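(* Let $s\in(0,1)$, $\gamma\in(0,1]$ and $\mathcal{Y}\ge1$. Let $V^0_{\mathcal{T}_{\mathcal{Y}}}=G_{\mathcal{T}_{\mathcal{Y}}}(\mathcal{H}_\alpha\mathsf{u}_0)$ and, for $k=0,\dots,\mathcal{K}-1$, let $V^{k+1}_{\mathcal{T}_{\mathcal{Y}}}\in\mathbb{V}(\mathcal{T}_{\mathcal{Y}})$ solve $$(\delta^\gamma\operatorname{tr}V^{k+1}_{\mathcal{T}_{\mathcal{Y}}},\operatorname{tr}W)_{L^2(\Omega)}+a_{\mathcal{Y}}(V^{k+1}_{\mathcal{T}_{\mathcal{Y}}},W)=\langle f^{k+1},\operatorname{tr}W\rangle\qquad\forall W\in\mathbb{V}(\mathcal{T}_{\mathcal{Y}}).$$ This fully discrete scheme is unconditionally stable for all $\gamma\in(0,1]$, i.e. $$I^{1-\gamma}\|\operatorname{tr}V^\tau_{\mathcal{T}_{\mathcal{Y}}}\|^2_{L^2(\Omega)}(T)+\|V^\tau_{\mathcal{T}_{\mathcal{Y}}}\|^2_{\ell^2(\mathring{H}^1_L(y^\alpha,\mathcal{C}_{\mathcal{Y}}))}\lesssim I^{1-\gamma}\|\operatorname{tr}V^0_{\mathcal{T}_{\mathcal{Y}}}\|^2_{L^2(\Omega)}(T)+\|f^\tau\|^2_{\ell^2(\mathbb{H}^{-s}(\Omega))},$$ where $I^0$ is the identity (case $\gamma=1$).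
   Context: $\Omega\subset\mathbb{R}^n$ ($n\ge1$) is open, bounded and connected with polyhedral boundary; $T>0$. $\mathcal{L}w=-\operatorname{div}(A\nabla w)+cw$ with $0\le c\in L^\infty(\Omega)$ and $A\in C^{0,1}(\Omega,GL(n,\mathbb{R}))$ symmetric and positive definite; it is assumed that $\|w\|_{H^2(\Omega)}\lesssim\|\mathcal{L}w\|_{L^2(\Omega)}$ for $w\in H^2(\Omega)\cap H^1_0(\Omega)$. $\{(\lambda_k,\varphi_k)\}$ are the Dirichlet eigenpairs of $\mathcal{L}$, $\{\varphi_k\}$ orthonormal in $L^2(\Omega)$; $\mathbb{H}^s(\Omega)=\{w=\sum_kw_k\varphi_k:\sum_k\lambda_k^sw_k^2=\|w\|^2_{\mathbb{H}^s(\Omega)}<\infty\}$, with dual $\mathbb{H}^{-s}(\Omega)$ and pairing $\langle\cdot,\cdot\rangle$. Set $\alpha=1-2s$, $d_s=2^\alpha\Gamma(1-s)/\Gamma(s)$, $\mathcal{C}_{\mathcal{Y}}=\Omega\times(0,\mathcal{Y})$ with points $(x',y)$, $\Gamma_D=(\partial\Omega\times[0,\mathcal{Y}])\cup(\Omega\times\{\mathcal{Y}\})$. $\mathring{H}^1_L(y^\alpha,\mathcal{C}_{\mathcal{Y}})=\{w\in H^1(y^\alpha,\mathcal{C}_{\mathcal{Y}}):w=0\text{ on }\Gamma_D\}$, where $H^1(y^\alpha,\cdot)$ is the Sobolev space for the measure $y^\alpha dx$; its norm is $\|\nabla w\|_{L^2(y^\alpha,\mathcal{C}_{\mathcal{Y}})}$.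 $\operatorname{tr}$ is the trace on $\Omega\times\{0\}$. $a_{\mathcal{Y}}(w,\phi)=\frac1{d_s}\int_{\mathcal{C}_{\mathcal{Y}}}y^\alpha\mathbf{A}\nabla w\cdot\nabla\phi+y^\alpha c\,w\phi$, $\mathbf{A}=\operatorname{diag}\{A,1\}$. $\mathcal{H}_\alpha\mathsf{u}_0\in\mathring{H}^1_L(y^\alpha,\mathcal{C}_{\mathcal{Y}})$ is the $\alpha$-harmonic extension: $\operatorname{tr}\mathcal{H}_\alpha\mathsf{u}_0=\mathsf{u}_0$ and $a_{\mathcal{Y}}(\mathcal{H}_\alpha\mathsf{u}_0,\phi)=0$ for all $\phi\in\mathring{H}^1_L(y^\alpha,\mathcal{C}_{\mathcal{Y}})$ with $\operatorname{tr}\phi=0$. $\mathcal{T}_{\mathcal{Y}}$ is a mesh of $\mathcal{C}_{\mathcal{Y}}$ into cells $K\times I$, with $K$ in a conforming shape-regular mesh $\mathcal{T}_\Omega$ of $\Omega$ (simplices or $n$-rectangles) and $I$ in a partition of $[0,\mathcal{Y}]$. $\mathbb{V}(\mathcal{T}_{\mathcal{Y}})=\{W\in C^0(\bar{\mathcal{C}}_{\mathcal{Y}}):W|_{K\times I}\in\mathcal{P}_1(K)\otimes\mathbb{P}_1(I)\ \forall K\times I\in\mathcal{T}_{\mathcal{Y}},\ W|_{\Gamma_D}=0\}$, with $\mathcal{P}_1(K)=\mathbb{P}_1(K)$ for simplices and $\mathbb{Q}_1(K)$ for $n$-rectangles. $G_{\mathcal{T}_{\mathcal{Y}}}:\mathring{H}^1_L(y^\alpha,\mathcal{C}_{\mathcal{Y}})\to\mathbb{V}(\mathcal{T}_{\mathcal{Y}})$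 is defined by $a_{\mathcal{Y}}(G_{\mathcal{T}_{\mathcal{Y}}}w,W)=a_{\mathcal{Y}}(w,W)$ for all $W\in\mathbb{V}(\mathcal{T}_{\mathcal{Y}})$. $\mathcal{K}\in\mathbb{N}$, $\tau=T/\mathcal{K}$, $t_k=k\tau$, $f^k=f(t_k)$. $\delta^1\phi^{k+1}=\tau^{-1}(\phi^{k+1}-\phi^k)$; for $\gamma\in(0,1)$, $\delta^\gamma\phi^{k+1}=\frac1{\Gamma(2-\gamma)}\sum_{j=0}^ka_j\tau^{-\gamma}(\phi^{k+1-j}-\phi^{k-j})$, $a_j=(j+1)^{1-\gamma}-j^{1-\gamma}$. $\|\phi^\tau\|^2_{\ell^2(\mathcal{X})}=\sum_{k=1}^{\mathcal{K}}\tau\|\phi^k\|^2_{\mathcal{X}}$. $(I^\sigma g)(t)=\frac1{\Gamma(\sigma)}\int_0^t(t-r)^{\sigma-1}g(r)\,dr$ for $\sigma>0$; when applied to $\|\phi^\tau\|^2$ the sequence is identified with the function equal to $\phi^l$ on $(t_{l-1},t_l]$; when applied to a number, that number is regarded as a constant function. $a\lesssim b$ means $a\le Cb$ with a nonessential constant $C$, independent of the data and of the discretization parameters; ''unconditionally'' means with no restriction on $\tau$. *)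

(* Defs.v *)
From HB Require Import structures.
From mathcomp Require Import all_boot all_order all_algebra.
From mathcomp Require Import all_classical all_reals all_analysis.
Set Implicit Arguments.
Unset Strict Implicit.
Unset Printing Implicit Defensive.
Import Order.TTheory GRing.Theory Num.Theory.
Import numFieldNormedType.Exports.
Local Open Scope classical_set_scope.
Local Open Scope ring_scope.

(** R^n is ['rV[R]_n] with the sigma-algebra generated by the coordinates.
    [leb n] is obtained from the one-dimensional Lebesgue measure by iterated
    products, adding the last coordinate at each step. *)

Definition rv_display : measure_display.
Proof. exact: default_measure_display. Qed.

Section measurable_rv.
Context {R : realType} (n : nat).

Let coords : 'I_n -> 'rV[R]_n -> measurableTypeR R := fun i x => x 0 i.

Let rv_set0 : g_sigma_preimage coords set0.
Proof. exact: sigma_algebra0. Qed.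

Let rv_setC B : g_sigma_preimage coords B -> g_sigma_preimage coords (~` B).
Proof. exact: sigma_algebraC. Qed.

Let rv_bigcup (F : (set 'rV[R]_n)^nat) :
  (forall i, g_sigma_preimage coords (F i)) ->
  g_sigma_preimage coords (\bigcup_i F i).
Proof. exact: sigma_algebra_bigcup. Qed.

HB.instance Definition _ := @isMeasurable.Build rv_display
  'rV[R]_n (g_sigma_preimage coords) rv_set0 rv_setC rv_bigcup.

End measurable_rv.

Lemma measurable_coord (R : realType) n (i : 'I_n) :
  measurable_fun [set: 'rV[R]_n] (fun x => x 0 i : measurableTypeR R).
Proof.
move=> _ Y mY; rewrite setTI; apply: sub_sigma_algebra => /=.
rewrite -bigcup_seq/=; exists i => /=; first by rewrite mem_index_enum.
by exists Y => //; rewrite setTI.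
Qed.

Lemma measurable_rvP (R : realType) n d (T : measurableType d)
    (f : T -> 'rV[R]_n) :
  (forall i, measurable_fun setT (fun t => f t 0 i : measurableTypeR R)) ->
  measurable_fun setT f.
Proof.
move=> mf _ Y mY; rewrite setTI.
suff H : @measurable _ 'rV[R]_n `<=` [set B | measurable (f @^-1` B)] by exact: H.
apply: smallest_sub.
  split => [|B|F]/=; first by rewrite preimage_set0.
    by rewrite setTD preimage_setC; exact: measurableC.
  by move=> mF; rewrite preimage_bigcup; exact: bigcup_measurable.
move=> B; rewrite -bigcup_seq/= => -[i _ [C mC <-]] /=.
by rewrite setTI; have := mf i measurableT _ mC; rewrite setTI.
Qed.

Section points.
Context {R : realType} (n : nat).

(** Points (x', y) of R^n x R are encoded in ['rV_n.+1], y being the last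
    coordinate; [hor] and [ver] also split a gradient into its parts. *)
Definition pt (x : 'rV[R]_n) (y : R) : 'rV[R]_n.+1 :=
  \row_i (if unlift ord_max i is Some j then x 0 j else y).

Definition hor (z : 'rV[R]_n.+1) : 'rV[R]_n := col' ord_max z.

Definition ver (z : 'rV[R]_n.+1) : R := z 0 ord_max.

Lemma ptK (z : 'rV[R]_n.+1) : pt (hor z) (ver z) = z.
Proof.
apply/rowP => i; rewrite !mxE; case: unliftP => [j ->|->] //.
by rewrite !mxE.
Qed.

Lemma hor_pt x y : hor (pt x y) = x.
Proof. by apply/rowP => i; rewrite !mxE liftK. Qed.

Lemma ver_pt x y : ver (pt x y) = y.
Proof. by rewrite /ver !mxE unlift_none. Qed.

Lemma measurable_pt : measurable_fun
  [set: ('rV[R]_n * measurableTypeR R)%type] (fun p => pt p.1 p.2).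
Proof.
apply: measurable_rvP => i; case: (unliftP ord_max i) => [j ->|->].
  under eq_fun do rewrite mxE liftK.
  exact: (measurableT_comp (measurable_coord j) measurable_fst).
under eq_fun do rewrite mxE unlift_none.
exact: measurable_snd.
Qed.

Lemma measurable_hv : measurable_fun [set: 'rV[R]_n.+1]
  (fun z => (hor z, ver z) : ('rV[R]_n * measurableTypeR R)%type).
Proof.
apply: measurable_fun_pair; last exact: measurable_coord.
apply: measurable_rvP => i; under eq_fun do rewrite mxE.
exact: measurable_coord.
Qed.

Section leb_step.
Variable mu : {sigma_finite_measure set 'rV[R]_n -> \bar R}.

Definition leb_step : set 'rV[R]_n.+1 -> \bar R :=
  pushforward (mu \x @lebesgue_measure R)%E (fun p => pt p.1 p.2).

Let leb_step0 : leb_step set0 = 0%E.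
Proof. by rewrite /leb_step /pushforward preimage_set0 measure0. Qed.

Let leb_step_ge0 B : (0 <= leb_step B)%E.
Proof.
apply: (@measure_ge0 _ _ _ (mu \x @lebesgue_measure R)%E).
Qed.

Let leb_step_sigma_additive : semi_sigma_additive leb_step.
Proof.
move=> F mF tF mUF; rewrite /leb_step /pushforward preimage_bigcup.
apply: measure_semi_sigma_additive.
- by move=> k; rewrite -[X in measurable X]setTI; exact: measurable_pt.
- apply/trivIsetP => /= i j _ _ ij; rewrite -preimage_setI.
  by move/trivIsetP : tF => /(_ _ _ _ _ ij) ->//; rewrite preimage_set0.
- by rewrite -preimage_bigcup -[X in measurable X]setTI; exact: measurable_pt.
Qed.

HB.instance Definition _ := isMeasure.Build _ _ _ leb_step
  leb_step0 leb_step_ge0 leb_step_sigma_additive.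

Let leb_step_sigma_finite : sigma_finite setT leb_step.
Proof.
have [F FT Foo] : sigma_finite setT (mu \x @lebesgue_measure R)%E.
  have /sigma_finiteP[F [TF ndF Foo]] := sigma_finiteT mu.
  have /sigma_finiteP[G [TG ndG Goo]] := sigma_finiteT (@lebesgue_measure R).
  exists (fun k => F k `*` G k).
    rewrite -setXTT TF TG predeqE => -[x y]; split.
      move=> [/= [k _ Fkx] [l _ Gly]]; exists (maxn k l) => //; split.
      - by move: x Fkx; exact/subsetPset/ndF/leq_maxl.
      - by move: y Gly; exact/subsetPset/ndG/leq_maxr.
    by move=> [k _ []/= ? ?]; split; exists k.
  move=> k; have [? ?] := Foo k; have [? ?] := Goo k.
  split; first exact: measurableX.
  by rewrite product_measure1E// lte_mul_pinfty// ge0_fin_numE.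
exists (fun k => (fun z => (hor z, ver z)) @^-1` F k).
  by rewrite -preimage_bigcup -FT preimage_setT.
move=> k; have [mF Fk] := Foo k; split.
  by rewrite -[X in measurable X]setTI; exact: measurable_hv.
rewrite /leb_step /pushforward (_ : _ @^-1` _ = F k)//.
by apply/seteqP; split => -[x y] /=; rewrite hor_pt ver_pt.
Qed.

HB.instance Definition _ := Measure_isSigmaFinite.Build _ _ _ leb_step
  leb_step_sigma_finite.

End leb_step.
End points.

Fixpoint leb {R : realType} (n : nat) :
    {sigma_finite_measure set 'rV[R]_n -> \bar R} :=
  match n with
  | 0 => dirac (0 : 'rV[R]_0) : {sigma_finite_measure set 'rV[R]_0 -> \bar R}
  | m.+1 => leb_step (leb m) : {sigma_finite_measure set 'rV[R]_m.+1 -> \bar R}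
  end.
Arguments leb {R n}.

Section euclidean.
Context {R : realType}.

Definition dot n (u v : 'rV[R]_n) : R := \sum_i u 0 i * v 0 i.

(** The library norm of ['rV[R]_n] is the sup norm. *)
Definition enorm n (u : 'rV[R]_n) : R := Num.sqrt (dot u u).

Definition unit_vec n (i : 'I_n) : 'rV[R]_n := delta_mx 0 i.

End euclidean.

(** As in Brezis' book, weak derivatives are tested with C^1 functions of
    compact support, and H^1_0 is the closure of the latter. *)

Section sobolev.
Context {R : realType} {n : nat}.
Implicit Types (U : set 'rV[R]_n) (w rho f g : 'rV[R]_n -> R).

Definition C1 f := forall i,
  (forall x, derivable f x (unit_vec i)) /\ continuous ('D_(unit_vec i) f).

Definition C1c U f := C1 f /\
  exists K, [/\ compact K, K `<=` U & forall x, ~ K x -> f x = 0].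

Definition locally_int U w := measurable_fun U w /\
  forall K, compact K -> K `<=` U -> leb.-integrable K (EFin \o w).

Definition is_weak_partial U i w g :=
  [/\ locally_int U w, locally_int U g & forall f, C1c U f ->
    \int[leb]_(x in U) (w x * 'D_(unit_vec i) f x)
    = - \int[leb]_(x in U) (g x * f x)].

Definition is_weak_grad U w (G : 'rV[R]_n -> 'rV[R]_n) :=
  forall i : 'I_n, is_weak_partial U i w (fun x => G x 0 i).

(** Weak gradients are unique almost everywhere; [wgrad] picks one. *)
Definition wgrad U w : 'rV[R]_n -> 'rV[R]_n :=
  xget (fun=> 0) (is_weak_grad U w).

Definition is_weak_div U (F : 'rV[R]_n -> 'rV[R]_n) g :=
  [/\ forall i : 'I_n, locally_int U (fun x => F x 0 i), locally_int U g &
    forall f, C1c U f ->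
      \int[leb]_(x in U) (\sum_i F x 0 i * 'D_(unit_vec i) f x)
      = - \int[leb]_(x in U) (g x * f x)].

Definition wdiv U F : 'rV[R]_n -> R := xget (fun=> 0) (is_weak_div U F).

(** Below, [rho] is a weight: these are spaces for the measure rho dx. *)
Definition L2sq U rho w : \bar R :=
  (\int[leb]_(x in U) (rho x * w x ^+ 2)%:E)%E.

Definition L2 U rho w := measurable_fun U w /\ (L2sq U rho w < +oo)%E.

Definition gradsq U rho w : \bar R :=
  (\int[leb]_(x in U) (rho x * dot (wgrad U w x) (wgrad U w x))%:E)%E.

Definition H1sq U rho w : \bar R := (L2sq U rho w + gradsq U rho w)%E.

Definition H1 U rho w :=
  [/\ L2 U rho w, exists G, is_weak_grad U w G &
      forall i : 'I_n, L2 U rho (fun x => wgrad U w x 0 i)].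

Definition H1_cvg U rho (f : nat -> 'rV[R]_n -> R) w :=
  H1sq U rho (w \- f j) @[j --> \oo] --> 0%E.

Definition one_weight : 'rV[R]_n -> R := fun=> 1.

Definition L2norm U w : R := Num.sqrt (fine (L2sq U one_weight w)).

Definition L2dot U w g : R := \int[leb]_(x in U) (w x * g x).

Definition H10 U w := H1 U one_weight w /\
  exists2 f : nat -> 'rV[R]_n -> R,
    forall j, C1c U (f j) & H1_cvg U one_weight f w.

Definition H2 U w := H1 U one_weight w /\
  forall i : 'I_n, H1 U one_weight (fun x => wgrad U w x 0 i).

Definition H2norm U w : R := Num.sqrt (fine
  (H1sq U one_weight w +
   \sum_(i < n) gradsq U one_weight (fun x => wgrad U w x 0%R i))%E).

End sobolev.

Section domain_operator.
Context {R : realType} {n : nat}.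
Implicit Types (Omega : set 'rV[R]_n) (A : 'rV[R]_n -> 'M[R]_n)
  (c w v : 'rV[R]_n -> R).

Definition hull m (v : 'I_m -> 'rV[R]_n) : set 'rV[R]_n :=
  [set x | exists t : 'I_m -> R,
    [/\ forall i, 0 <= t i, \sum_i t i = 1 & x = \sum_i t i *: v i]].

Definition affinely_independent m (v : 'I_m -> 'rV[R]_n) :=
  forall t : 'I_m -> R,
    \sum_i t i = 0 -> \sum_i t i *: v i = 0 -> forall i, t i = 0.

(** The boundary of the open set [Omega] is a finite union of
    (n-1)-simplices. *)
Definition polyhedral_boundary Omega :=
  exists (N : nat) (v : 'I_N -> 'I_n -> 'rV[R]_n),
    (forall j, affinely_independent (v j)) /\
    closure Omega `\` Omega = \bigcup_j hull (v j).

(** The class C^{0,1} and the positive definiteness are understood up to the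
    boundary, so that, [Omega] being bounded, L is uniformly elliptic. *)
Definition admissible_A Omega A :=
  [/\ [lipschitz A x | x in closure Omega],
      forall x, closure Omega x -> A x \in unitmx,
      forall x, closure Omega x -> (A x)^T = A x &
      forall x, closure Omega x ->
        forall xi, xi != 0 -> 0 < dot (xi *m (A x)^T) xi].

Definition admissible_c Omega c := measurable_fun Omega c /\
  exists M : R, {ae leb, forall x, Omega x -> 0 <= c x <= M}.

(** Gradients are row vectors: A grad w is [G *m (A x)^T]. *)
Definition flux A (G : 'rV[R]_n -> 'rV[R]_n) : 'rV[R]_n -> 'rV[R]_n :=
  fun x => G x *m (A x)^T.

Definition Lop Omega A c w : 'rV[R]_n -> R :=
  fun x => - wdiv Omega (flux A (wgrad Omega w)) x + c x * w x.

Definition H2_regular Omega A c := exists C : R, forall w,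
  H2 Omega w -> H10 Omega w ->
  H2norm Omega w <= C * L2norm Omega (Lop Omega A c w).

Definition form_L Omega A c w v : R := \int[leb]_(x in Omega)
  (dot (flux A (wgrad Omega w) x) (wgrad Omega v x) + c x * w x * v x).

(** All the Dirichlet eigenpairs of L, in weak form, counted with
    multiplicity: the eigenfunctions form a Hilbert basis of L^2. *)
Definition dirichlet_eigenpairs Omega A c
    (lam : nat -> R) (phi : nat -> 'rV[R]_n -> R) :=
  [/\ forall k, H10 Omega (phi k),
      forall k v, H10 Omega v ->
        form_L Omega A c (phi k) v = lam k * L2dot Omega (phi k) v,
      forall j k, L2dot Omega (phi j) (phi k) = (j == k)%:R &
      forall w, L2 Omega one_weight w ->
        (forall k, L2dot Omega w (phi k) = 0) ->
        {ae leb, forall x, Omega x -> w x = 0}].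

End domain_operator.

Section spectral.
Context {R : realType} {n : nat}.
Variables (Omega : set 'rV[R]_n) (lam : nat -> R) (phi : nat -> 'rV[R]_n -> R)
  (s : R).
Implicit Types (w v : 'rV[R]_n -> R) (F : ('rV[R]_n -> R) -> R).

Definition Hs_sq w : \bar R :=
  (\sum_(0 <= k <oo) (lam k `^ s * L2dot Omega w (phi k) ^+ 2)%:E)%E.

Definition Hs w := L2 Omega one_weight w /\ (Hs_sq w < +oo)%E.

Definition Hs_norm w : R := Num.sqrt (fine (Hs_sq w)).

(** Boundedness makes [F w] depend on the class of w in L^2 only. *)
Definition Hs_dual F :=
  (forall a w v, Hs w -> Hs v -> F (fun x => a * w x + v x) = a * F w + F v) /\
  exists C : R, forall w, Hs w -> `|F w| <= C * Hs_norm w.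

Definition Hs_dual_norm F : R :=
  sup [set `|F w| | w in [set w | Hs w /\ Hs_norm w <= 1]].

End spectral.

Section cylinder.
Context {R : realType} {n : nat}.
Variables (Omega : set 'rV[R]_n) (Y : R).
Implicit Types (w v : 'rV[R]_n.+1 -> R) (u : 'rV[R]_n -> R).

Definition cyl : set 'rV[R]_n.+1 :=
  [set z | Omega (hor z) /\ 0 < ver z < Y].

Definition Gamma_D : set 'rV[R]_n.+1 :=
  [set z | (closure Omega `\` Omega) (hor z) /\ 0 <= ver z <= Y] `|`
  [set z | Omega (hor z) /\ ver z = Y].

Definition weight (s : R) : 'rV[R]_n.+1 -> R := fun z => ver z `^ (1 - 2 * s).

Definition vanishes_near (D : set 'rV[R]_n.+1) w :=
  exists N, [/\ open N, D `<=` N & forall z, N z -> w z = 0].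

(** [w = 0] on [Gamma_D] means that w is a limit of C^1 functions vanishing
    near [Gamma_D]; its trace on Omega x {0} is the limit in L^2 of the
    restrictions of any such sequence. *)
Definition smooth_approx (s : R) w (f : nat -> 'rV[R]_n.+1 -> R) :=
  (forall j, C1 (f j) /\ vanishes_near Gamma_D (f j)) /\
  H1_cvg cyl (weight s) f w.

Definition H1L (s : R) w :=
  H1 cyl (weight s) w /\ exists f, smooth_approx s w f.

Definition H1L_norm (s : R) w : R :=
  Num.sqrt (fine (gradsq cyl (weight s) w)).

Definition restr0 w : 'rV[R]_n -> R := fun x => w (pt x 0).

Definition is_trace (s : R) w u := L2 Omega one_weight u /\
  exists2 f, smooth_approx s w f &
    L2sq Omega one_weight (restr0 (f j) \- u) @[j --> \oo] --> 0%E.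

Definition EulerGamma (x : R) : R :=
  \int[@lebesgue_measure R]_(t in `]0, +oo[) (t `^ (x - 1) * expR (- t)).

Definition d_ (s : R) : R :=
  2 `^ (1 - 2 * s) * EulerGamma (1 - s) / EulerGamma s.

Definition form_Y (A : 'rV[R]_n -> 'M[R]_n) (c : 'rV[R]_n -> R) (s : R) w v
    : R :=
  (d_ s)^-1 * \int[leb]_(z in cyl)
    (weight s z *
      (dot (hor (wgrad cyl w z) *m (A (hor z))^T) (hor (wgrad cyl v z)) +
       ver (wgrad cyl w z) * ver (wgrad cyl v z)) +
     weight s z * c (hor z) * w z * v z).

Definition is_alpha_harmonic_extension A c s u w :=
  [/\ H1L s w, is_trace s w u &
      forall v, H1L s v -> is_trace s v (fun=> 0) -> form_Y A c s w v = 0].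

End cylinder.

Inductive cell (R : realType) (n : nat) :=
  | Simplex of 'I_n.+1 -> 'rV[R]_n
  | Rectangle of 'rV[R]_n & 'rV[R]_n.

Section mesh.
Context {R : realType} {n : nat}.
Implicit Types (K : cell R n) (F : set 'rV[R]_n) (p : 'rV[R]_n -> R).

Definition cell_set K : set 'rV[R]_n :=
  match K with
  | Simplex v => hull v
  | Rectangle a b => [set x | forall i, a 0 i <= x 0 i <= b 0 i]
  end.

Definition nondegenerate K :=
  match K with
  | Simplex v => affinely_independent v
  | Rectangle a b => forall i, a 0 i < b 0 i
  end.

(** Proper faces, of any dimension between 0 and n-1. *)
Definition is_face K F :=
  match K with
  | Simplex v => exists S : {set 'I_n.+1},
      [/\ S != finset.set0, S != finset.setT &
          F = [set x | exists t : 'I_n.+1 -> R,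
            [/\ forall i, 0 <= t i, \sum_i t i = 1,
                forall i, i \notin S -> t i = 0 &
                x = \sum_i t i *: v i]]]
  | Rectangle a b => exists (S : {set 'I_n}) (e : 'rV[R]_n),
      [/\ S != finset.set0,
          forall i, i \in S -> e 0 i = a 0 i \/ e 0 i = b 0 i &
          F = [set x | cell_set (Rectangle a b) x /\
                       forall i, i \in S -> x 0 i = e 0 i]]
  end.

(** The local space: P_1 for simplices, Q_1 for rectangles. *)
Definition local_poly K p :=
  match K with
  | Simplex _ => exists (a : R) (b : 'rV[R]_n), forall x, p x = a + dot b x
  | Rectangle _ _ => exists a : {set 'I_n} -> R,
      forall x, p x = \sum_(S : {set 'I_n}) a S * \prod_(i in S) x 0 i
  end.

Definition conforming_mesh (Omega : set 'rV[R]_n) N (K : 'I_N -> cell R n) :=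
  [/\ forall i, nondegenerate (K i),
      closure Omega = \bigcup_i cell_set (K i) &
      forall i j, i != j ->
        cell_set (K i) `&` cell_set (K j) = set0 \/
        (is_face (K i) (cell_set (K i) `&` cell_set (K j)) /\
         is_face (K j) (cell_set (K i) `&` cell_set (K j)))].

(** The diameter of each cell is at most [sigma] times the diameter [2 * r]
    of some inscribed Euclidean ball. *)
Definition shape_regular (sigma : R) N (K : 'I_N -> cell R n) :=
  forall i, exists z r,
    [/\ 0 < r, [set x | enorm (x - z) < r] `<=` cell_set (K i) &
        forall x x', cell_set (K i) x -> cell_set (K i) x' ->
          enorm (x - x') <= sigma * (2 * r)].

(** The cells I are the intervals [yy j, yy j.+1], j < M. *)
Definition is_partition (Y : R) (M : nat) (yy : nat -> R) :=
  [/\ yy 0%N = 0, yy M = Y & forall j, (j < M)%N -> yy j < yy j.+1].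

(** An element of P(K) (x) P_1(I) is p(x') + y q(x') with p, q in P(K). *)
Definition in_V (Omega : set 'rV[R]_n) (Y : R) N (K : 'I_N -> cell R n)
    (M : nat) (yy : nat -> R) (W : 'rV[R]_n.+1 -> R) :=
  [/\ {within closure (cyl Omega Y), continuous W},
      forall i j, (j < M)%N -> exists p q,
        [/\ local_poly (K i) p, local_poly (K i) q &
            forall x y, cell_set (K i) x -> yy j <= y <= yy j.+1 ->
              W (pt x y) = p x + y * q x] &
      forall z, Gamma_D Omega Y z -> W z = 0].

Definition is_galerkin_projection (Omega : set 'rV[R]_n) (Y : R)
    (A : 'rV[R]_n -> 'M[R]_n) (c : 'rV[R]_n -> R) (s : R)
    N (K : 'I_N -> cell R n) M yy (w W : 'rV[R]_n.+1 -> R) :=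
  in_V Omega Y K M yy W /\
  forall W', in_V Omega Y K M yy W' ->
    form_Y Omega Y A c s W W' = form_Y Omega Y A c s w W'.

End mesh.

Section time.
Context {R : realType}.

(** [frac_diff gamma tau g k] is the discrete derivative of order [gamma] of g
    at index k+1. *)
Definition frac_diff (gamma tau : R) (g : nat -> R) (k : nat) : R :=
  if gamma == 1 then tau^-1 * (g k.+1 - g k)
  else (EulerGamma (2 - gamma))^-1 *
    \sum_(0 <= j < k.+1)
      (j.+1%:R `^ (1 - gamma) - j%:R `^ (1 - gamma)) *
      tau `^ (- gamma) * (g (k.+1 - j)%N - g (k - j)%N).

(** The function equal to [g l] on (t_(l-1), t_l], where t_l = l tau. *)
Definition step_fun (tau : R) (g : nat -> R) : R -> R :=
  fun t => g `|Num.ceil (t / tau)|%N.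

Definition frac_int (sigma : R) (g : R -> R) (t : R) : R :=
  if sigma == 0 then g t
  else (EulerGamma sigma)^-1 *
    \int[@lebesgue_measure R]_(r in `]0, t[) ((t - r) `^ (sigma - 1) * g r).

End time.

(** The values of a continuous W on Omega x {0} are its trace; they are
    [restr0 W]. *)
Definition fully_discrete_scheme {R : realType} {n : nat}
    (Omega : set 'rV[R]_n) (Y : R) (A : 'rV[R]_n -> 'M[R]_n)
    (c : 'rV[R]_n -> R) (s gamma tau : R) N (K : 'I_N -> cell R n) M yy
    (f : R -> ('rV[R]_n -> R) -> R) (KK : nat)
    (V : nat -> 'rV[R]_n.+1 -> R) :=
  forall k, (k < KK)%N -> in_V Omega Y K M yy (V k.+1) /\
    forall W, in_V Omega Y K M yy W ->
      L2dot Omega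
        (fun x => frac_diff gamma tau (fun j => restr0 (V j) x) k) (restr0 W)
      + form_Y Omega Y A c s (V k.+1) W
      = f (k.+1%:R * tau) (restr0 W).

(* Main.v *)
(** Testing the scheme with [W = V k.+1] gives, by coercivity of [form_Y],
    (D r, r) + c0 |grad V|^2 <= |F|_(-s) |tr V|_s, with r the trace of V and D
    the discrete fractional derivative.  The coefficients of D are nonnegative
    and nonincreasing, so Abel summation yields (D r) r >= D(r^2) / 2, and the
    sum over time of tau D(r^2) telescopes into the difference of the two
    fractional integrals, up to a positive factor.

    The trace inequality |tr V|_s^2 <= C |grad V|^2 is proved mode by mode: for
    v(y) = (u(., y), phi_k), lam^s v(0)^2 is bounded by the integral of
    y^alpha (v'^2 + lam v^2), splitting at y = lam^(-1/2), and Bessel's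
    inequality in L^2 and in the energy form sums the modes.  This needs u of
    class C^1 with compact support in Omega x (-Y, Y); a discrete function,
    extended evenly in y and by zero, is Lipschitz and, off finitely many
    hyperplanes, strictly differentiable, so truncated mollifications of it
    are such functions and their gradients converge almost everywhere. *)

Require Import Defs.
From mathcomp Require Import all_boot all_order all_algebra.
From mathcomp Require Import all_classical all_reals all_analysis.
From mathcomp Require Import measurable_realfun ring lra.
Set Implicit Arguments.
Unset Strict Implicit.
Unset Printing Implicit Defensive.
Import Order.TTheory GRing.Theory Num.Theory.
Import numFieldNormedType.Exports.
Local Open Scope classical_set_scope.
Local Open Scope ring_scope.

(** * Lebesgue measure on row vectors *)

(** The trace and coercivity constants must be fixed before any mesh appears, so a mesh may only
    supply qualitative facts: its Lipschitz constants serve to dominate integrands and never enter a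
    final bound. The trace inequality passes to the limit between two integrals, for which almost
    everywhere convergence of uniformly bounded gradients is enough. Reflecting in y makes the face
    y = 0 interior, so that mollifications can be centred there. Mollification pushes the support
    across the boundary of Omega x (-Y, Y); truncating the values instead of moving the domain
    confines it to a superlevel set of |w|, which is compact inside that cylinder. Compact support
    matters because the slices at fixed y must lie in H^1_0(Omega), where the eigenvalue relation
    can be tested. Since [wgrad] is an arbitrary choice among weak gradients, each explicit gradient
    is tied to it by almost everywhere uniqueness. *)

Section leb_basics.
Context {R : realType}.

Lemma rv_ballP n (x y : 'rV[R]_n) e : 0 < e ->
  ball x e y <-> forall i, `|x 0 i - y 0 i| < e.
Proof.
move=> e0; split=> [[_ H] i|H]; first exact: H.
by split=> // i j; rewrite ord1; exact: H.
Qed.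

Lemma rv_norm_ltP n (x : 'rV[R]_n) e : 0 < e ->
  `|x| < e <-> forall i, `|x 0 i| < e.
Proof.
move=> e0; have := @rv_ballP n 0 x e e0.
rewrite mx_norm_ball /ball_ /= sub0r normrN => -[H1 H2]; split=> [/H1 H i|H].
  by have := H i; rewrite mxE sub0r normrN.
by apply: H2 => i; rewrite mxE sub0r normrN.
Qed.

Lemma rv_coord_le n (x : 'rV[R]_n) i : `|x 0 i| <= `|x|.
Proof.
apply/ler_addgt0Pr => e e0; apply/ltW.
have/(rv_norm_ltP x) : 0 < `|x| + e by rewrite ltr_wpDl.
by rewrite ltrDl e0 => -[/(_ isT)].
Qed.

Lemma rv_norm_leP n (x : 'rV[R]_n) e : 0 <= e ->
  `|x| <= e <-> forall i, `|x 0 i| <= e.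
Proof.
move=> e0; split=> [xe i|H]; first exact: le_trans (rv_coord_le _ _) _.
apply/ler_addgt0Pr => d d0; apply/ltW/rv_norm_ltP; first by rewrite ltr_wpDl.
by move=> i; rewrite (le_lt_trans (H i))// ltrDl.
Qed.

(** The sigma-algebra is generated by the coordinates and not by the topology, so the result rests
    on countability: an open set is the union of the boxes with rational centre and radius that it
    contains, enumerated by [unpickle]. *)
Lemma open_rv_measurable n (U : set 'rV[R]_n) : open U -> measurable U.
Proof.
move=> oU.
pose box (p : 'rV[rat]_n * rat) : set 'rV[R]_n :=
  [set y | forall i, `|y 0 i - ratr (p.1 0 i)| < ratr p.2].
pose D := [set p | box p `<=` U].
have -> : U = \bigcup_(p in D) box p.
  apply/seteqP; split=> [x Ux|x [p Dp]]; last exact: Dp.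
  have /nbhs_ballP[e /= e0 eU] := open_nbhs_nbhs (conj oU Ux).
  have [q /[!in_itv]/= /andP[q0 qe]] : exists q : rat, (ratr q : R) \in `]0, e / 2[.
    by apply: rat_in_itvoo; rewrite divr_gt0.
  have /choice[f Hf] : forall i : 'I_n, exists r : rat, `|x 0 i - ratr r| < ratr q.
    move=> i; have [r /[!in_itv]/= /andP[? ?]] :
        exists r : rat, (ratr r : R) \in `]x 0 i - ratr q, x 0 i + ratr q[.
      by apply: rat_in_itvoo; lra.
    by exists r; rewrite ltr_distl; apply/andP; split; lra.
  exists (\row_i f i, q) => /=; last by move=> i; rewrite mxE.
  move=> y Hy; apply: eU; apply/rv_ballP => // i.
  have := Hy i; have := Hf i; rewrite /= mxE => H1 H2.
  rewrite (_ : _ - _ = (x 0 i - ratr (f i)) - (y 0 i - ratr (f i))); last by ring.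
  by rewrite (le_lt_trans (ler_normB _ _))//; lra.
rewrite (_ : bigcup _ _ = \bigcup_k (if unpickle k is Some p then
    if `[< D p >] then box p else set0 else set0)); last first.
  apply/seteqP; split=> [x [p Dp xp]|x [k _]].
    by exists (pickle p) => //; rewrite pickleK asboolT.
  case: unpickle => [p|//]; case: asboolP => // Dp xp; by exists p.
apply: bigcupT_measurable => k; case: unpickle => [p|//]; case: ifP => // _.
rewrite (_ : box p = \bigcap_(i in [set: 'I_n])
  [set y : 'rV[R]_n | `|y 0 i - ratr (p.1 0 i)| < ratr p.2]); last first.
  by apply/seteqP; split=> [y H i _|y H i]; exact: H.
apply: fin_bigcap_measurable => // i _.
rewrite (_ : [set y | _] = (fun x : 'rV[R]_n => x 0 i : measurableTypeR R) @^-1`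
  ball (ratr (p.1 0 i) : R) (ratr p.2)); last first.
  by apply/seteqP; split => y; rewrite /= /ball /= distrC.
rewrite -[X in measurable X]setTI; apply: measurable_coord => //.
by rewrite ball_itv.
Qed.

Lemma closed_rv_measurable n (U : set 'rV[R]_n) : closed U -> measurable U.
Proof.
by move=> cU; rewrite -(setCK U); apply: measurableC; apply: open_rv_measurable; exact: closed_openC.
Qed.

Lemma continuous_rv_measurable n (f : 'rV[R]_n -> R) (D : set 'rV[R]_n) :
  measurable D -> continuous f -> measurable_fun D f.
Proof.
move=> mD cf; apply: (measurability _ (RGenOpens.measurableE R)).
move=> _ [_ [a [b ->] <-]]; apply: measurableI => //.
by apply: open_rv_measurable; move/continuousP: cf; apply; exact: interval_open.
Qed.

Lemma leb_tonelli n (f : 'rV[R]_n.+1 -> \bar R) :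
  measurable_fun setT f -> (forall z, (0 <= f z)%E) ->
  (\int[leb]_z f z =
   \int[@lebesgue_measure R]_y \int[leb]_x f (pt x y))%E.
Proof.
move=> mf f0; rewrite /=.
have mpt := @measurable_pt R n.
rewrite [LHS](@ge0_integral_pushforward _ _ _ _ R _ mpt
  (@leb R n \x @lebesgue_measure R)%E setT f) //.
rewrite preimage_setT fubini_tonelli2 //.
  exact: measurableT_comp mf mpt.
by move=> x; exact: f0.
Qed.

(** The image of the Lebesgue measure under a translation gives half-open intervals the same length,
    and a measure is determined by these. *)
Lemma lebesgue_ge0_translation (f : R -> \bar R) (a : R) :
  measurable_fun setT f -> (forall z, (0 <= f z)%E) ->
  (\int[@lebesgue_measure R]_y f (y + a)%R = \int[@lebesgue_measure R]_y f y)%E.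
Proof.
move=> mf f0.
have mt : measurable_fun [set: measurableTypeR R]
    ((fun y : R => y + a) : measurableTypeR R -> measurableTypeR R).
  exact: measurable_funD.
pose nu := measure_function_pushforward__canonical__measure_function_Measure
  (@lebesgue_measure R) mt.
have E : forall X, ocitv X -> lebesgue_measure X = nu X.
  move=> _ [[x y] _ <-]; rewrite /pushforward /=.
  rewrite [RHS](_ : _ = lebesgue_measure `]x - a, y - a]%classic); last first.
    apply: (congr1 (@lebesgue_measure R)).
    by apply/seteqP; split=> z; rewrite /= !in_itv/= ltrBlDr lerBrDr.
  rewrite !lebesgue_measure_itv/= !lte_fin ltrD2r; case: ifP => // _.
  by rewrite -!EFinB opprB addrA subrK.
transitivity (\int[nu]_y f y)%E.
  by rewrite ge0_integral_pushforward.
apply: (@eq_measure_integral _ _ R setT (@lebesgue_measure R) nu f) => A mA _.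
exact/esym/(lebesgue_measure_unique E).
Qed.

Lemma leb_ge0_translation n (f : 'rV[R]_n -> \bar R) (a : 'rV[R]_n) :
  measurable_fun setT f -> (forall z, (0 <= f z)%E) ->
  (\int[leb]_y f (y + a)%R = \int[leb]_y f y)%E.
Proof.
elim: n f a => [|n IH] f a mf f0.
  by congr integral; apply/funext => x; congr f; apply/rowP => -[].
have mt m (b : 'rV[R]_m) : measurable_fun setT (fun y : 'rV[R]_m => y + b).
  apply: measurable_rvP => i; under eq_fun do rewrite mxE.
  by apply: measurable_funD => //; exact: measurable_coord.
rewrite !leb_tonelli //; last exact: (measurableT_comp mf (mt _ a)).
have ptD x y : pt x y + a = pt (x + hor a) (y + ver a).
  apply/rowP => i; rewrite !mxE; case: unliftP => [j ->|->]; last by [].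
  by rewrite !mxE.
transitivity (\int[@lebesgue_measure R]_y \int[leb]_x f (pt x (y + ver a)%R))%E.
  apply: eq_integral => y _; under eq_integral do rewrite ptD.
  apply: (IH (fun x => f (pt x (y + ver a)))) => //.
  apply: measurableT_comp => //.
  exact: (measurableT_comp (@measurable_pt R n) (measurable_pair2 _ )).
apply: (@lebesgue_ge0_translation (fun y => \int[leb]_x f (pt x y))%E).
  have := @measurable_fun_fubini_tonelli_G _ _ 'rV[R]_n (measurableTypeR R) R leb
    (fun p => f (pt p.1 p.2)).
  apply; first exact: (measurableT_comp mf (@measurable_pt R n)).
  by move=> z; exact: f0.
by move=> z; exact: integral_ge0.
Qed.
End leb_basics.

Definition cube {R : realType} n (r : R) : set 'rV[R]_n :=
  [set z | forall i, `|z 0 i| <= r].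
Arguments cube {R} n r.

Section leb_more.
Context {R : realType}.

Lemma rv_translation_measurable n (a : 'rV[R]_n) :
  measurable_fun setT (fun y : 'rV[R]_n => y + a).
Proof.
apply: measurable_rvP => i; under eq_fun do rewrite mxE.
by apply: measurable_funD => //; exact: measurable_coord.
Qed.

Lemma leb_translation n (f : 'rV[R]_n -> \bar R) (a : 'rV[R]_n) :
  measurable_fun setT f ->
  (\int[leb]_y f (y + a)%R = \int[leb]_y f y)%E.
Proof.
move=> mf; rewrite integralE [RHS]integralE.
congr (_ - _)%E.
  rewrite -(leb_ge0_translation a (f := f^\+%E)) //; last exact: measurable_funepos.
  by apply: eq_integral => x _; rewrite !funeposE.
rewrite -(leb_ge0_translation a (f := f^\-%E)) //; last exact: measurable_funeneg.
by apply: eq_integral => x _; rewrite !funenegE.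
Qed.

Lemma leb_integrable_translation n (f : 'rV[R]_n -> R) (a : 'rV[R]_n) :
  leb.-integrable setT (EFin \o f) ->
  leb.-integrable setT (EFin \o (fun y => f (y + a))).
Proof.
move=> /integrableP[mf fi]; apply/integrableP; split.
  exact: (measurableT_comp mf (rv_translation_measurable a)).
by rewrite (leb_ge0_translation a (f := fun y => `|(f y)%:E|%E)) //;
  exact: measurableT_comp.
Qed.

Lemma leb_Rtranslation n (f : 'rV[R]_n -> R) (a : 'rV[R]_n) :
  measurable_fun setT f ->
  \int[leb]_y f (y + a) = \int[leb]_y f y.
Proof.
move=> mf; rewrite /Rintegral; congr fine.
by apply: (leb_translation a (f := EFin \o f)); exact/measurable_EFinP.
Qed.

Lemma leb_null_vsections n (B : set 'rV[R]_n.+1) : measurable B ->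
  (forall x, lebesgue_measure [set y | B (pt x y)] = 0%E) -> leb B = 0%E.
Proof.
move=> mB H; rewrite /= /leb_step /pushforward /= /product_measure1.
apply: integral0_eq => x _ /=; rewrite -[RHS](H x); congr lebesgue_measure.
by apply/seteqP; split=> y; rewrite /xsection/= in_setE.
Qed.

Lemma leb_null_hsections n (B : set 'rV[R]_n.+1) : measurable B ->
  (forall y, leb [set x | B (pt x y)] = 0%E) -> leb B = 0%E.
Proof.
move=> mB H; rewrite /= /leb_step /pushforward.
have mB' : measurable ((fun p => @pt R n p.1 p.2) @^-1` B).
  by rewrite -[X in measurable X]setTI; exact: measurable_pt.
(* The measure is built from the sections at fixed x; uniqueness of the product measure lets it be
   computed from the sections at fixed y. *)
transitivity ((@leb R n \x^ @lebesgue_measure R)%E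
    ((fun p => @pt R n p.1 p.2) @^-1` B)).
  apply: product_measure_unique => // A1 A2 mA1 mA2.
  exact: (@product_measure2E _ _ _ _ _ leb (@lebesgue_measure R)).
apply: integral0_eq => y _ /=; rewrite -[RHS](H y); congr (leb _).
by apply/seteqP; split=> x; rewrite /ysection/= in_setE.
Qed.

Lemma closed_cube n (r : R) : closed (cube n r).
Proof.
rewrite (_ : cube n r = \bigcap_(i in setT)
    (fun x : 'rV[R]_n => x 0 i) @^-1` [set t | `|t| <= r]); last first.
  by apply/seteqP; split=> [z H i _|z H i]; exact: H.
apply: closed_bigI => i _; apply: closed_comp.
  by move=> z _; exact: coord_continuous.
rewrite (_ : mkset _ = `[-r, r]%classic); last first.
  by apply/seteqP; split=> t; rewrite /= in_itv/= ler_norml.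
exact: interval_closed.
Qed.

Lemma measurable_cube n (r : R) : measurable (cube n r).
Proof. by apply: closed_rv_measurable; exact: closed_cube. Qed.

Lemma leb_cube n (r : R) : (leb (cube n r) < +oo)%E.
Proof.
elim: n => [|n IH]; first by rewrite /= diracE; case: (_ \in _); rewrite ltry.
rewrite /= /leb_step /pushforward.
rewrite (_ : _ @^-1` _ = cube n r `*` `[-r, r]%classic); last first.
  apply/seteqP; split=> -[x y] /=.
    move=> H; split=> [i|]; last first.
      by have := H ord_max; rewrite mxE unlift_none in_itv/= ler_norml.
    by have := H (lift ord_max i); rewrite mxE liftK.
  move=> [H1 H2] i; rewrite mxE; case: unliftP => [j _|_]; first exact: H1.
  by rewrite ler_norml; move: H2; rewrite in_itv.
rewrite product_measure1E //; last exact: measurable_cube.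
have H : (lebesgue_measure (`[(- r)%R, r]%classic : set R) < +oo)%E.
  by rewrite lebesgue_measure_itv/=; case: ifP; rewrite ?ltry// -EFinB ltry.
by rewrite lte_mul_pinfty// ?ge0_fin_numE.
Qed.

Lemma bounded_cube n (A : set 'rV[R]_n) : bounded_set A ->
  exists2 r, 0 < r & A `<=` cube n r.
Proof.
move=> [M [_ HM]]; exists (`|M| + 1); first by rewrite ltr_wpDl.
move=> z Az i; rewrite (le_trans (rv_coord_le _ _))//.
by apply: HM Az; rewrite (le_lt_trans (ler_norm M))// ltrDl.
Qed.
End leb_more.

(** * Functions of class C^1 and weak partial derivatives *)

Section C1_calculus.
Context {R : realType} {n : nat}.
Implicit Types (f g : 'rV[R]_n -> R) (x v : 'rV[R]_n).

Lemma is_derive_line f x v t df :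
  is_derive (x + t *: v) v f df ->
  is_derive t (1 : R) (fun s : R => f (x + s *: v)) df.
Proof.
move=> [D E].
have EQ : (fun h : R => h^-1 *: ((f \o shift (x + t *: v)) (h *: v) - f (x + t *: v)))
   = (fun h : R => h^-1 *: (((fun s : R => f (x + s *: v)) \o shift t) (h *: (1 : R))
       - f (x + t *: v))).
  apply/funext => h /=; congr (_ *: (f _ - _)).
  by rewrite scaler1 scalerDl addrCA.
by split; [rewrite /derivable -EQ|rewrite /derive -EQ].
Qed.

Lemma is_derive_line0 f x v df :
  is_derive (0 : R) (1 : R) (fun s : R => f (x + s *: v)) df -> is_derive x v f df.
Proof.
move=> [D E].
have EQ : (fun h : R => h^-1 *: ((f \o shift x) (h *: v) - f x))
   = (fun h : R => h^-1 *: (((fun s : R => f (x + s *: v)) \o shift 0) (h *: (1 : R))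
       - f (x + 0 *: v))).
  apply/funext => h /=; congr (_ *: (f _ - f _)); last by rewrite scale0r addr0.
  by rewrite scaler1 addr0 addrC.
by split; [rewrite /derivable EQ|rewrite /derive EQ].
Qed.

(** The partial derivatives are carried as data, so that sums, products and compositions come with
    explicit formulas. *)
Definition is_C1 f (D : 'I_n -> 'rV[R]_n -> R) := forall i,
  (forall x, is_derive x (unit_vec i) f (D i x)) /\ continuous (D i).

Lemma is_C1_C1 f D : is_C1 f D -> C1 f.
Proof.
move=> H i; have [H1 H2] := H i; split=> [x|]; first by case: (H1 x).
rewrite (_ : derive _ ^~ _ = D i) //; apply/funext => x; by case: (H1 x).
Qed.

Lemma C1_is_C1 f : C1 f -> is_C1 f (fun i => 'D_(unit_vec i) f).
Proof.
by move=> H i; have [H1 H2] := H i; split => // x; apply: DeriveDef.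
Qed.

Lemma is_C1_derive f D i : is_C1 f D -> 'D_(unit_vec i) f = D i.
Proof. by move=> H; apply/funext => x; have [H1 _] := H i; case: (H1 x). Qed.

Lemma line_lip f x v B (t : R) :
  (forall s, derivable f (x + s *: v) v) ->
  (forall s, (0 <= s <= t) || (t <= s <= 0) -> `|'D_v f (x + s *: v)| <= B) ->
  `|f (x + t *: v) - f x| <= B * `|t|.
Proof.
move=> df HB.
pose g (s : R) := f (x + s *: v).
have dg s : is_derive s (1 : R) g ('D_v f (x + s *: v)).
  by apply: is_derive_line; apply: DeriveDef.
have cg a b : {within `[a, b], continuous g}.
  apply: derivable_within_continuous => s _; by case: (dg s).
have -> : f x = g 0 by rewrite /g scale0r addr0.
rewrite -/(g t); case: (lerP 0 t) => t0.
  have [c] := MVT_segment t0 (fun s _ => dg s) (@cg 0 t).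
  rewrite in_itv/= => /andP[c0 ct] ->; rewrite subr0 normrM ler_wpM2r//.
  by apply: HB; rewrite c0 ct.
have [c] := MVT_segment (ltW t0) (fun s _ => dg s) (@cg t 0).
rewrite in_itv/= => /andP[c0 ct] E; rewrite distrC E sub0r normrM normrN ler_wpM2r//.
by apply: HB; rewrite c0 ct orbT.
Qed.

(** The two points are joined by a path that changes one coordinate at a time and never leaves the
    box; each of the n moves costs at most [B * |x - y|] by the mean value theorem. *)
Lemma C1_lip_box f D (c x y : 'rV[R]_n) (r B : R) : is_C1 f D ->
  (forall i (z : 'rV[R]_n), (forall j, `|z 0 j - c 0 j| <= r) -> `|D i z| <= B) ->
  (forall j, `|x 0 j - c 0 j| <= r) -> (forall j, `|y 0 j - c 0 j| <= r) ->
  `|f x - f y| <= n%:R * B * `|x - y|.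
Proof.
move=> fD HB Hx Hy.
pose h k : 'rV[R]_n := \row_j (if (j < k)%N then x 0 j else y 0 j).
have h0 : h 0%N = y by apply/rowP => j; rewrite mxE ltn0.
have hn : h n = x by apply/rowP => j; rewrite mxE ltn_ord.
suff H k : (k <= n)%N -> `|f (h k) - f (h 0%N)| <= k%:R * B * `|x - y|.
  by rewrite -hn -{1}h0; rewrite -hn in H; exact: H.
elim: k => [|k IH] kn; first by rewrite subrr normr0 !mul0r.
pose i := Ordinal kn.
have hS : h k.+1 = h k + (x 0 i - y 0 i) *: unit_vec i.
  apply/rowP => j; rewrite !mxE eqxx /= ltnS leq_eqVlt.
  case: (eqVneq j i) => [->|ji]; first by rewrite /= eqxx ltnn mulr1 addrC subrK.
  rewrite mulr0 addr0; case: eqP => [jk|//].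
  by move: ji; rewrite -val_eqE /= jk eqxx.
rewrite (_ : _ - _ = (f (h k.+1) - f (h k)) + (f (h k) - f (h 0%N))); last by ring.
rewrite (le_trans (ler_normD _ _))// -natr1 !mulrDl [leRHS]addrC lerD ?IH 1?ltnW//.
rewrite mul1r hS.
have [d1 _] := fD i.
have xyi : `|x 0 i - y 0 i| <= `|x - y|.
  by have := rv_coord_le (x - y) i; rewrite !mxE.
have B0 : 0 <= B by apply: le_trans (HB i x Hx).
apply: (@le_trans _ _ (B * `|x 0 i - y 0 i|)); last exact: ler_wpM2l.
apply: line_lip => s; first by case: (d1 (h k + s *: unit_vec i)).
move=> sx; case: (d1 (h k + s *: unit_vec i)) => _ ->; apply: HB => j.
rewrite !mxE eqxx /=; case: (eqVneq j i) => [->|ji]; last first.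
  by rewrite mulr0 addr0; case: ifP.
rewrite /= ltnn mulr1; have := Hx i; have := Hy i.
rewrite !ler_norml => /andP[? ?] /andP[? ?].
by move/orP: sx => [|] /andP[? ?]; apply/andP; split; lra.
Qed.

Lemma C1_lip_cube f D (r : R) : 0 <= r -> is_C1 f D ->
  exists2 L, 0 <= L & forall x y, cube n r x -> cube n r y ->
    `|f x - f y| <= L * `|x - y|.
Proof.
move=> r0 fD.
have cK : compact (cube n r).
  apply: bounded_closed_compact; last exact: closed_cube.
  exists r; split; first exact: num_real.
  by move=> M rM z Hz; apply: le_trans (ltW rM); exact/rv_norm_leP.
have /choice[B HB] : forall i, exists B, forall z, cube n r z -> `|D i z| <= B.
  move=> i; have [_ ci] := fD i.
  have /compact_bounded[M [_ HM]] : compact (D i @` cube n r).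
    by apply: continuous_compact cK; exact: continuous_subspaceT.
  exists (`|M| + 1) => z Hz; apply: (HM (`|M| + 1)); last by exists z.
  by rewrite (le_lt_trans (ler_norm M))// ltrDl.
have B0 : 0 <= \sum_i `|B i| by apply: sumr_ge0.
exists (n%:R * \sum_i `|B i|); first by rewrite mulr_ge0.
move=> x y Hx Hy.
apply: (@C1_lip_box f D 0 x y r) => //; last 2 first.
- by move=> j; rewrite mxE subr0; exact: Hx.
- by move=> j; rewrite mxE subr0; exact: Hy.
move=> i z Hz; apply: (@le_trans _ _ (B i)).
  by apply: HB => j; have := Hz j; rewrite mxE subr0.
rewrite (le_trans (ler_norm _))// (bigD1 i)//= lerDl; exact: sumr_ge0.
Qed.

Lemma lip_cube_continuous f :
  (forall r : R, 0 <= r -> exists2 L, 0 <= L & forall x y, cube n r x -> cube n r y ->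
    `|f x - f y| <= L * `|x - y|) -> continuous f.
Proof.
move=> H x A /= /(nbhs_ballP (f x))[e /= e0 eA].
have [L L0 HL] := H (`|x| + 1) (ltW (ltr_wpDl (normr_ge0 _) ltr01)).
have d0 : 0 < Num.min 1 (e / (L + 1)) by rewrite lt_min ltr01 /= divr_gt0// ltr_wpDl.
apply/nbhs_ballP; exists (Num.min 1 (e / (L + 1))) => // y.
rewrite mx_norm_ball /ball_ /= => xy; apply: eA; rewrite /ball /=.
have xC : cube n (`|x| + 1) x.
  by apply/rv_norm_leP; rewrite ?ler_wpDr// addr_ge0.
have yC : cube n (`|x| + 1) y.
  apply/rv_norm_leP; first by rewrite addr_ge0.
  rewrite (_ : y = x - (x - y)); last by rewrite opprB addrC subrK.
  rewrite (le_trans (ler_normB _ _))// lerD2l.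
  by move: xy; rewrite lt_min => /andP[/ltW].
rewrite (le_lt_trans (HL _ _ xC yC))//.
move: xy; rewrite lt_min ltr_pdivlMr ?ltr_wpDl// => /andP[_].
by apply: le_lt_trans; rewrite mulrC ler_wpM2l// lerDl.
Qed.

(** [C1] speaks of partial derivatives only, so continuity comes from the Lipschitz bound on
    cubes. *)
Lemma C1_continuous f : C1 f -> continuous f.
Proof.
by move=> /C1_is_C1 H; apply: lip_cube_continuous => r r0; exact: C1_lip_cube H.
Qed.

Lemma is_C1_cst (a : R) : is_C1 (fun=> a) (fun _ _ => 0).
Proof. by move=> i; split=> [x|]; [exact: is_derive_cst|exact: cst_continuous]. Qed.

Lemma is_C1_coord j : is_C1 (fun x => x 0 j) (fun i _ => (i == j)%:R).
Proof.
move=> i; split=> [x|]; last exact: cst_continuous.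
apply: is_derive_line0.
rewrite (_ : (fun _ => _) = (fun s : R => x 0 j + s * (i == j)%:R)); last first.
  by apply/funext => s; rewrite !mxE eqxx /= eq_sym.
have H := is_deriveD (is_derive_cst (x 0 j) (0 : R) (1 : R))
  (is_deriveZ ((i == j)%:R : R) (is_derive_id (0 : R) (1 : R))).
rewrite add0r /GRing.scale/= mulr1 in H.
rewrite (_ : (fun _ => _) = cst (x 0 j) + (i == j)%:R \*: id) //.
by apply/funext => s /=; rewrite mulrC.
Qed.

Lemma is_C1D f g Df Dg : is_C1 f Df -> is_C1 g Dg ->
  is_C1 (fun x => f x + g x) (fun i x => Df i x + Dg i x).
Proof.
move=> Hf Hg i; have [f1 f2] := Hf i; have [g1 g2] := Hg i.
split=> [x|x]; first exact: is_deriveD.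
by apply: continuousD; [exact: f2|exact: g2].
Qed.

Lemma C1_c f Df : is_C1 f Df -> continuous f.
Proof. by move=> /is_C1_C1; exact: C1_continuous. Qed.

Lemma is_C1M f g Df Dg : is_C1 f Df -> is_C1 g Dg ->
  is_C1 (fun x => f x * g x) (fun i x => f x * Dg i x + g x * Df i x).
Proof.
move=> Hf Hg i; have [f1 f2] := Hf i; have [g1 g2] := Hg i.
split=> [x|x]; first exact: is_deriveM.
exact: (continuousD (continuousM (C1_c Hf (x:=x)) (g2 x)) (continuousM (C1_c Hg (x:=x)) (f2 x))).
Qed.

Lemma is_C1_comp f Df (h dh : R -> R) : is_C1 f Df ->
  (forall t : R, is_derive t (1 : R) h (dh t)) -> continuous dh ->
  is_C1 (fun x => h (f x)) (fun i x => dh (f x) * Df i x).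
Proof.
move=> Hf hd hc i; have [f1 f2] := Hf i; split=> [x|x].
  apply: is_derive_line0.
  have f1' : is_derive (x + 0 *: unit_vec i) (unit_vec i) f (Df i x).
    by rewrite scale0r addr0.
  have := @is_derive1_comp R h (fun s : R => f (x + s *: unit_vec i)) 0 _ _ _
    (is_derive_line f1').
  by apply; rewrite scale0r addr0.
apply: continuousM; last exact: f2.
by apply: (@continuous_comp _ _ _ f dh); [exact: (C1_c Hf)|exact: hc].
Qed.

Lemma is_C1_ext f g Df Dg : f =1 g -> (forall i, Df i =1 Dg i) ->
  is_C1 f Df -> is_C1 g Dg.
Proof.
by move=> /funext <- H; have -> : Dg = Df by apply/funext => i; apply/funext => x; rewrite H.
Qed.

Lemma is_C1Z (a : R) f Df : is_C1 f Df ->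
  is_C1 (fun x => a * f x) (fun i x => a * Df i x).
Proof.
move=> H; apply: is_C1_ext (is_C1M (is_C1_cst a) H) => // i x /=.
by rewrite mulr0 addr0.
Qed.

Lemma C1_sum (I : Type) (r : seq I) (P : pred I) (F : I -> 'rV[R]_n -> R) :
  (forall i, P i -> C1 (F i)) -> C1 (fun x => \sum_(i <- r | P i) F i x).
Proof.
move=> HF; elim: r => [|j r IH].
  rewrite (_ : (fun _ => _) = fun=> 0); first exact/is_C1_C1/is_C1_cst.
  by apply/funext => x; rewrite big_nil.
have [Pj|nPj] := boolP (P j); last first.
  rewrite (_ : (fun _ => _) = fun x => \sum_(i <- r | P i) F i x)//.
  by apply/funext => x; rewrite big_cons (negbTE nPj).
rewrite (_ : (fun _ => _) = fun x => F j x + \sum_(i <- r | P i) F i x).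
  by apply/is_C1_C1/is_C1D; apply: C1_is_C1 => //; exact: HF.
by apply/funext => x; rewrite big_cons Pj.
Qed.

Lemma C1_prod (I : Type) (r : seq I) (P : pred I) (F : I -> 'rV[R]_n -> R) :
  (forall i, P i -> C1 (F i)) -> C1 (fun x => \prod_(i <- r | P i) F i x).
Proof.
move=> HF; elim: r => [|j r IH].
  rewrite (_ : (fun _ => _) = fun=> 1); first exact/is_C1_C1/is_C1_cst.
  by apply/funext => x; rewrite big_nil.
have [Pj|nPj] := boolP (P j); last first.
  rewrite (_ : (fun _ => _) = fun x => \prod_(i <- r | P i) F i x)//.
  by apply/funext => x; rewrite big_cons (negbTE nPj).
rewrite (_ : (fun _ => _) = fun x => F j x * \prod_(i <- r | P i) F i x).
  by apply/is_C1_C1/is_C1M; apply: C1_is_C1 => //; exact: HF.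
by apply/funext => x; rewrite big_cons Pj.
Qed.

(** Off its support the derivatives of [f] vanish, so they are bounded. *)
Lemma C1c_lip f U : C1c U f ->
  exists2 L, 0 <= L & forall x y, `|f x - f y| <= L * `|x - y|.
Proof.
move=> [/C1_is_C1 fD [K [cK KU f0]]].
have oK : open (~` K).
  by apply: closed_openC; apply: compact_closed => //; exact: norm_hausdorff.
have D0 i x : ~ K x -> 'D_(unit_vec i) f x = 0.
  move=> nKx; rewrite (@near_eq_derive _ _ _ f (cst 0)) ?derive_cst//.
  apply: filterS (open_nbhs_nbhs (conj oK nKx)) => z nKz; exact: f0.
have B0 : exists B, forall i z, `|'D_(unit_vec i) f z| <= B.
  have /choice[B HB] : forall i, exists B, forall z, `|'D_(unit_vec i) f z| <= B.
    move=> i; have [_ ci] := fD i.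
    have /compact_bounded[M [_ HM]] : compact ('D_(unit_vec i) f @` K).
      by apply: continuous_compact cK; exact: continuous_subspaceT.
    exists (`|M| + 1) => z; have [Kz|nKz] := pselect (K z); last first.
      by rewrite D0 // normr0 addr_ge0.
    apply: (HM (`|M| + 1)); last by exists z.
    by rewrite (le_lt_trans (ler_norm M))// ltrDl.
  exists (\sum_i `|B i|) => i z; rewrite (le_trans (HB i z))//.
  by rewrite (le_trans (ler_norm _))// (bigD1 i)//= lerDl; exact: sumr_ge0.
have [B HB] := B0.
have [n0|/negP/negP] := boolP (n == 0)%N.
  exists 0 => // x y; rewrite mul0r (_ : x = y) ?subrr ?normr0//.
  by apply/rowP => i; have := leq_ltn_trans (leq0n i) (ltn_ord i); rewrite lt0n n0.
rewrite -lt0n => n0.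
have Bge0 : 0 <= B by apply: le_trans (HB (Ordinal n0) 0).
exists (n%:R * B); first by rewrite mulr_ge0.
move=> x y; apply: (@C1_lip_box f _ x x y `|x - y| B fD) => // j.
- by rewrite subrr normr0.
- by rewrite distrC; have := rv_coord_le (x - y) j; rewrite !mxE.
Qed.

End C1_calculus.

Section integrals.
Context {R : realType} {d : measure_display} {T : measurableType d}
  {mu : {measure set T -> \bar R}}.

Lemma Rdominated_cvg (D : set T) (f_ : nat -> T -> R) (f g : T -> R) :
  measurable D -> (forall m, measurable_fun D (f_ m)) -> measurable_fun D f ->
  {ae mu, forall x, D x -> f_ m x @[m --> \oo] --> f x} ->
  mu.-integrable D (EFin \o g) ->
  (forall m x, D x -> `|f_ m x| <= g x) ->
  mu.-integrable D (EFin \o f) /\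
  \int[mu]_(x in D) f_ m x @[m --> \oo] --> \int[mu]_(x in D) f x.
Proof.
move=> mD mf_ mf cf ig fg.
have [|||||i1 i2 i3] := @dominated_convergence _ _ _ mu D mD
  (fun m => EFin \o f_ m) (EFin \o f) (EFin \o g).
- by move=> m; exact/measurable_EFinP.
- exact/measurable_EFinP.
- apply: filterS cf => x H Dx.
  by apply/fine_cvgP; split; [exact: nearW|exact: H Dx].
- exact: ig.
- by apply: aeW => x m Dx; rewrite /= lee_fin; exact: fg.
split=> //; apply: fine_cvg; rewrite fineK//.
exact: integrable_fin_num.
Qed.

Lemma Rintegral_supp (U : set T) (f : T -> R) :
  (forall x, ~ U x -> f x = 0) ->
  \int[mu]_(x in U) f x = \int[mu]_x f x.
Proof.
move=> f0; rewrite Rintegral_mkcond; congr Rintegral.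
apply/funext => x; rewrite /patch; case: ifPn => // /negP xU.
by rewrite f0 // => Ux; apply: xU; rewrite inE.
Qed.
End integrals.

(** * Weak derivatives of Lipschitz functions *)

Section lipschitz.
Context {R : realType} {n : nat}.
Implicit Types (f w : 'rV[R]_n -> R).

Definition lip (L : R) w := forall x y, `|w x - w y| <= L * `|x - y|.

Lemma lip_continuous L w : lip L w -> continuous w.
Proof.
move=> H; apply: lip_cube_continuous => r r0; exists `|L| => // x y _ _.
by rewrite (le_trans (H x y))// ler_wpM2r// ler_norm.
Qed.

Lemma integrable_supp (r B : R) f : measurable_fun setT f ->
  (forall z, `|f z| <= B) -> (forall z, ~ cube n r z -> f z = 0) ->
  leb.-integrable setT (EFin \o f).
Proof.
move=> mf fB f0.
have -> : EFin \o f = (EFin \o f) \_ (cube n r).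
  apply/funext => z; rewrite patchE; case: ifPn => //= /negP zr.
  by rewrite f0// => H; apply: zr; rewrite inE.
apply/(integrable_mkcond _ (@measurable_cube R n r)).
apply: measurable_bounded_integrable => //; first exact: measurable_cube.
- exact: leb_cube.
- exact: measurable_funTS.
- exists B; split; first exact: num_real.
  by move=> M BM x _ /=; apply: le_trans (fB x) (ltW BM).
Qed.

Lemma unit_vec_norm (i : 'I_n) : `|unit_vec i : 'rV[R]_n| <= 1.
Proof.
apply/rv_norm_leP => // j; rewrite mxE eqxx /=; case: (j == i) => //=.
  by rewrite normr1.
by rewrite normr0 ler01.
Qed.

Lemma compact_cube (K : set 'rV[R]_n) : compact K -> exists2 r, 0 < r & K `<=` cube n r.
Proof. by move=> /compact_bounded /bounded_cube. Qed.

Lemma lip_locally_int L w U : open U -> lip L w -> locally_int U w.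
Proof.
move=> oU wL; have cw := lip_continuous wL.
split; first by apply: continuous_rv_measurable => //; exact: open_rv_measurable.
move=> K cK KU.
have mK : measurable K.
  by apply: closed_rv_measurable; apply: compact_closed => //; exact: norm_hausdorff.
have [r r0 Kr] := compact_cube cK.
apply: measurable_bounded_integrable => //.
- apply: le_lt_trans (leb_cube n r); apply: le_measure => //; rewrite inE//.
  exact: measurable_cube.
- exact: continuous_rv_measurable.
- have /compact_bounded[M [Mr HM]] : compact (w @` K).
    by apply: continuous_compact cK; exact: continuous_subspaceT.
  by exists M; split => // M' MM' x Kx; apply: (HM _ MM'); exists x.
Qed.

Lemma bounded_locally_int (B : R) (g : 'rV[R]_n -> R) (U : set 'rV[R]_n) : open U -> measurable_fun U g ->
  (forall z, U z -> `|g z| <= B) -> locally_int U g.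
Proof.
move=> oU mg gB; split => // K cK KU.
have mK : measurable K.
  by apply: closed_rv_measurable; apply: compact_closed => //; exact: norm_hausdorff.
have [r r0 Kr] := compact_cube cK.
apply: measurable_bounded_integrable => //.
- apply: le_lt_trans (leb_cube n r); apply: le_measure => //; rewrite inE//.
  exact: measurable_cube.
- by apply: measurable_funS mg => //; exact: open_rv_measurable.
- exists B; split; first exact: num_real.
  by move=> M BM x Kx /=; apply: le_trans (gB x (KU _ Kx)) (ltW BM).
Qed.

(** Derivatives are read along the steps 1/(m+1), because dominated convergence is applied to
    sequences. *)
Lemma is_derive_quot (f : 'rV[R]_n -> R) z v df : is_derive z v f df ->
  (f (z + m.+1%:R^-1 *: v) - f z) * m.+1%:R @[m --> \oo] --> df.
Proof.
move=> [D <-]; have /cvgr_dnbhsP/(_ (fun m => m.+1%:R^-1)) H := D.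
rewrite (_ : (fun m => _) = (fun m => (m.+1%:R^-1)^-1 *:
    ((f \o shift z) (m.+1%:R^-1 *: v) - f z))).
  by apply: H; split=> [m|]; [rewrite invr_eq0|exact: cvg_harmonic].
by apply/funext => m; rewrite /= invrK [z + _]addrC mulrC.
Qed.

Lemma continuous_bounded_cube w (r : R) : 0 <= r -> continuous w ->
  exists Bw, forall z : 'rV[R]_n, cube n r z -> `|w z| <= Bw.
Proof.
move=> r0 cw.
have cC : compact (cube n r : set 'rV[R]_n).
  apply: bounded_closed_compact; last exact: closed_cube.
  exists r; split; first exact: num_real.
  by move=> M rM z Hz; apply: le_trans (ltW rM); apply/rv_norm_leP.
have /compact_bounded[M [Mr HM]] : compact (w @` cube n r).
  by apply: continuous_compact cC; exact: continuous_subspaceT.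
exists (`|M| + 1) => z Hz; apply: (HM (`|M| + 1)); last by exists z.
by rewrite (le_lt_trans (ler_norm M))// ltrDl.
Qed.

(** Difference quotients are moved from the test function to [w] by the
    translation invariance of the Lebesgue measure. *)
Lemma lip_weak_partial (L B : R) w (U : set 'rV[R]_n) i (g : 'rV[R]_n -> R) : open U -> lip L w ->
  measurable_fun U g -> (forall z, U z -> `|g z| <= B) ->
  {ae leb, forall z, U z ->
    (w z - w (z - m.+1%:R^-1 *: unit_vec i)) * m.+1%:R @[m --> \oo] --> g z} ->
  is_weak_partial U i w g.
Proof.
move=> oU wL mg gB gae.
split; [exact: lip_locally_int wL|exact: bounded_locally_int gB|move=> f fU].
have [Lf Lf0 fL] := C1c_lip fU.
have [fC1 [K [cK KU fK]]] := fU.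
have cf := C1_continuous fC1; have cw := lip_continuous wL.
have fD := C1_is_C1 fC1.
have [r r0 Kr] := compact_cube cK.
have f0 z : ~ U z -> f z = 0 by move=> Uz; apply: fK => /KU.
have Df0 z : ~ K z -> 'D_(unit_vec i) f z = 0.
  move=> nKz; rewrite (@near_eq_derive _ _ _ f (cst 0)) ?derive_cst//.
  have oK : open (~` K).
    by apply: closed_openC; apply: compact_closed => //; exact: norm_hausdorff.
  by apply: filterS (open_nbhs_nbhs (conj oK nKz)) => y nKy; exact: fK.
rewrite Rintegral_supp; last by move=> z Uz; rewrite Df0 ?mulr0// => /KU.
pose t (m : nat) : R := m.+1%:R^-1.
have t0 m : 0 < t m by rewrite invr_gt0.
have t1 m : t m <= 1 by rewrite invf_le1// ler1n.
pose q m (z : 'rV[R]_n) := w z * ((f (z + t m *: unit_vec i) - f z) * m.+1%:R).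
have mw : measurable_fun setT w by exact: continuous_rv_measurable.
have mf : measurable_fun setT f by exact: continuous_rv_measurable.
have mft a : measurable_fun setT (fun z : 'rV[R]_n => f (z + a)).
  exact: (measurableT_comp mf (rv_translation_measurable a)).
have mwt a : measurable_fun setT (fun z : 'rV[R]_n => w (z + a)).
  exact: (measurableT_comp mw (rv_translation_measurable a)).
have ww a : measurable_fun setT (fun z : 'rV[R]_n => w (z - a)) by exact: mwt.
(* The steps [t m] are at most 1, so every shifted support stays in the cube of radius [r + 1]. *)
have r10 : 0 <= r + 1 by rewrite addr_ge0// ltW.
have [Bw HBw] := continuous_bounded_cube r10 cw.
have [Bf HBf] := continuous_bounded_cube r10 cf.
have q0 m (z : 'rV[R]_n) : ~ cube n (r + 1) z -> q m z = 0.
  move=> nz; rewrite /q [f z]fK ?[f (z + _)]fK ?subrr ?mul0r ?mulr0//.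
    move=> /Kr Hz; apply: nz => j; have := Hz j; rewrite !mxE eqxx /=.
    have [_|_] := eqVneq j i; rewrite ?mulr0 ?addr0 ?mulr1; last by move=> /le_trans->//; rewrite lerDl.
    move=> H; rewrite (_ : z 0 j = (z 0 j + t m) - t m); last by ring.
    by rewrite (le_trans (ler_normB _ _))// lerD// gtr0_norm.
  by move=> /Kr Hz; apply: nz => j; rewrite (le_trans (Hz j))// lerDl.
have fq m (z : 'rV[R]_n) : `|(f (z + t m *: unit_vec i) - f z) * m.+1%:R| <= Lf.
  rewrite normrM [`|m.+1%:R|]ger0_norm// -ler_pdivlMr//.
  rewrite (le_trans (fL _ _))// addrAC subrr add0r normrZ gtr0_norm//.
  by rewrite ler_wpM2l// -[leRHS]mulr1 ler_wpM2l ?unit_vec_norm// ltW.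
have wq m (z : 'rV[R]_n) : `|(w z - w (z - t m *: unit_vec i)) * m.+1%:R| <= `|L|.
  rewrite normrM [`|m.+1%:R|]ger0_norm// -ler_pdivlMr//.
  rewrite (le_trans (wL _ _))// opprB addrC subrK normrZ gtr0_norm//.
  apply: (@le_trans _ _ (`|L| * (t m * `|unit_vec i|))).
    by rewrite ler_wpM2r ?ler_norm// mulr_ge0// ltW.
  by rewrite ler_wpM2l// -[leRHS]mulr1 ler_wpM2l ?unit_vec_norm// ltW.
have icst (b : R) :
    leb.-integrable setT (EFin \o (fun z : 'rV[R]_n => b * \1_(cube n (r + 1)) z)).
  apply: (@integrable_supp (r + 1) `|b|).
  - apply: measurable_funM => //; apply: measurable_indic; exact: measurable_cube.
  - move=> z; rewrite normrM -[leRHS]mulr1 ler_wpM2l// indicE.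
    by case: (_ \in _) => /=; rewrite ?normr1 ?normr0.
  - by move=> z nz; rewrite indicE memNset ?mulr0.
have [|||||_ C1] := @Rdominated_cvg R _ _ (@leb R n) setT q
  (fun z => w z * 'D_(unit_vec i) f z)
  (fun z => (`|Bw| * Lf) * \1_(cube n (r + 1)) z) measurableT.
- move=> m; apply: measurable_funM => //; apply: measurable_funM => //.
  exact: measurable_funB.
- apply: measurable_funM => //; apply: continuous_rv_measurable => //.
  by have [] := fD i.
- apply: aeW => z _; apply: cvgM; first exact: cvg_cst.
  by apply: is_derive_quot; have [] := fD i.
- exact: icst.
- move=> m z _; rewrite indicE; have [zr|nzr] := pselect (cube n (r + 1) z).
    rewrite mem_set// mulr1 normrM ler_pM// ?fq//.
    by rewrite (le_trans (HBw z zr))// ler_norm.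
  by rewrite memNset// mulr0 q0// normr0.
pose p m (z : 'rV[R]_n) := - (((w z - w (z - t m *: unit_vec i)) * m.+1%:R) * f z).
have mp m : measurable_fun setT (p m).
  apply: measurableT_comp => //; apply: measurable_funM => //.
  by apply: measurable_funM => //; exact: measurable_funB.
have fB (z : 'rV[R]_n) : `|f z| <= `|Bf| * \1_(cube n (r + 1)) z.
  rewrite indicE; have [zr|nzr] := pselect (cube n (r + 1) z).
    by rewrite mem_set// mulr1 (le_trans (HBf z zr))// ler_norm.
  rewrite memNset// mulr0 fK ?normr0// => /Kr Hz; apply: nzr => j.
  by rewrite (le_trans (Hz j))// lerDl.
have mU := open_rv_measurable oU.
have [|||||iC2 C2] := @Rdominated_cvg R _ _ (@leb R n) U p (fun z => - (g z * f z))
  (fun z => (`|L| * `|Bf|) * \1_(cube n (r + 1)) z) mU.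
- by move=> m; apply: measurable_funTS.
- apply: measurableT_comp => //; apply: measurable_funM => //.
  exact: measurable_funTS.
- apply: filterS gae => z H Uz; apply: cvgN; apply: cvgM; first exact: H.
  exact: cvg_cst.
- by apply: integrableS (icst _).
- by move=> m z _; rewrite normrN normrM -mulrA ler_pM// wq.
have EU m : \int[leb]_(x in U) p m x = \int[leb]_x q m x.
  rewrite Rintegral_supp; last by move=> z Uz; rewrite /p f0// mulr0 oppr0.
  pose h (z : 'rV[R]_n) := w (z - t m *: unit_vec i) * f z.
  have mh : measurable_fun setT h by exact: measurable_funM.
  have ih : leb.-integrable setT (EFin \o h).
    apply: (@integrable_supp r (`|Bw| * `|Bf|)) => //; last first.
      by move=> z nz; rewrite /h fK ?mulr0// => /Kr.
    move=> z; have [zr|nzr] := pselect (cube n r z); last first.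
      by rewrite /h fK ?mulr0 ?normr0 ?mulr_ge0// => /Kr.
    rewrite normrM ler_pM//.
      apply: (le_trans _ (ler_norm Bw)); apply: HBw => j; rewrite !mxE eqxx /=.
      rewrite (le_trans (ler_normB _ _))// lerD ?zr//.
      rewrite normrM gtr0_norm// -[leRHS]mulr1 ler_pM//; first exact: ltW.
      by case: (j == i); rewrite ?normr1 ?normr0.
    apply: (le_trans _ (ler_norm Bf)); apply: HBf => j.
    by rewrite (le_trans (zr j))// lerDl.
  have iht : leb.-integrable setT (EFin \o (fun z => h (z + t m *: unit_vec i))).
    exact: leb_integrable_translation.
  have ip : leb.-integrable setT (EFin \o p m).
    apply: (@integrable_supp (r + 1) (`|L| * `|Bf|)) => // z.
      rewrite /p normrN normrM ler_pM// ?wq//.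
      rewrite (le_trans (fB z))// -[leRHS]mulr1 ler_wpM2l// indicE lern1 leq_b1.
    move=> nz; rewrite /p fK ?mulr0 ?oppr0// => /Kr Hz; apply: nz => j.
    by rewrite (le_trans (Hz j))// lerDl.
  have ihd : leb.-integrable setT
      (EFin \o (fun z => h (z + t m *: unit_vec i) - h z)).
    exact: (integrableB measurableT iht ih).
  (* Forward quotients of [f] against [w] and backward quotients of [w] against [f] differ by a
     multiple of a translate of [h] minus [h], whose integral vanishes. *)
  have -> : q m = fun z => p m z + m.+1%:R * (h (z + t m *: unit_vec i) - h z).
    by apply/funext => z; rewrite /q /p /h addrK; ring.
  rewrite RintegralD//; last exact: (integrableZl measurableT _ ihd).
  by rewrite RintegralZl// RintegralB// leb_Rtranslation// subrr mulr0 addr0.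
have -> : \int[leb]_(x in U) (g x * f x) = - \int[leb]_(x in U) (- (g x * f x)).
  rewrite -mulN1r -RintegralZl//.
  by apply: eq_Rintegral => z _; rewrite mulN1r opprK.
rewrite opprK; move: C2; under eq_fun do rewrite EU.
by move=> C2; exact: (cvg_unique _ C1 C2).
Qed.
End lipschitz.

(** * Bump functions of class C^1 *)

Section bumps.
Context {R : realType}.

(** Squared positive part: C^1 with derivative 2 max(0, t), the building block of the kernels, the
    cut-offs and the truncation. *)
Definition sqpos (t : R) : R := Num.max 0 t ^+ 2.

Lemma sqpos_ge0 t : 0 <= sqpos t. Proof. exact: sqr_ge0. Qed.

Lemma sqpos_eq0 t : t <= 0 -> sqpos t = 0.
Proof. by move=> t0; rewrite /sqpos max_l// expr0n. Qed.

Lemma sqpos_gt0 t : 0 < t -> 0 < sqpos t.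
Proof. by move=> t0; rewrite /sqpos max_r ?ltW// exprn_gt0. Qed.

Lemma max_lip (z t : R) : `|Num.max 0 z - Num.max 0 t| <= `|z - t|.
Proof.
have H1 := ler_norm (z - t); have := ler_norm (t - z); rewrite distrC => H2.
have H3 := normr_ge0 (z - t).
by rewrite ler_norml /Num.max; case: ltP => z0; case: ltP => t0;
  apply/andP; split; lra.
Qed.

Lemma continuous_pos : continuous (fun t : R => Num.max 0 t).
Proof.
move=> t A /= /(nbhs_ballP (Num.max 0 t))[e /= e0 eA].
apply/nbhs_ballP; exists e => //= z tz; apply: eA.
exact: le_lt_trans (max_lip _ _) tz.
Qed.

(** The remainder is [|z+^2 - t+^2 - 2 t+ (z - t)| <= (z - t)^2]. *)
Lemma is_derive_sqpos (t : R) : is_derive t (1 : R) sqpos (2 * Num.max 0 t).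
Proof.
have rem h : `|sqpos (h + t) - sqpos t - 2 * Num.max 0 t * h| <= h ^+ 2.
  rewrite /sqpos ler_norml /Num.max; case: ltP => z0; case: ltP => t0.
  - by have := sqr_ge0 h => ?; apply/andP; split; nra.
  - have H1 : 0 <= (h + t) * (- t) by apply: mulr_ge0; lra.
    have H2 : 0 <= (- t) * (- t) by apply: mulr_ge0; lra.
    by apply/andP; split; nra.
  - have H1 : 0 <= t * (- (h + t)) by apply: mulr_ge0; lra.
    have H2 : 0 <= (h + t) ^+ 2 by exact: sqr_ge0.
    by apply/andP; split; nra.
  - by have := sqr_ge0 h; rewrite !expr0n /= !mulr0 mul0r !subr0 => ?; apply/andP; split; lra.
have C : h^-1 *: ((sqpos \o shift t) (h *: (1 : R)) - sqpos t) @[h --> 0^'] -->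
    2 * Num.max 0 t.
  apply/cvgrPdist_le => e e0; near=> h.
  have h0 : h != 0 by near: h; exact: nbhs_dnbhs_neq.
  have he : `|h| <= e.
    near: h; apply: dnbhs0_le; exact: e0.
  rewrite /= /GRing.scale /= mulr1.
  rewrite (_ : _ - _ = - (h^-1 * (sqpos (h + t) - sqpos t - 2 * Num.max 0 t * h))).
    rewrite normrN normrM normfV ler_pdivrMl ?normr_gt0//.
    rewrite (le_trans (rem h))// -real_normK ?num_real// expr2.
    by rewrite ler_wpM2l.
  by field.
split; first by apply/cvg_ex; exists (2 * Num.max 0 t).
exact: cvg_lim.
Unshelve. all: by end_near. Qed.

Lemma continuous_dsqpos : continuous (fun t : R => 2 * Num.max 0 t).
Proof. by move=> t; apply: cvgM; [exact: cvg_cst|exact: continuous_pos]. Qed.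

Lemma C1_sqpos n (f : 'rV[R]_n -> R) : C1 f -> C1 (fun x => sqpos (f x)).
Proof.
move=> /C1_is_C1 fC; apply: is_C1_C1.
exact: (is_C1_comp fC is_derive_sqpos continuous_dsqpos).
Qed.

(** A bump of class C^1, positive exactly on the open cube of centre [q] and half-side [r] (for
    nonnegative [r]). *)
Definition tentsq n (q : 'rV[R]_n) (r : R) (x : 'rV[R]_n) : R :=
  \prod_(i < n) sqpos (r ^+ 2 - (x 0 i - q 0 i) ^+ 2).

Lemma C1_coord n (i : 'I_n) : C1 (fun x : 'rV[R]_n => x 0 i).
Proof. exact: (is_C1_C1 (@is_C1_coord R n i)). Qed.

Lemma C1_cst n (a : R) : C1 (fun _ : 'rV[R]_n => a).
Proof. exact: (is_C1_C1 (@is_C1_cst R n a)). Qed.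

Lemma C1D n (f g : 'rV[R]_n -> R) : C1 f -> C1 g -> C1 (fun x => f x + g x).
Proof. by move=> /C1_is_C1 Hf /C1_is_C1 Hg; exact: (is_C1_C1 (is_C1D Hf Hg)). Qed.

Lemma C1M n (f g : 'rV[R]_n -> R) : C1 f -> C1 g -> C1 (fun x => f x * g x).
Proof. by move=> /C1_is_C1 Hf /C1_is_C1 Hg; exact: (is_C1_C1 (is_C1M Hf Hg)). Qed.

Lemma C1Z n a (f : 'rV[R]_n -> R) : C1 f -> C1 (fun x => a * f x).
Proof. by move=> Hf; apply: C1M => //; exact: C1_cst. Qed.

Lemma C1N n (f : 'rV[R]_n -> R) : C1 f -> C1 (fun x => - f x).
Proof.
move=> Hf; rewrite (_ : (fun _ => _) = (fun x => -1 * f x)); first exact: C1Z.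
by apply/funext => x; rewrite mulN1r.
Qed.

Lemma C1B n (f g : 'rV[R]_n -> R) : C1 f -> C1 g -> C1 (fun x => f x - g x).
Proof. by move=> Hf Hg; apply: C1D => //; exact: C1N. Qed.

Lemma C1_tentsq n (q : 'rV[R]_n) r : C1 (tentsq q r).
Proof.
apply: C1_prod => i _; apply: C1_sqpos; apply: C1B; first exact: C1_cst.
under eq_fun do rewrite expr2.
have H : C1 (fun x : 'rV[R]_n => x 0 i - q 0 i) := C1B (C1_coord i) (C1_cst _).
exact: (C1M H H).
Qed.

Lemma tentsq_ge0 n (q : 'rV[R]_n) r x : 0 <= tentsq q r x.
Proof. by apply: prodr_ge0 => i _; exact: sqpos_ge0. Qed.

Lemma tentsq_gt0 n (q x : 'rV[R]_n) r : (forall i, `|x 0 i - q 0 i| < r) ->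
  0 < tentsq q r x.
Proof.
move=> H; apply: prodr_gt0 => i _; apply: sqpos_gt0.
rewrite subr_gt0 -real_normK ?num_real// ltr_pXn2r ?nnegrE//.
exact: le_trans (ltW (H i)).
Qed.

Lemma tentsq_eq0 n (q x : 'rV[R]_n) r i : 0 <= r -> r <= `|x 0 i - q 0 i| ->
  tentsq q r x = 0.
Proof.
move=> r0 H; apply/eqP/prodf_eq0; exists i => //; apply/eqP/sqpos_eq0.
by rewrite subr_le0 -[leRHS]real_normK ?num_real// ler_pXn2r ?nnegrE.
Qed.

Lemma C1cD n U (f g : 'rV[R]_n -> R) : C1c U f -> C1c U g ->
  C1c U (fun x => f x + g x).
Proof.
move=> [Cf [K [cK KU fK]]] [Cg [K' [cK' KU' gK]]]; split; first exact: C1D.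
exists (K `|` K'); split; [exact: compactU|by rewrite subUset|].
by move=> x /not_orP[/fK -> /gK ->]; rewrite addr0.
Qed.

Lemma C1c0 n (U : set 'rV[R]_n) : C1c U (fun=> 0).
Proof. by split; [exact: C1_cst|exists set0; split => //; exact: compact0]. Qed.

(** A C^1 saturation: 0 at t = 0, below 1 everywhere, and tending to 1 with [m] as soon as t is
    nonzero. *)
Definition sat (m : nat) (t : R) : R := 1 - (1 + m%:R * t ^+ 2)^-1.

Lemma sat_den m (t : R) : 0 < 1 + m%:R * t ^+ 2 :> R.
Proof. by rewrite ltr_pwDl// mulr_ge0// sqr_ge0. Qed.

Lemma is_derive_sat m (t : R) : is_derive t (1 : R) (sat m)
  ((m%:R * (2 * t)) * ((1 + m%:R * t ^+ 2)^-1) ^+ 2).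
Proof.
have H : is_derive t (1 : R) (fun t : R => 1 + m%:R * t ^+ 2) (m%:R * (2 * t)).
  have K := is_deriveD (is_derive_cst (1 : R) t (1 : R))
    (is_deriveZ (m%:R : R) (is_deriveX 2 (is_derive_id t (1 : R)))).
  rewrite (_ : (fun _ => _) = cst (1 : R) + m%:R \*: (id ^+ 2)) //.
  by apply: (is_derive_eq K); rewrite /GRing.scale/= add0r mulr1 expr1.
have K := is_deriveB (is_derive_cst (1 : R) t (1 : R)) (@is_deriveV R (fun t : R => 1 + m%:R * t ^+ 2) t _ _
  (lt0r_neq0 (sat_den m t)) H).
apply: (is_derive_eq K).
rewrite /GRing.scale/= sub0r mulNr opprK mulrC; congr (_ * _).
by rewrite exprVn.
Qed.
End bumps.

(** * Uniqueness of weak derivatives *)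

Section uniqueness.
Context {R : realType} {n : nat}.
Implicit Types (U O : set 'rV[R]_n).

Lemma C1c_sub U O (f : 'rV[R]_n -> R) : U `<=` O -> C1c U f -> C1c O f.
Proof.
move=> UO [Cf [K [cK KU fK]]]; split=> //; exists K; split=> //.
exact: subset_trans UO.
Qed.

Lemma closed_cubeAt (q : 'rV[R]_n) (r : R) :
  compact [set x : 'rV[R]_n | forall i, `|x 0 i - q 0 i| <= r].
Proof.
have := @rV_compact R n (fun i => `[q 0 i - r, q 0 i + r]%classic).
rewrite (_ : [set v : 'rV[R]_n | _] =
  [set x : 'rV[R]_n | forall i, `|x 0 i - q 0 i| <= r]).
  by apply => i; exact: segment_compact.
apply/seteqP; split=> x /= H i; have := H i; rewrite /= in_itv/= ler_norml => ?.
  by lra.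
by lra.
Qed.

(** Saturated sums of countably many bumps increase to the indicator. *)
Lemma open_C1c_approx O : open O -> exists f_ : nat -> 'rV[R]_n -> R,
  (forall m, C1c O (f_ m)) /\ (forall m x, 0 <= f_ m x <= 1) /\
  forall x, O x -> f_ m x @[m --> \oo] --> (1 : R).
Proof.
move=> oO.
pose good (p : 'rV[rat]_n * rat) := (0 < p.2)%R /\
  [set x : 'rV[R]_n | forall i, `|x 0 i - ratr (p.1 0 i)| <= ratr p.2] `<=` O.
pose b (p : 'rV[rat]_n * rat) : 'rV[R]_n -> R :=
  tentsq (\row_i ratr (p.1 0 i)) (ratr p.2).
pose B k : 'rV[R]_n -> R := if unpickle k is Some p then
  if `[< good p >] then b p else fun=> 0 else fun=> 0.
have BC k : C1c O (B k).
  rewrite /B; case: unpickle => [p|]; last exact: C1c0.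
  case: asboolP => [[p0 pO]|_]; last exact: C1c0.
  split; first exact: C1_tentsq.
  exists [set x : 'rV[R]_n | forall i, `|x 0 i - (\row_i ratr (p.1 0 i)) 0 i| <= ratr p.2].
  split; first exact: closed_cubeAt.
    by move=> x H; apply: pO => i; have := H i; rewrite mxE.
  move=> x /existsNP[i /negP]; rewrite -ltNge => H; apply: (@tentsq_eq0 _ _ _ _ _ i); last exact: ltW.
  by rewrite ler0q ltW.
have B0 k x : 0 <= B k x.
  rewrite /B; case: unpickle => [p|//]; case: asboolP => // _; exact: tentsq_ge0.
pose S m x := \sum_(k < m) B k x.
have SC m : C1c O (S m).
  elim: m => [|m IH].
    rewrite (_ : S 0%N = fun=> 0); first exact: C1c0.
    by apply/funext => x; rewrite /S big_ord0.
  rewrite (_ : S m.+1 = fun x => S m x + B m x); first exact: C1cD.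
  by apply/funext => x; rewrite /S big_ord_recr.
exists (fun m x => sat m (S m x)); split=> [m|].
  have [CS [K [cK KO SK]]] := SC m; split.
    apply: is_C1_C1; apply: (is_C1_comp (C1_is_C1 CS) (is_derive_sat m)).
    have sc : continuous (fun t : R => 1 + m%:R * t ^+ 2 : R).
      move=> t; apply: cvgD; first exact: cvg_cst.
      by apply: cvgM; [exact: cvg_cst|apply: exprn_continuous].
    move=> t; apply: cvgM.
      by apply: cvgM; [exact: cvg_cst|apply: cvgM; [exact: cvg_cst|exact: cvg_id]].
    apply: (@continuous_comp _ _ _ (fun t : R => (1 + m%:R * t ^+ 2)^-1) (fun u => u ^+ 2)).
      by apply: cvgV; [exact/lt0r_neq0/sat_den|exact: sc].
    exact: exprn_continuous.
  exists K; split=> // x /SK ->.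
  by rewrite /sat expr0n /= mulr0 addr0 invr1 subrr.
split=> [m x|x Ox].
  rewrite /sat subr_ge0 gerBl invr_ge0 (ltW (sat_den _ _)) andbT.
  by rewrite invf_le1 ?sat_den// lerDl mulr_ge0// sqr_ge0.
have /nbhs_ballP[e /= e0 eO] := open_nbhs_nbhs (conj oO Ox).
have [q /[!in_itv]/= /andP[q0 qe]] : exists q : rat, (ratr q : R) \in `]0, e / 2[.
  by apply: rat_in_itvoo; rewrite divr_gt0.
have /choice[f Hf] : forall i : 'I_n, exists r : rat, `|x 0 i - ratr r| < ratr q.
  move=> i; have [r /[!in_itv]/= /andP[? ?]] :
      exists r : rat, (ratr r : R) \in `]x 0 i - ratr q, x 0 i + ratr q[.
    by apply: rat_in_itvoo; lra.
  by exists r; rewrite ltr_distl; apply/andP; split; lra.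
pose p : 'rV[rat]_n * rat := (\row_i f i, q).
have gp : good p.
  split; first by rewrite /= -(@ltr0q R).
  move=> y Hy; apply: eO; apply/rv_ballP => // i.
  have := Hy i; have := Hf i; rewrite /= mxE => H1 H2.
  rewrite (_ : _ - _ = (x 0 i - ratr (f i)) - (y 0 i - ratr (f i))); last by ring.
  by rewrite (le_lt_trans (ler_normB _ _))//; lra.
have c0 : 0 < B (pickle p) x.
  rewrite /B pickleK asboolT//; apply: tentsq_gt0 => i; rewrite !mxE; exact: Hf.
set c := B (pickle p) x in c0.
have Sc m : (pickle p < m)%N -> c <= S m x.
  move=> pm; rewrite /S (bigD1 (Ordinal pm))//= lerDl; exact: sumr_ge0.
(* With this [a], [1 + m * S m x ^+ 2 >= a * (m + 1)] once [S m x >= c], so the gap to 1 is at most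
   [a^-1 / (m + 1)]. *)
pose a := Num.min 1 (c ^+ 2).
have a0 : 0 < a by rewrite lt_min ltr01 exprn_gt0.
rewrite -[X in _ --> X]subr0; apply: cvgB; first exact: cvg_cst.
apply: (@squeeze_cvgr _ _ _ _ (fun=> 0) (fun m => a^-1 * m.+1%:R^-1)).
- near=> m; rewrite invr_ge0 (ltW (sat_den _ _))/= -invfM lef_pV2 ?posrE ?sat_den//; last first.
    by rewrite mulr_gt0.
  rewrite -natr1 mulrDr mulr1 addrC lerD//; first by rewrite ge_min lexx.
  rewrite mulrC ler_wpM2l// (@le_trans _ _ (c ^+ 2))//; first by rewrite ge_min lexx orbT.
  have cS : c <= S m x by apply: Sc; near: m; exact: nbhs_infty_gt.
  by rewrite ler_pXn2r ?nnegrE ?(ltW c0)//; exact: le_trans (ltW c0) cS.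
- exact: cvg_cst.
- rewrite -[X in _ --> X](mulr0 a^-1); apply: cvgM; first exact: cvg_cst.
  exact: cvg_harmonic.
Unshelve. all: by end_near. Qed.

Lemma rv_measurable_open : @measurable _ 'rV[R]_n = <<s @open 'rV[R]_n >>.
Proof.
apply/seteqP; split; last first.
  apply: smallest_sub; first exact: sigma_algebra_measurable.
  exact: open_rv_measurable.
apply: smallest_sub; first exact: smallest_sigma_algebra.
move=> A; rewrite -bigcup_seq/= => -[i _ [C mC <-]]; rewrite setTI.
move: mC; rewrite /= => mC.
pose P (C : set R) := <<s @open 'rV[R]_n >> ((fun x : 'rV[R]_n => x 0 i) @^-1` C).
suff H : (@RGenOpens.G R).-sigma.-measurable `<=` P.
  by apply: H; rewrite -(RGenOpens.measurableE R).
apply: smallest_sub.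
  have [s0 sC sU] := smallest_sigma_algebra setT (@open 'rV[R]_n).
  split=> [|D|F]; rewrite /P.
  - by rewrite preimage_set0.
  - by rewrite setTD preimage_setC => /sC; rewrite setTD.
  - by move=> HF; rewrite preimage_bigcup; exact: sU.
move=> _ [a [b ->]]; apply: sub_sigma_algebra.
by apply: open_comp; [move=> z _; exact: coord_continuous|exact: interval_open].
Qed.
End uniqueness.

Section weak_unique.
Context {R : realType} {n : nat}.
Implicit Types (U O : set 'rV[R]_n).

Lemma compact_rv_measurable (K : set 'rV[R]_n) : compact K -> measurable K.
Proof.
by move=> cK; apply: closed_rv_measurable; apply: compact_closed => //; exact: norm_hausdorff.
Qed.

(** Open sets are stable under intersection and generate the sigma-algebra, so by Dynkin's argument
    the integral of [h] vanishes on every measurable set. *)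
Lemma open_integral0_ae (h : 'rV[R]_n -> R) :
  leb.-integrable setT (EFin \o h) ->
  (forall O, open O -> \int[leb]_(x in O) h x = 0) ->
  {ae leb, forall x, h x = 0}.
Proof.
move=> ih H0.
have fE (E : set 'rV[R]_n) : measurable E ->
    (\int[leb]_(x in E) (EFin \o h) x)%E \is a fin_num.
  by move=> mE; apply: integrable_fin_num => //; exact: integrableS ih.
have mh := measurable_int _ ih.
have H (E : set 'rV[R]_n) : measurable E -> (\int[leb]_(x in E) (EFin \o h) x = 0)%E.
  rewrite [X in X -> _](_ : _ = <<s @open 'rV[R]_n >> E); last by rewrite -rv_measurable_open.
  move: E; apply: (@dynkin_induction _ _ (@open 'rV[R]_n)).
  - exact: rv_measurable_open.
  - exact: openI.
  - by have := H0 _ openT; rewrite /Rintegral => /eqP; rewrite fine_eq0 ?fE// => /eqP.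
  - move=> O oO; have := H0 _ oO; rewrite /Rintegral => /eqP.
    by rewrite fine_eq0 ?fE//; [move=> /eqP|exact: open_rv_measurable].
  - move=> S mS S0.
    have : (\int[leb]_(x in S `|` ~` S) (EFin \o h) x = 0)%E.
      rewrite setUv; have := H0 _ openT; rewrite /Rintegral => /eqP.
      by rewrite fine_eq0 ?fE// => /eqP.
    rewrite integral_setU //=; first by rewrite S0 add0e.
    - exact: measurableC.
    - by rewrite setUv.
    - by apply/disj_setPS => x [].
  - move=> F mF tF F0; rewrite integral_bigcup//; first by rewrite eseries0.
    by apply: integrableS ih => //; exact: bigcup_measurable.
have := @integral_ae_eq _ _ R (@leb R n) setT measurableT (cst 0%E) (EFin \o h) ih (measurable_cst _).
move=> Hae; have : ae_eq leb setT (EFin \o h) (cst 0%E).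
  by apply: Hae => E _ mE; rewrite H// integral0.
by apply: filterS => x /(_ I) [].
Qed.

(** Weak derivatives are integrable on compact sets only; this reduces an almost everywhere property
    to open sets inside compact ones, through countably many rational cubes. *)
Lemma ae_cover_cubes U (P : 'rV[R]_n -> Prop) : open U ->
  (forall Q O, compact Q -> open O -> O `<=` Q -> Q `<=` U ->
    {ae leb, forall x, O x -> P x}) ->
  {ae leb, forall x, U x -> P x}.
Proof.
move=> oU H.
pose cl (p : 'rV[rat]_n * rat) :=
  [set x : 'rV[R]_n | forall i, `|x 0 i - ratr (p.1 0 i)| <= ratr p.2].
pose op (p : 'rV[rat]_n * rat) :=
  [set x : 'rV[R]_n | forall i, `|x 0 i - ratr (p.1 0 i)| < ratr p.2].
pose W k := if unpickle k is Some p then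
  if `[< cl p `<=` U >] then [set x | op p x /\ ~ P x] else set0 else set0.
have nW k : leb.-negligible (W k).
  rewrite /W; case: unpickle => [p|]; last exact: negligible_set0.
  case: asboolP => [pU|_]; last exact: negligible_set0.
  have ccl : compact (cl p).
    have := @closed_cubeAt R n (\row_i ratr (p.1 0 i)) (ratr p.2).
    by congr compact; apply/seteqP; split=> x /= Hx i; have := Hx i; rewrite mxE.
  have oop : open (op p).
    have [p0|p0] := ltP 0 (ratr p.2 : R).
      have := ball_open (\row_i ratr (p.1 0 i) : 'rV[R]_n) (ratr p.2).
      congr open; apply/seteqP; split=> x.
        by move=> /(rv_ballP _ _ p0) Hx i; have := Hx i; rewrite mxE distrC.
      by move=> Hx; apply/(rv_ballP _ _ p0) => i; have := Hx i; rewrite mxE distrC.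
    (* A box with nonpositive radius is empty, except in dimension 0, where it is the whole
       space. *)
    have [n0|/negP/negP] := boolP (n == 0)%N.
      rewrite (_ : op p = setT); first exact: openT.
      apply/seteqP; split=> // x _ i.
      by have := leq_ltn_trans (leq0n i) (ltn_ord i); rewrite lt0n n0.
    rewrite -lt0n => n0; rewrite (_ : op p = set0); first exact: open0.
    apply/seteqP; split=> // x /(_ (Ordinal n0)); rewrite ltNge => /negP; apply.
    exact: le_trans p0 (normr_ge0 _).
  have := H (cl p) (op p) ccl oop _ pU; move=> /(_ (fun x Hx i => ltW (Hx i))).
  by apply: negligibleS => x [Ox nP] /(_ Ox).
have := negligible_bigcup nW; apply: negligibleS => x /not_implyP[Ux nPx].
have /nbhs_ballP[e /= e0 eO] := open_nbhs_nbhs (conj oU Ux).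
have [q /[!in_itv]/= /andP[q0 qe]] : exists q : rat, (ratr q : R) \in `]0, e / 2[.
  by apply: rat_in_itvoo; rewrite divr_gt0.
have /choice[f Hf] : forall i : 'I_n, exists r : rat, `|x 0 i - ratr r| < ratr q.
  move=> i; have [r /[!in_itv]/= /andP[? ?]] :
      exists r : rat, (ratr r : R) \in `]x 0 i - ratr q, x 0 i + ratr q[.
    by apply: rat_in_itvoo; lra.
  by exists r; rewrite ltr_distl; apply/andP; split; lra.
exists (pickle (\row_i f i : 'rV[rat]_n, q)) => //.
rewrite /W pickleK asboolT; first by split => //= i; rewrite mxE.
move=> y Hy; apply: eO; apply/rv_ballP => // i.
have := Hy i; have := Hf i; rewrite /= mxE => H1 H2.
rewrite (_ : _ - _ = (x 0 i - ratr (f i)) - (y 0 i - ratr (f i))); last by ring.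
by rewrite (le_lt_trans (ler_normB _ _))//; lra.
Qed.

(** Both candidates integrate alike against the C^1 cut-offs that tend to the indicator of an open
    set; dominated convergence then makes the integral of their difference vanish on every open
    set. *)
Lemma weak_partial_unique U i w g1 g2 : open U ->
  is_weak_partial U i w g1 -> is_weak_partial U i w g2 ->
  {ae leb, forall x, U x -> g1 x = g2 x}.
Proof.
move=> oU [_ [m1 i1] H1] [_ [m2 i2] H2].
apply: ae_cover_cubes => // Q O cQ oO OQ QU.
have mU := open_rv_measurable oU; have mO := open_rv_measurable oO.
have mQ := compact_rv_measurable cQ.
pose g x := g1 x - g2 x.
have igQ : leb.-integrable Q (EFin \o g).
  exact: (integrableB mQ (i1 Q cQ QU) (i2 Q cQ QU)).
have igO : leb.-integrable O (EFin \o g) by exact: integrableS igQ.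
have gT : EFin \o (g \_ O) = (EFin \o g) \_ O.
  by apply/funext => x; rewrite /= !patchE; case: ifP.
suff : {ae leb, forall x, (g \_ O) x = 0}.
  apply: filterS => x; rewrite patchE /g => + Ox.
  by rewrite mem_set// => /eqP; rewrite subr_eq0 => /eqP.
apply: open_integral0_ae.
  by rewrite gT; apply/(integrable_mkcond _ mO).
move=> O' oO'; rewrite -Rintegral_mkcondr.
have oI : open (O' `&` O) by exact: openI.
have mI := open_rv_measurable oI.
have IQ : O' `&` O `<=` Q by move=> x [_ /OQ].
have [f_ [fC [f01 f1]]] := open_C1c_approx oI.
have igI : leb.-integrable (O' `&` O) (EFin \o g) by exact: integrableS igQ.
have mg : measurable_fun (O' `&` O) g by have /measurable_int/measurable_EFinP := igI.
have [|||||_ C] := @Rdominated_cvg R _ _ (@leb R n) (O' `&` O)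
    (fun m x => g x * f_ m x) g (fun x => `|g x|) mI.
- move=> m; apply: measurable_funM => //; apply: continuous_rv_measurable => //.
  by apply: C1_continuous; have [] := fC m.
- exact: mg.
- apply: aeW => x Ox; rewrite -[X in _ --> X]mulr1; apply: cvgM; first exact: cvg_cst.
  exact: f1.
- exact: integrable_norm.
- move=> m x _; rewrite normrM -[leRHS]mulr1 ler_wpM2l//.
  by have /andP[? ?] := f01 m x; rewrite ger0_norm.
have Z m : \int[leb]_(x in O' `&` O) (g x * f_ m x) = 0.
  have fU : C1c U (f_ m) by apply: C1c_sub (fC m); exact: subset_trans QU.
  have [Cf [K [cK KI fK]]] := fC m.
  have mK := compact_rv_measurable cK.
  have KU : K `<=` U by apply: subset_trans KI _; exact: subset_trans QU.
  have gf0 (h : 'rV[R]_n -> R) V : K `<=` V -> \int[leb]_(x in V) (h x * f_ m x) =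
      \int[leb]_(x in K) (h x * f_ m x).
    move=> KV; rewrite (@Rintegral_supp _ _ _ _ V); last first.
      by move=> x nV; rewrite fK ?mulr0// => /KV.
    by rewrite (@Rintegral_supp _ _ _ _ K)// => x nK; rewrite fK ?mulr0.
  have cf : continuous (f_ m) by exact: C1_continuous.
  have ih (h : 'rV[R]_n -> R) : leb.-integrable K (EFin \o h) ->
      leb.-integrable K (EFin \o (fun x => h x * f_ m x)).
    move=> ih; have := @integrableMl _ _ _ (@leb R n) K mK (EFin \o h) (f_ m) ih.
    apply; first exact: continuous_rv_measurable.
    exists 1; split => // M M1 x _ /=; have /andP[? ?] := f01 m x.
    by rewrite ger0_norm// (le_trans _ (ltW M1)).
  rewrite gf0//.
  have -> : (fun x => g x * f_ m x) = (fun x => g1 x * f_ m x - g2 x * f_ m x).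
    by apply/funext => x; rewrite /g mulrBl.
  have j1 := ih _ (i1 K cK KU); have j2 := ih _ (i2 K cK KU).
  rewrite RintegralB//.
  rewrite -(gf0 g1 U)// -(gf0 g2 U)//.
  have := H1 _ fU; rewrite (H2 _ fU) => /oppr_inj ->.
  by rewrite subrr.
move: C; under eq_fun do rewrite Z.
by move=> C; exact: (cvg_unique _ C (cvg_cst (0 : R))).
Qed.

(** Bridge between the arbitrary choice made by [wgrad] and any gradient computed explicitly. *)
Lemma weak_grad_wgrad U w (G : 'rV[R]_n -> 'rV[R]_n) : open U ->
  is_weak_grad U w G ->
  is_weak_grad U w (wgrad U w) /\ {ae leb, forall x, U x -> wgrad U w x = G x}.
Proof.
move=> oU wG.
have W : is_weak_grad U w (wgrad U w) by rewrite /wgrad; apply: xgetPex; exists G.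
split=> //.
have H i : {ae leb, forall x, U x -> wgrad U w x 0 i = G x 0 i}.
  exact: weak_partial_unique (W i) (wG i).
have := filter_forall (ae_filter_ringOfSetsType leb) H.
by apply: filterS => x Hx Ux; apply/rowP => i; exact: Hx.
Qed.
End weak_unique.

(** * Mollification *)

Section mollifier.
Context {R : realType} {n : nat}.
Implicit Types (w phi psi : 'rV[R]_n -> R).

Lemma leb_cube_gt0 m (r : R) : 0 < r -> (0 < @leb R m (cube m r))%E.
Proof.
move=> r0; elim: m => [|m IH].
  by rewrite /= diracE mem_set ?lte_fin// => -[].
rewrite /= /leb_step /pushforward.
rewrite (_ : _ @^-1` _ = cube m r `*` `[-r, r]%classic); last first.
  apply/seteqP; split=> -[x y] /=.
    move=> H; split=> [i|]; last first.
      by have := H ord_max; rewrite mxE unlift_none in_itv/= ler_norml.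
    by have := H (lift ord_max i); rewrite mxE liftK.
  move=> [H1 H2] i; rewrite mxE; case: unliftP => [j _|_]; first exact: H1.
  by rewrite ler_norml; move: H2; rewrite in_itv.
rewrite product_measure1E //; last exact: measurable_cube.
have H : (0 < lebesgue_measure (`[(- r)%R, r]%classic : set R))%E.
  by rewrite lebesgue_measure_itv/= lte_fin ifT ?lte_fin -?EFinB ?lte_fin; lra.
exact: mule_gt0.
Qed.

(** The mollifying kernel, left without normalisation: [avg] divides by its mass. *)
Definition krn (h : R) : 'rV[R]_n -> R := tentsq 0 h.

Lemma ker_ge0 h z : 0 <= krn h z. Proof. exact: tentsq_ge0. Qed.

Lemma ker_supp h z : 0 <= h -> ~ cube n h z -> krn h z = 0.
Proof.
move=> h0 /existsNP[i /negP]; rewrite -ltNge => H.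
by apply: (@tentsq_eq0 _ _ _ _ _ i) => //; rewrite mxE subr0 ltW.
Qed.

Lemma C1_ker h : C1 (krn h). Proof. exact: C1_tentsq. Qed.

Lemma continuous_ker h : continuous (krn h).
Proof. exact/C1_continuous/C1_ker. Qed.

Lemma C1c_ker h : 0 <= h -> C1c setT (krn h).
Proof.
move=> h0; split; first exact: C1_ker.
exists (cube n h); split=> //.
  have := @closed_cubeAt R n 0 h; congr compact.
  by apply/seteqP; split=> z H i; have := H i; rewrite mxE subr0.
by move=> z; exact: ker_supp.
Qed.

Lemma continuous_supp_integrable r phi : 0 <= r -> continuous phi ->
  (forall z, ~ cube n r z -> phi z = 0) -> leb.-integrable setT (EFin \o phi).
Proof.
move=> r0 cphi s0; have [B HB] := continuous_bounded_cube r0 cphi.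
apply: (@integrable_supp _ _ r `|B|) => //.
  exact: continuous_rv_measurable.
move=> z; have [zr|/s0->] := pselect (cube n r z); last by rewrite normr0.
by rewrite (le_trans (HB z zr))// ler_norm.
Qed.

Lemma ker_integrable h phi : 0 <= h -> continuous phi ->
  leb.-integrable setT (EFin \o (fun z => phi z * krn h z)).
Proof.
move=> h0 cphi; apply: (@continuous_supp_integrable h) => //.
  by move=> z; apply: continuousM; [exact: cphi|exact: continuous_ker].
by move=> z nz; rewrite ker_supp// mulr0.
Qed.

Definition kmass (h : R) : R := \int[leb]_z krn h z.

Lemma kmass_gt0 h : 0 < h -> 0 < kmass h.
Proof.
move=> h0; have h20 : 0 < h / 2 by rewrite divr_gt0.
have ik : leb.-integrable setT (EFin \o krn h).
  apply: (@continuous_supp_integrable h) => //; rewrite ?ltW//.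
    exact: continuous_ker.
  by move=> z; apply: ker_supp; exact: ltW.
(* Lower bound of the kernel on the cube of half the radius, obtained factor by factor. *)
pose a := sqpos (h ^+ 2 - (h / 2) ^+ 2) ^+ n.
have a0 : 0 < a.
  apply: exprn_gt0; apply: sqpos_gt0; rewrite subr_gt0 ltr_pXn2r ?nnegrE//; lra.
have Ha z : cube n (h / 2) z -> a <= krn h z.
  move=> Hz; rewrite /a /krn /tentsq -[n in _ ^+ n]card_ord -prodr_const.
  apply: ler_prod => i _; rewrite sqpos_ge0 /= mxE subr0 /sqpos.
  have H1 : z 0 i ^+ 2 <= (h / 2) ^+ 2.
    by rewrite -[leLHS]real_normK ?num_real// ler_pXn2r ?nnegrE ?(ltW h20)//.
  have H2 : (h / 2) ^+ 2 <= h ^+ 2 by rewrite ler_pXn2r ?nnegrE//; lra.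
  by rewrite ler_pXn2r ?nnegrE ?le_max ?lexx// !max_r; lra.
have ic : leb.-integrable (cube n (h / 2)) (EFin \o krn h).
  by apply: integrableS ik => //; exact: measurable_cube.
have mc := @measurable_cube R n (h / 2).
apply: (@lt_le_trans _ _ (\int[leb]_(z in cube n (h / 2)) a)).
  rewrite Rintegral_cst// mulr_gt0// fine_gt0// leb_cube_gt0//=.
  exact: leb_cube.
rewrite /kmass Rintegral_mkcond [leRHS]Rintegral_mkcond; apply: le_Rintegral => //.
- rewrite (_ : EFin \o _ = (EFin \o cst a) \_ (cube n (h / 2))).
    apply/(integrable_mkcond _ mc); apply: measurable_bounded_integrable => //.
      exact: leb_cube.
    exact: bounded_cst.
  by apply/funext => z; rewrite /= !patchE; case: ifP.
- by rewrite patch_setT.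
- move=> z _; rewrite !patchE in_setT; case: ifPn => [/set_mem/Ha//|_].
  exact: ker_ge0.
Qed.

Definition avg (h : R) phi : R := (kmass h)^-1 * \int[leb]_z (phi z * krn h z).

Lemma avgB h phi psi : 0 <= h -> continuous phi -> continuous psi ->
  avg h (fun z => phi z - psi z) = avg h phi - avg h psi.
Proof.
move=> h0 c1 c2; rewrite /avg -mulrBr -RintegralB//; try exact: ker_integrable.
by congr (_ * _); apply: eq_Rintegral => z _; rewrite mulrBl.
Qed.

Lemma avg_cst h (a : R) : 0 < h -> avg h (fun=> a) = a.
Proof.
move=> h0; rewrite /avg RintegralZl//; last first.
  apply: (@continuous_supp_integrable h); first exact: ltW.
    exact: continuous_ker.
  by move=> z; apply: ker_supp; exact: ltW.
by rewrite mulrCA mulVf ?mulr1// gt_eqF// kmass_gt0.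
Qed.

Lemma avg_le h phi (eta : R) : 0 < h -> continuous phi ->
  (forall z, cube n h z -> `|phi z| <= eta) -> `|avg h phi| <= eta.
Proof.
move=> h0 cphi Hphi; rewrite /avg normrM normfV [`|kmass h|]gtr0_norm ?kmass_gt0//.
have i1 := ker_integrable (ltW h0) cphi.
rewrite ler_pdivrMl ?kmass_gt0//; apply: (le_trans (le_normr_Rintegral measurableT i1)).
have ik : leb.-integrable setT (EFin \o krn h).
  apply: (@continuous_supp_integrable h); first exact: ltW.
    exact: continuous_ker.
  by move=> z; apply: ker_supp; exact: ltW.
rewrite /kmass mulrC -RintegralZl//; apply: le_Rintegral => //.
- exact: (integrable_norm i1).
- exact: (integrableZl measurableT _ ik).
move=> z _; rewrite normrM [`|krn h z|]ger0_norm ?ker_ge0//.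
have [zh|nz] := pselect (cube n h z); first by rewrite ler_wpM2r ?ker_ge0// Hphi.
by rewrite ker_supp ?mulr0// ltW.
Qed.

(** Written as a mean of translates of [w], so that linearity, constants and sup bounds on the cube
    pass from [avg] to the mollification and to its difference quotients. *)
Definition moll (h : R) w (x : 'rV[R]_n) := avg h (fun z => w (z + x)).

Lemma continuous_translate w (x : 'rV[R]_n) : continuous w ->
  continuous (fun z : 'rV[R]_n => w (z + x)).
Proof.
move=> cw z A /= /cw /(nbhs_ballP (z + x))[e /= e0 H].
apply/nbhs_ballP; exists e => //= y; rewrite mx_norm_ball /ball_/= => yz.
by apply: (H (y + x)); rewrite mx_norm_ball /ball_/= opprD addrACA subrr addr0.
Qed.

Lemma moll_approx h w L x : 0 < h -> 0 <= L -> lip L w -> `|moll h w x - w x| <= L * h.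
Proof.
move=> h0 L0 wL; have cw := lip_continuous wL.
have ct := @continuous_translate w x cw.
rewrite -{1}(avg_cst (w x) h0) -avgB//; [|exact: ltW|exact: cst_continuous].
apply: avg_le => //.
  by move=> z; apply: continuousB; [exact: ct|exact: cst_continuous].
move=> z Hz; rewrite (le_trans (wL _ _))// addrK ler_wpM2l//.
by apply/rv_norm_leP => //; exact: ltW.
Qed.

(** The derivative falls on the kernel [krn h (z - x)], whence the minus sign. *)
Definition dmoll (h : R) w i (x : 'rV[R]_n) : R :=
  - ((kmass h)^-1 * \int[leb]_z (w z * 'D_(unit_vec i) (krn h) (z - x))).

Lemma is_C1_moll h w L r : 0 < h -> 0 <= r -> lip L w ->
  (forall z, ~ cube n r z -> w z = 0) -> is_C1 (moll h w) (dmoll h w).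
Proof.
move=> h0 r0 wL ws i.
have cw := lip_continuous wL.
have mw : measurable_fun setT w by exact: continuous_rv_measurable.
have [Lk Lk0 kL] := C1c_lip (C1c_ker (ltW h0)).
have kD := C1_is_C1 (C1_ker h).
have [kd kc] := kD i.
(* A translation moves [x] from [w], which is only Lipschitz, to the kernel, which is C^1. *)
have mollE (x : 'rV[R]_n) : moll h w x = (kmass h)^-1 * \int[leb]_z (w z * krn h (z - x)).
  rewrite /moll /avg; congr (_ * _).
  rewrite -[RHS](leb_Rtranslation x); first by apply: eq_Rintegral => z _; rewrite addrK.
  apply: measurable_funM => //; apply: continuous_rv_measurable => //.
  exact/continuous_translate/continuous_ker.
have iw : leb.-integrable setT (EFin \o w).
  exact: (@continuous_supp_integrable r).
have kB (z : 'rV[R]_n) : `|'D_(unit_vec i) (krn h) z| <= Lk.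
  apply: (@cvgr_to_le _ _ _ _ _ _ _ (cvg_norm (is_derive_quot (kd z)))).
  apply: nearW => m /=.
  rewrite normrM [`|m.+1%:R|]ger0_norm// -ler_pdivlMr//.
  rewrite (le_trans (kL _ _))// addrAC subrr add0r normrZ gtr0_norm ?invr_gt0//.
  by rewrite ler_wpM2l// -[leRHS]mulr1 ler_wpM2l ?unit_vec_norm// invr_ge0.
have contD : continuous (fun x : 'rV[R]_n => \int[leb]_z (w z * 'D_(unit_vec i) (krn h) (z - x))).
  have iD : leb.-integrable setT (EFin \o 'D_(unit_vec i) (krn h)).
    apply: (@continuous_supp_integrable h) => //; first exact: ltW.
    move=> z nz; rewrite (@near_eq_derive _ _ _ (krn h) (cst 0)) ?derive_cst//.
    have oK : open (~` (cube n h : set 'rV[R]_n)) by apply: closed_openC; exact: closed_cube.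
    apply: filterS (open_nbhs_nbhs (conj oK nz)) => y nKy; apply: ker_supp => //; exact: ltW.
  (* For continuity in [x] the translation is undone: with [x] inside [w], the Lipschitz bound
     applies. *)
  have DE (x : 'rV[R]_n) : \int[leb]_z (w z * 'D_(unit_vec i) (krn h) (z - x)) =
      \int[leb]_z (w (z + x) * 'D_(unit_vec i) (krn h) z).
    rewrite -(leb_Rtranslation x); first by apply: eq_Rintegral => z _; rewrite addrK.
    apply: measurable_funM => //; apply: continuous_rv_measurable => //.
    exact: (continuous_translate kc).
  have iwD (x : 'rV[R]_n) : leb.-integrable setT
      (EFin \o (fun z => w (z + x) * 'D_(unit_vec i) (krn h) z)).
    apply: (@continuous_supp_integrable h) => //; first exact: ltW.
      by move=> z; exact: (continuousM (@continuous_translate w x cw z) (kc z)).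
    move=> z nz; rewrite (@near_eq_derive _ _ _ (krn h) (cst 0)) ?derive_cst ?mulr0//.
    have oK : open (~` (cube n h : set 'rV[R]_n)) by apply: closed_openC; exact: closed_cube.
    apply: filterS (open_nbhs_nbhs (conj oK nz)) => y nKy; apply: ker_supp => //; exact: ltW.
  apply: (@lip_continuous _ _ (L * \int[leb]_z `|'D_(unit_vec i) (krn h) z|)) => x y.
  rewrite !DE -RintegralB// (le_trans (le_normr_Rintegral _ _))//.
    exact: (integrableB measurableT (iwD x) (iwD y)).
  rewrite mulrAC -RintegralZl//; last exact: (integrable_norm iD).
  apply: le_Rintegral => //.
  - exact: (integrable_norm (integrableB measurableT (iwD x) (iwD y))).
  - exact: (integrableZl measurableT _ (integrable_norm iD)).
  move=> z _; rewrite -mulrBl normrM ler_wpM2r// (le_trans (wL _ _))//.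
  by rewrite opprD addrACA subrr add0r.
split=> [x|x]; last first.
  exact: (continuousN (continuousM (@cst_continuous _ _ (kmass h)^-1 x) (contD x))).
apply: is_derive_line0.
pose f (t : R) z := w z * krn h (z - (x + t *: unit_vec i)).
have df (t : R) z : is_derive t (1 : R) (f ^~ z)
    (w z * - 'D_(unit_vec i) (krn h) (z - (x + t *: unit_vec i))).
  have K0 : is_derive ((z - x) + (- t) *: unit_vec i) (unit_vec i) (krn h)
      ('D_(unit_vec i) (krn h) (z - (x + t *: unit_vec i))).
    rewrite opprD scaleNr addrA; exact: kd.
  have K := is_derive1_comp (is_derive_line K0) (is_deriveNid t (1 : R)).
  have K1 := is_deriveZ (w z) K.
  rewrite (_ : f ^~ z = w z \*: ((fun s => krn h (z - x + s *: unit_vec i)) \o -%R)).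
    by apply: (is_derive_eq K1); rewrite /GRing.scale/= mulrN1.
  by apply/funext => s; rewrite /f /= scaleNr opprD addrA.
have d1 (t : R) z : partial1of2 f t z =
    w z * - 'D_(unit_vec i) (krn h) (z - (x + t *: unit_vec i)).
  by rewrite partial1of2E; case: (df t z).
pose F (t : R) := \int[leb]_z f t z.
have intf (t : R) : leb.-integrable setT (EFin \o f t).
  apply: (@continuous_supp_integrable r) => //.
    have ck := @continuous_translate (krn h) (- (x + t *: unit_vec i)) (@continuous_ker h).
    by rewrite /f => z; exact: (continuousM (cw z) (ck z)).
  by move=> z nz; rewrite /f ws// mul0r.
have dF : is_derive (0 : R) (1 : R) F
    (\int[leb]_z (w z * - 'D_(unit_vec i) (krn h) (z - x))).
  have -> : \int[leb]_z (w z * - 'D_(unit_vec i) (krn h) (z - x)) =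
      \int[leb]_z partial1of2 f 0 z.
    by apply: eq_Rintegral => z _; rewrite d1 scale0r addr0.
  have I0 : `]-1, 1[%classic (0 : R) by rewrite /= in_itv/= ltrN10 ltr01.
  have G0 z : 0 <= `|w z| * Lk by rewrite mulr_ge0.
  have iG : leb.-integrable setT (EFin \o (fun z => `|w z| * Lk)).
    have := integrableZr measurableT Lk (integrable_norm iw).
    by apply: eq_integrable => // z _; rewrite /= EFinM.
  have C := @cvg_differentiation_under_integral R _ _ (@leb R n) f setT measurableT
    0 (-1) 1 I0 (fun t _ => intf t) (fun t z _ _ => @ex_derive _ _ _ _ _ _ _ (df t z)) _ G0 iG.
  have {}C : t^-1 *: (F (t + 0) - F 0) @[t --> 0^'] --> \int[leb]_z partial1of2 f 0 z.
    by apply: C => t z _ _; rewrite d1 normrM normrN ler_wpM2l// kB.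
  have E : (fun t : R => t^-1 *: ((F \o shift 0) (t *: (1 : R)) - F 0)) =
      (fun t => t^-1 *: (F (t + 0) - F 0)).
    by apply/funext => t /=; rewrite scaler1.
  split; first by apply/cvg_ex; exists (\int[leb]_z partial1of2 f 0 z); rewrite E.
  by rewrite /derive E; exact: cvg_lim.
have := is_deriveZ (kmass h)^-1 dF.
rewrite (_ : (fun s => _) = (kmass h)^-1 \*: F); last first.
  by apply/funext => t; rewrite mollE.
move=> K; apply: (is_derive_eq K).
rewrite /dmoll /GRing.scale/= -mulrN; congr (_ * _).
rewrite -mulN1r -RintegralZl//; last first.
  apply: (@continuous_supp_integrable r) => //.
    by move=> z; exact: (continuousM (cw z) (@continuous_translate _ (- x) kc z)).
  by move=> z nz; rewrite ws// mul0r.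
by apply: eq_Rintegral => z _; rewrite mulrN mulN1r.
Qed.

(** Uniformity in the base point is what makes the derivatives of mollifications
    converge to [g] at [x]. *)
Definition strict_partial w i x (g : R) := forall eta, 0 < eta ->
  exists2 d, 0 < d & forall y (t : R), `|y - x| < d -> `|t| < d ->
    `|w (y + t *: unit_vec i) - w y - t * g| <= eta * `|t|.

(** A difference quotient of the mollification is the mean of the difference quotients of [w] at
    points within [h] of [x]; a bound uniform over these points passes to the limit. *)
Lemma dmoll_le h w L r i x g (eta d : R) : 0 < h -> 0 <= r -> lip L w ->
  (forall z, ~ cube n r z -> w z = 0) -> 0 < d ->
  (forall y (t : R), `|y - x| <= h -> `|t| < d ->
    `|w (y + t *: unit_vec i) - w y - t * g| <= eta * `|t|) ->
  `|dmoll h w i x - g| <= eta.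
Proof.
move=> h0 r0 wL ws d0 H; have cw := lip_continuous wL.
have [mD _] := is_C1_moll h0 r0 wL ws i.
have C : `|(moll h w (x + m.+1%:R^-1 *: unit_vec i) - moll h w x) * m.+1%:R - g|
    @[m --> \oo] --> `|dmoll h w i x - g|.
  apply: cvg_norm; apply: cvgB; last exact: cvg_cst.
  exact: (is_derive_quot (mD x)).
apply: (cvgr_to_le C); near=> m.
have md : m.+1%:R^-1 < d by near: m; exact: (near_infty_natSinv_lt (PosNum d0)).
have m0 : 0 < m.+1%:R^-1 :> R by rewrite invr_gt0.
set t : R := m.+1%:R^-1 in md m0 *.
have tE : m.+1%:R = t^-1 by rewrite invrK.
have c1 a := @continuous_translate w a cw.
have -> : (moll h w (x + t *: unit_vec i) - moll h w x) * m.+1%:R - g =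
    avg h (fun z => w (z + (x + t *: unit_vec i)) - w (z + x) - t * g) * t^-1.
  rewrite avgB ?avgB ?avg_cst ?ltW//.
  - by rewrite tE [RHS]mulrBl; congr (_ - _); rewrite [t * g]mulrC mulfK// gt_eqF.
  - by move=> z; exact: (continuousB (c1 _ z) (c1 _ z)).
  - by move=> z; exact: cst_continuous.
rewrite normrM [`|t^-1|]gtr0_norm ?invr_gt0// ler_pdivrMr//.
apply: avg_le => //.
  move=> z; exact: (continuousB (continuousB (c1 (x + t *: unit_vec i) z) (c1 x z))
    (@cst_continuous _ _ (t * g) z)).
move=> z Hz; rewrite addrA (le_trans (H _ _ _ _))//.
- by rewrite addrK; apply/rv_norm_leP => //; exact: ltW.
- by rewrite gtr0_norm.
- by rewrite gtr0_norm.
Unshelve. all: by end_near. Qed.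

Lemma dmoll_lip h w L r i x : 0 < h -> 0 <= r -> lip L w ->
  (forall z, ~ cube n r z -> w z = 0) -> 0 <= L -> `|dmoll h w i x| <= L.
Proof.
move=> h0 r0 wL ws L0; rewrite -[dmoll _ _ _ _]subr0.
(* With [g = 0] the Lipschitz bound holds for every step, so the radius 1 is arbitrary. *)
apply: (@dmoll_le h w L r i x 0 L 1) => // y t _ _.
rewrite mulr0 subr0 (le_trans (wL _ _))// addrAC subrr add0r normrZ.
by rewrite ler_wpM2l// -[leRHS]mulr1 ler_wpM2l ?unit_vec_norm.
Qed.

Lemma dmoll_cvg w L r i x g (h : nat -> R) : 0 <= r -> lip L w ->
  (forall z, ~ cube n r z -> w z = 0) ->
  (forall m, 0 < h m) -> h m @[m --> \oo] --> 0 -> strict_partial w i x g ->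
  dmoll (h m) w i x @[m --> \oo] --> g.
Proof.
move=> r0 wL ws h0 hc sp; apply/cvgrPdist_le => e e0.
have [d d0 Hd] := sp e e0.
near=> m; rewrite distrC; apply: (@dmoll_le (h m) w L r i x g e d) => // y t yx td.
apply: Hd => //; apply: le_lt_trans yx _; rewrite -[h m]gtr0_norm//.
by rewrite -normrN -sub0r; near: m; apply: cvgr_dist_lt.
Unshelve. all: by end_near. Qed.

Lemma strict_partial_quot w i x g : strict_partial w i x g ->
  (w x - w (x - m.+1%:R^-1 *: unit_vec i)) * m.+1%:R @[m --> \oo] --> g.
Proof.
move=> sp; apply/cvgrPdist_le => e e0; have [d d0 Hd] := sp e e0.
near=> m.
have md : m.+1%:R^-1 < d by near: m; exact: (near_infty_natSinv_lt (PosNum d0)).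
set t : R := m.+1%:R^-1 in md *.
have t0 : 0 < t by rewrite invr_gt0.
have tE : m.+1%:R = t^-1 by rewrite invrK.
have := Hd x (- t); rewrite subrr normr0 normrN [`|t|]gtr0_norm// scaleNr => /(_ d0 md).
rewrite -ler_pdivrMr// -[t in X in X <= _ -> _]gtr0_norm// -normf_div => H.
apply: le_trans H; rewrite tE le_eqVlt; apply/orP; left; apply/eqP; congr `|_|.
by rewrite gtr0_norm//; field; rewrite gt_eqF.
Unshelve. all: by end_near. Qed.
End mollifier.

(** * Finite element functions *)

Section geometry.
Context {R : realType}.

Lemma dot_split n (a z : 'rV[R]_n.+1) :
  dot a z = dot (hor a) (hor z) + ver a * ver z.
Proof.
rewrite /dot big_ord_recr /=; congr (_ + _); apply: eq_bigr => i _.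
rewrite !mxE (_ : widen_ord _ i = lift ord_max i)//.
by apply: val_inj; rewrite /= /bump leqNgt ltn_ord add0n.
Qed.

Lemma dot0l n (z : 'rV[R]_n) : dot 0 z = 0.
Proof. by apply: big1 => i _; rewrite mxE mul0r. Qed.

Lemma C1_dot n (a : 'rV[R]_n) : C1 (dot a).
Proof. by apply: C1_sum => i _; apply: C1Z; exact: C1_coord. Qed.

Lemma C1_hor_coord n (i : 'I_n) : C1 (fun z : 'rV[R]_n.+1 => hor z 0 i).
Proof.
rewrite (_ : (fun _ => _) = (fun z : 'rV[R]_n.+1 => z 0 (lift ord_max i))).
  exact: C1_coord.
by apply/funext => z; rewrite mxE.
Qed.

(** If the horizontal part of the normal is nonzero, horizontal sections are hyperplanes one
    dimension lower; otherwise the normal is vertical and each vertical line meets the set in one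
    point. *)
Lemma hyperplane_null n (a : 'rV[R]_n) (b : R) : a != 0 ->
  leb [set x | dot a x + b = 0] = 0%E.
Proof.
elim: n a b => [|n IH] a b a0; first by move: a0; rewrite (thinmx0 a) eqxx.
have mB m (c : 'rV[R]_m) (d : R) : measurable [set x | dot c x + d = 0].
  apply: closed_rv_measurable.
  apply: (@closed_comp _ _ (fun x => dot c x + d) [set 0]); last exact: closed_eq.
  move=> x _; apply: continuousD; last exact: cst_continuous.
  exact: (C1_continuous (C1_dot c)).
have [h0|h0] := eqVneq (hor a) 0; last first.
  apply: leb_null_hsections => // y.
  rewrite (_ : [set x | _] = [set x | dot (hor a) x + (ver a * y + b) = 0]); first exact: IH.
  by apply/seteqP; split=> x /=; rewrite dot_split hor_pt ver_pt addrA.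
apply: leb_null_vsections => // x.
have v0 : ver a != 0.
  apply: contra a0 => /eqP v0; rewrite -(ptK a) h0 v0.
  by apply/eqP/rowP => i; rewrite !mxE; case: unliftP => // j _; rewrite mxE.
rewrite (_ : [set y | _] = [set - b / ver a]) ?lebesgue_measure_set1//.
apply/seteqP; split=> y /=; rewrite dot_split hor_pt ver_pt h0 dot0l add0r.
  by move=> /eqP; rewrite addr_eq0 => /eqP <-; rewrite mulrC mulKf.
by move=> ->; rewrite mulrC divfK// addNr.
Qed.

(** In homogeneous coordinates (x, 1), affine independence is invertibility. *)
Definition bary n (v : 'I_n.+1 -> 'rV[R]_n) (x : 'rV[R]_n) : 'rV[R]_n.+1 :=
  pt x 1 *m invmx (\matrix_i pt (v i) 1).

Lemma pt_sum n m (t : 'I_m -> R) (v : 'I_m -> 'rV[R]_n) :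
  (\row_i t i) *m (\matrix_i pt (v i) 1) = pt (\sum_i t i *: v i) (\sum_i t i).
Proof.
apply/rowP => j; rewrite !mxE; case: unliftP => [k ->|->].
  rewrite summxE; apply: eq_bigr => i _; rewrite !mxE liftK.
  by [].
by apply: eq_bigr => i _; rewrite !mxE unlift_none mulr1.
Qed.

Lemma bary_unit n (v : 'I_n.+1 -> 'rV[R]_n) : affinely_independent v ->
  (\matrix_i pt (v i) 1) \in unitmx.
Proof.
move=> av; rewrite -row_free_unit; apply/row_freeP.
have : row_free (\matrix_i pt (v i) 1).
  apply/inj_row_free => t; rewrite (_ : t = \row_i t 0 i); last by apply/rowP => i; rewrite mxE.
  rewrite pt_sum => E.
  have E1 : \sum_i t 0 i *: v i = 0.
    by rewrite -[LHS](hor_pt _ (\sum_i t 0 i)) E; apply/rowP => j; rewrite !mxE.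
  have E2 : \sum_i t 0 i = 0.
    by rewrite -[LHS](ver_pt (\sum_i t 0 i *: v i)) E /ver mxE.
  by apply/rowP => i; rewrite !mxE; exact: av.
by move/row_freeP.
Qed.

Lemma hull_bary n (v : 'I_n.+1 -> 'rV[R]_n) x : affinely_independent v ->
  hull v x <-> forall i, 0 <= bary v x 0 i.
Proof.
move=> av; have uM := bary_unit av; split=> [[t [t0 t1 ->]] i|H].
  have -> : bary v (\sum_i t i *: v i) = \row_i t i; last by rewrite mxE.
  have := pt_sum t v; rewrite t1 => E.
  by rewrite /bary -[X in X *m _]E mulmxK.
have E : bary v x *m (\matrix_i pt (v i) 1) = pt x 1 by rewrite mulmxKV.
rewrite (_ : bary v x = \row_i bary v x 0 i) in E; last by apply/rowP => i; rewrite mxE.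
rewrite pt_sum in E; exists (fun i => bary v x 0 i); split => //.
  by rewrite -[LHS](ver_pt (\sum_i bary v x 0 i *: v i)) E ver_pt.
by rewrite -[LHS](hor_pt x 1) -E hor_pt.
Qed.

(** Common form of simplices and rectangles. Nonzero normals matter: they put the boundary of a cell
    in finitely many null hyperplanes. *)
Lemma cell_halfspaces n (K : cell R n) : (1 <= n)%N -> Defs.nondegenerate K ->
  exists m (a : 'I_m -> 'rV[R]_n) (b : 'I_m -> R), (forall j, a j != 0) /\
    forall x, cell_set K x <-> forall j, 0 <= dot (a j) x + b j.
Proof.
move=> n1; case: K => [v|lo up] /= nd.
  have uM := bary_unit nd; set N := invmx (\matrix_i pt (v i) 1).
  have BE x i : bary v x 0 i = dot (hor (\row_j N j i)) x + N ord_max i.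
    rewrite /bary mxE; transitivity (dot (\row_j N j i) (pt x 1)).
      by apply: eq_bigr => j _; rewrite [in RHS]mxE mulrC.
    by rewrite dot_split hor_pt ver_pt mulr1 /ver mxE.
  exists n.+1, (fun i => hor (\row_j N j i)), (fun i => N ord_max i); split.
    (* A zero normal would make the i-th barycentric coordinate constant, yet it is 1 at vertex i
       and 0 at any other; a second vertex exists since [1 <= n]. *)
    move=> i; apply/negP => /eqP h0.
    have bv k : bary v (v k) = delta_mx 0 k.
      rewrite /bary (_ : pt (v k) 1 = delta_mx 0 k *m (\matrix_i pt (v i) 1)) ?mulmxK//.
      by rewrite -rowE rowK.
    have c k : bary v (v k) 0 i = N ord_max i by rewrite BE h0 dot0l add0r.
    have [k ki] : exists k : 'I_n.+1, k != i.
      exists (if i == ord0 then ord_max else ord0).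
      case: (eqVneq i ord0) => [->|]; last by rewrite eq_sym.
      by rewrite -val_eqE /= -lt0n.
    have := c i; rewrite -(c k) !bv !mxE !eqxx /= eq_sym (negbTE ki) => /eqP.
    by rewrite oner_eq0.
  by move=> x; rewrite hull_bary//; split=> H i; have := H i; rewrite BE.
(* One half-space per coordinate and side, [true] standing for the lower face. *)
pose s (p : 'I_n * bool) : R := if p.2 then 1 else -1.
pose p (k : 'I_#|{: 'I_n * bool}|) := enum_val k.
exists _, (fun k => s (p k) *: unit_vec (p k).1),
  (fun k => if (p k).2 then - lo 0 (p k).1 else up 0 (p k).1).
have dE (i : 'I_n) (x : 'rV[R]_n) (c : R) : dot (c *: unit_vec i) x = c * x 0 i.
  rewrite /dot (bigD1 i)//= !mxE eqxx big1 ?addr0 ?eqxx ?mulr1// => j ji.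
  by rewrite !mxE (negbTE ji) mulr0 mul0r.
split=> [k|x].
  apply/negP => /eqP /rowP /(_ (p k).1); rewrite !mxE !eqxx /= mulr1 /s => /eqP.
  by case: (p k).2; rewrite ?oppr_eq0 oner_eq0.
split=> [H k|H i].
  rewrite dE /s; have /andP[H1 H2] := H (p k).1.
  by case: (p k).2; rewrite ?mul1r ?mulN1r; lra.
have h1 := H (enum_rank (i, true)); have h2 := H (enum_rank (i, false)).
rewrite dE /p /s enum_rankK /= mul1r in h1.
rewrite dE /p /s enum_rankK /= mulN1r in h2.
by apply/andP; split; lra.
Qed.
End geometry.

(** * Gluing Lipschitz bounds *)

Section gluing.
Context {R : realType}.

(** Induction on the number of pieces: follow the piece containing [a] up to its last time [t1],
    then continue from there without it. The lengths of successive intervals add up, so the constant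
    does not grow with the number of pieces. *)
Lemma glue_interval (g : R -> R) (L : R) (E : nat -> set R) (s : seq nat) (a b : R) :
  a <= b -> (forall k, k \in s -> closed (E k)) ->
  (forall t, a <= t <= b -> exists2 k, k \in s & E k t) ->
  (forall k t u, k \in s -> E k t -> E k u -> `|g t - g u| <= L * `|t - u|) ->
  `|g b - g a| <= L * (b - a).
Proof.
have [m] := ubnP (size s); elim: m => // m IH in s a *.
rewrite ltnS => sm ab cE cov gL.
have aab : a <= a <= b by rewrite lexx ab.
have [k ks Eka] := cov a aab.
pose S := E k `&` `[a, b]%classic.
have S0 : S !=set0 by exists a; split=> //=; rewrite in_itv/=.
have hS : has_sup S.
  by split=> //; exists b => t [_ /=]; rewrite in_itv/= => /andP[].
have cS : closed S by apply: closedI; [exact: cE|exact: interval_closed].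
set t1 := sup S.
have St1 : S t1.
  by move/closure_id: (cS) => {1}->; apply: closure_sup; [exact: S0|case: hS].
have [Et1 /= /[!in_itv]/= /andP[at1 t1b]] := St1.
have gt1 : `|g t1 - g a| <= L * (t1 - a).
  by rewrite (le_trans (gL k t1 a ks Et1 Eka))// ger0_norm// subr_ge0.
have [<-//|t1nb] := eqVneq t1 b.
have t1ltb : t1 < b by rewrite lt_neqAle t1nb.
pose s' := [seq j <- s | j != k].
have s's : (size s' < m)%N.
  apply: leq_trans sm; rewrite /s' size_filter -(count_predC (fun j => j != k) s) -addn1 leq_add2l.
  by rewrite -has_count; apply/hasP; exists k => //=; rewrite negbK.
have s'P j : j \in s' -> j \in s by rewrite mem_filter => /andP[].
have out t : t1 < t -> t <= b -> ~ E k t.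
  move=> t1t tb Et; have : t <= t1.
    apply: ub_le_sup; first by case: hS.
    by split=> //=; rewrite in_itv/= tb (le_trans at1 (ltW t1t)).
  by rewrite leNgt t1t.
have cov' t : t1 <= t <= b -> exists2 j, j \in s' & E j t.
  move=> /andP[]; rewrite le_eqVlt => /predU1P[<- _|t1t tb]; last first.
    have [|j js Ej] := cov t; first by rewrite tb (le_trans at1 (ltW t1t)).
    exists j => //; rewrite mem_filter js andbT /=.
    by apply/eqP => jk; apply: (out t) => //; rewrite -jk.
  (* At [t1] itself another piece is needed: if all remaining closed pieces avoided [t1], they would
     avoid a neighbourhood, and points slightly to its right would be covered by none. *)
  apply: contrapT => nE.
  have H : forall j, j \in s' -> nbhs t1 (~` E j).
    move=> j js; apply: open_nbhs_nbhs; split; first exact/closed_openC/cE/s'P.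
    by move=> Ej; apply: nE; exists j.
  have : nbhs t1 [set t | forall j, j \in s' -> ~ E j t].
    elim: (s') H => [|j r IHr] H; first by apply: filterS filterT => u _ j.
    have h1 := H j (mem_head _ _).
    have h2 := IHr (fun i ir => H i (mem_behead (s := j :: r) ir)).
    apply: filterS (filterI h1 h2) => u [p1 p2] i; rewrite inE => /predU1P[->//|].
    exact: p2.
  move=> /nbhs_ballP[e /= e0 He].
  pose u := Num.min b (t1 + e / 2).
  have ub : u <= b by rewrite ge_min lexx.
  have t1u : t1 < u by rewrite lt_min t1ltb ltrDl divr_gt0.
  have ue : `|t1 - u| < e.
    rewrite distrC gtr0_norm ?subr_gt0// ltrBlDr (le_lt_trans (_ : u <= t1 + e / 2))//.
      by rewrite ge_min lexx orbT.
    by rewrite addrC ltrD2r; lra.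
  have [|j js Ej] := cov u; first by rewrite ub (le_trans at1 (ltW t1u)).
  apply: (He u ue j) => //; rewrite mem_filter js andbT /=.
  by apply/eqP => jk; apply: (out u) => //; rewrite -jk.
have g2 : `|g b - g t1| <= L * (b - t1).
  by apply: (IH s') => // j; [move=> /s'P; exact: cE|move=> t u /s'P; exact: gL].
rewrite (_ : g b - g a = (g b - g t1) + (g t1 - g a)); last by ring.
by rewrite (le_trans (ler_normD _ _))//; lra.
Qed.

(** Along a segment the pieces cut out closed sets of times. They must cover the whole space, since
    a segment between two points may leave the domain. *)
Lemma glue_lip n (w : 'rV[R]_n -> R) (L : R) (E : nat -> set 'rV[R]_n) (s : seq nat) :
  (forall k, k \in s -> closed (E k)) ->
  (forall z, exists2 k, k \in s & E k z) ->
  (forall k z u, k \in s -> E k z -> E k u -> `|w z - w u| <= L * `|z - u|) ->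
  lip L w.
Proof.
move=> cE cov wL x y.
pose g (t : R) := w (y + t *: (x - y)).
have cl : continuous (fun t : R => y + t *: (x - y)).
  move=> t A /= /(nbhs_ballP (y + t *: (x - y)))[e /= e0 H].
  have d0 : 0 < `|x - y| + 1 by rewrite ltr_wpDl.
  apply/nbhs_ballP; exists (e / (`|x - y| + 1)); first exact: divr_gt0.
  move=> u /= tu; apply: H; rewrite mx_norm_ball /ball_/= opprD addrACA subrr add0r.
  rewrite -scalerBl normrZ; move: tu; rewrite /ball/= ltr_pdivlMr//; apply: le_lt_trans.
  by rewrite ler_wpM2l// lerDl.
have := @glue_interval g (L * `|x - y|) (fun k => [set t | E k (y + t *: (x - y))]) s 0 1.
rewrite /g scale1r scale0r addr0 subr0 mulr1 addrCA subrr addr0; apply => //.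
- by move=> k ks; apply: (@closed_comp _ _ _ (E k)); [move=> t _; exact: cl|exact: cE].
- by move=> t _; have [k] := cov (y + t *: (x - y)); exists k.
- move=> k t u ks Et Eu; rewrite (le_trans (wL k _ _ ks Et Eu))//.
  by rewrite opprD addrACA subrr add0r -scalerBl normrZ mulrAC mulrA.
Qed.
End gluing.

Section strict_partials.
Context {R : realType} {n : nat}.

(** Subtracting the linear function [g * z 0 i] leaves a derivative below [eta] near [x], and the
    mean value theorem applies along the i-th direction. *)
Lemma C1_strict_partial (P : 'rV[R]_n -> R) i x : C1 P ->
  strict_partial P i x ('D_(unit_vec i) P x).
Proof.
move=> CP eta eta0; have PD := C1_is_C1 CP; have [Pd Pc] := PD i.
set g := 'D_(unit_vec i) P x.
have : nbhs x (('D_(unit_vec i) P) @^-1` ball g eta) by apply: Pc; exact: nbhsx_ballx.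
move=> /(nbhs_ballP x)[d /= d0 Hd].
exists (d / 2); first by rewrite divr_gt0.
move=> y t yx td.
pose f z := P z + (- g) * z 0 i.
have fC := is_C1D PD (is_C1Z (- g) (@is_C1_coord R n i)).
have [fd _] := fC i.
have fE z : 'D_(unit_vec i) f z = 'D_(unit_vec i) P z - g.
  by case: (fd z) => _ ->; rewrite eqxx mulr1.
have -> : P (y + t *: unit_vec i) - P y - t * g = f (y + t *: unit_vec i) - f y.
  by rewrite /f !mxE eqxx /= eqxx mulr1; ring.
apply: line_lip => s; first by case: (fd (y + s *: unit_vec i)).
move=> st; rewrite fE distrC; apply: ltW; apply: (Hd (y + s *: unit_vec i)).
rewrite mx_norm_ball /ball_/=.
rewrite (_ : x - _ = (x - y) - s *: unit_vec i); last by rewrite opprD addrA.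
rewrite (le_lt_trans (ler_normB _ _))// (_ : d = d / 2 + d / 2); last by field.
rewrite ltrD//; first by rewrite distrC.
apply: le_lt_trans td; rewrite normrZ.
apply: (@le_trans _ _ (`|s| * 1)); first by rewrite ler_wpM2l// unit_vec_norm.
rewrite mulr1; move/orP: st => [|] /andP[? ?]; first by rewrite !ger0_norm//; lra.
by rewrite !ler0_norm//; lra.
Qed.

Lemma strict_partial_near (w P : 'rV[R]_n -> R) i x g :
  nbhs x [set y | w y = P y] -> strict_partial P i x g -> strict_partial w i x g.
Proof.
move=> /(nbhs_ballP x)[d /= d0 Hd] sP eta eta0.
have [d' d'0 H] := sP eta eta0.
exists (Num.min d' (d / 2)); first by rewrite lt_min d'0 divr_gt0.
move=> y t; rewrite !lt_min => /andP[y1 y2] /andP[t1 t2].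
have d2d : d / 2 < d by lra.
rewrite !Hd ?H//; rewrite mx_norm_ball /ball_/= distrC ?(lt_trans y2)//.
rewrite addrAC (le_lt_trans (ler_normD _ _))// (_ : d = d / 2 + d / 2); last by field.
rewrite ltrD// normrZ; apply: le_lt_trans t2.
by rewrite -[leRHS]mulr1 ler_wpM2l// unit_vec_norm.
Qed.

Lemma glue_lip_fin (I : finType) (w : 'rV[R]_n -> R) (L : R) (E : I -> set 'rV[R]_n) :
  (forall k, closed (E k)) -> (forall z, exists k, E k z) ->
  (forall k z u, E k z -> E k u -> `|w z - w u| <= L * `|z - u|) -> lip L w.
Proof.
move=> cE cov wL.
pose E' (k : nat) := if insub k is Some o then E (@enum_val I predT o) else set0.
apply: (@glue_lip _ _ w L E' (iota 0 #|I|)).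
- move=> k _; rewrite /E'; case: insubP=> [l Hl El|Nl]; [exact: cE|exact: closed0].
- move=> z; have [k Ek] := cov z; exists (enum_rank k : nat).
    by rewrite mem_iota /= add0n ltn_ord.
  by rewrite /E' valK enum_rankK.
- move=> k z u _; rewrite /E'; case: insubP=> [l Hl El|Nl]; [exact: wL|by []].
Qed.

Lemma open_gt0 (f : 'rV[R]_n -> R) : continuous f -> open [set z | 0 < f z].
Proof.
move=> cf; apply: (@open_comp _ _ f [set t | 0 < t]); first by move=> z _; exact: cf.
exact: open_gt.
Qed.

Lemma closed_ge0 (f : 'rV[R]_n -> R) : continuous f -> closed [set z | 0 <= f z].
Proof.
move=> cf; apply: (@closed_comp _ _ f [set t | 0 <= t]); first by move=> z _; exact: cf.
exact: closed_ge.
Qed.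

Lemma continuous_hor : continuous (fun z : 'rV[R]_n.+1 => hor z).
Proof.
move=> z A /= /(nbhs_ballP (hor z))[e /= e0 H].
apply/nbhs_ballP; exists e => //= y /(rv_ballP _ _ e0) zy; apply: H.
by apply/(rv_ballP _ _ e0) => i; have := zy (lift ord_max i); rewrite !mxE.
Qed.

Lemma cube_hv (r : R) (z : 'rV[R]_n.+1) :
  cube n.+1 r z <-> cube n r (hor z) /\ `|ver z| <= r.
Proof.
split=> [H|[H1 H2] i]; first by split=> [i|]; [rewrite mxE|]; exact: H.
have := congr1 (fun u : 'rV[R]_n.+1 => u 0 i) (ptK z); rewrite /= => <-.
by rewrite mxE; case: unliftP => [j _ | _]; [exact: H1|exact: H2].
Qed.

Lemma C1_local_poly (K : cell R n) p : local_poly K p ->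
  C1 (fun z : 'rV[R]_n.+1 => p (hor z)).
Proof.
case: K => [v|lo up] /=.
  move=> [a [b pE]].
  rewrite (_ : (fun _ => _) = (fun z : 'rV[R]_n.+1 => a + dot b (hor z))); last first.
    by apply/funext => z; rewrite pE.
  apply: C1D; first exact: C1_cst.
  by apply: C1_sum => i _; apply: C1Z; exact: C1_hor_coord.
move=> [a pE].
rewrite (_ : (fun _ => _) = (fun z : 'rV[R]_n.+1 =>
    \sum_(S : {set 'I_n}) a S * \prod_(i in S) hor z 0 i)); last first.
  by apply/funext => z; rewrite pE.
apply: C1_sum => S _; apply: C1Z; apply: C1_prod => i _; exact: C1_hor_coord.
Qed.
Lemma negligible_hyperplane m (a : 'rV[R]_m) (b : R) : a != 0 ->
  leb.-negligible [set x | dot a x + b = 0].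
Proof.
move=> a0; exists [set x | dot a x + b = 0]; split=> //; last exact: hyperplane_null.
apply: closed_rv_measurable.
apply: (@closed_comp _ _ (fun x => dot a x + b) [set 0]); last exact: closed_eq.
move=> x _; exact: (C1_continuous (C1D (C1_dot a) (C1_cst _))).
Qed.
End strict_partials.

(** [W] is controlled on the closed cylinder only. The reflection puts the face y = 0 in the
    interior, and the extension by zero stays continuous because [W] vanishes on [Gamma_D]. *)
Definition cylext {R : realType} {n : nat} (Omega : set 'rV[R]_n) (Y : R)
    (W : 'rV[R]_n.+1 -> R) (z : 'rV[R]_n.+1) : R :=
  if `[< Omega (hor z) /\ `|ver z| < Y >] then W (pt (hor z) `|ver z|) else 0.

Section fe_extension.
Context {R : realType} {n : nat}.
Variables (Omega : set 'rV[R]_n) (Y : R) (N : nat) (K : 'I_N -> cell R n)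
  (M : nat) (yy : nat -> R) (W : 'rV[R]_n.+1 -> R).
Hypotheses (n1 : (1 <= n)%N) (oO : open Omega) (bO : bounded_set Omega)
  (Y0 : 0 < Y) (ndK : forall i, Defs.nondegenerate (K i))
  (covK : closure Omega = \bigcup_i cell_set (K i))
  (part : is_partition Y M yy) (WV : in_V Omega Y K M yy W).

Let w := cylext Omega Y W.

Lemma cylext_in z : Omega (hor z) -> `|ver z| < Y -> w z = W (pt (hor z) `|ver z|).
Proof. by move=> H1 H2; rewrite /w /cylext asboolT. Qed.

Lemma cylext_out z : ~ (Omega (hor z) /\ `|ver z| < Y) -> w z = 0.
Proof. by move=> H; rewrite /w /cylext asboolF. Qed.

Lemma cylext_cyl z : cyl Omega Y z -> w z = W z.
Proof.
move=> [Oz /andP[z0 zY]]; rewrite cylext_in ?gtr0_norm//.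
by rewrite ptK.
Qed.

Lemma partition_mono j k : (j <= k)%N -> (k <= M)%N -> yy j <= yy k.
Proof.
case: part => _ _ H; elim: k => [|k IH]; first by rewrite leqn0 => /eqP ->.
rewrite leq_eqVlt => /predU1P[->//|]; rewrite ltnS => jk kM.
by rewrite (le_trans (IH jk (ltnW kM)))// ltW// H.
Qed.

Lemma partition_find y : 0 <= y < Y -> exists2 j, (j < M)%N & yy j <= y < yy j.+1.
Proof.
case: part => y0 yM _ /andP[y1 y2].
have H k : (k <= M)%N -> y < yy k -> exists2 j, (j < k)%N & yy j <= y < yy j.+1.
  elim: k => [|k IH] kM yk; first by move: yk; rewrite y0 ltNge y1.
  have [yk'|yk'] := ltP y (yy k); last by exists k => //; rewrite yk'.
  by have [j jk Hj] := IH (ltnW kM) yk'; exists j => //; rewrite ltnS ltnW.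
by apply: (H M) => //; rewrite yM.
Qed.

Lemma cell_sub i : cell_set (K i) `<=` closure Omega.
Proof. by move=> x Kx; rewrite covK; exists i. Qed.

(** [sg] selects the cell or its mirror image in {y = 0}. *)
Lemma cylext_piece i j (sg : bool) : (j < M)%N -> exists P : 'rV[R]_n.+1 -> R, C1 P /\
  forall z, cell_set (K i) (hor z) -> yy j <= (-1) ^+ sg * ver z <= yy j.+1 -> w z = P z.
Proof.
case: WV => _ Wp W0 jM; have [p [q [lp lq H]]] := Wp i j jM.
exists (fun z => p (hor z) + ((-1) ^+ sg * ver z) * q (hor z)); split.
  apply: C1D; first exact: C1_local_poly lp.
  apply: C1M; last exact: C1_local_poly lq.
  by apply: C1Z; exact: C1_coord.
move=> z Kz jz.
have yj0 : 0 <= yy j by case: part => <- _ _; apply: partition_mono => //; exact: ltnW.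
have yjY : yy j.+1 <= Y by case: part => _ <- _; apply: partition_mono.
have vz : (-1) ^+ sg * ver z = `|ver z|.
  have : 0 <= (-1) ^+ sg * ver z by case/andP: jz => /(le_trans yj0).
  case: (sg) => /=; rewrite ?expr1 ?expr0 ?mulN1r ?mul1r => vz.
    by rewrite ler0_norm// -oppr_ge0.
  by rewrite ger0_norm.
rewrite vz in jz *; rewrite -H//.
(* On the boundary the extension is zero by definition and the polynomial is zero because [W]
   vanishes on [Gamma_D]; thus they agree on the whole closed cell. *)
have [Oz|nOz] := pselect (Omega (hor z) /\ `|ver z| < Y).
  by case: Oz => *; rewrite cylext_in.
rewrite cylext_out// W0//.
have vY : `|ver z| <= Y by case/andP: jz => _ /le_trans->.
have [Oz|nO] := pselect (Omega (hor z)).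
  right; rewrite /= hor_pt ver_pt; split=> //; apply/eqP; rewrite eq_le vY /= leNgt.
  by apply/negP => zY; apply: nOz.
by left; rewrite /= hor_pt ver_pt normr_ge0 vY; split=> //; split=> //; exact: cell_sub Kz.
Qed.

Lemma cylext_supp : exists2 r, 0 < r & closure Omega `<=` cube n r /\ Y <= r.
Proof.
have [r r0 Or] := bounded_cube bO.
exists (Num.max r Y); first by rewrite lt_max r0.
split; last by rewrite le_max lexx orbT.
have Or' : Omega `<=` cube n (Num.max r Y).
  by move=> x /Or H i; rewrite (le_trans (H i))// le_max lexx.
by have /closure_id -> := @closed_cube R n (Num.max r Y); exact: closure_subset.
Qed.

Lemma cell_closed i : closed (cell_set (K i)).
Proof.
have [m [a [b [_ H]]]] := cell_halfspaces n1 (ndK i).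
rewrite (_ : cell_set (K i) = \bigcap_j [set x | 0 <= dot (a j) x + b j]).
  apply: closed_bigI => j _; apply: closed_ge0.
  exact: C1_continuous (C1D (C1_dot (a j)) (C1_cst _)).
by apply/seteqP; split=> [x /H Hx j _|x Hx]; [exact: Hx|apply/H => j; exact: Hx].
Qed.

(** Each closed piece carries the Lipschitz constant of its polynomial on a bounded cube; the sum of
    these constants bounds them all. *)
Lemma cylext_lip : exists2 L, 0 <= L & lip L w.
Proof.
have [r r0 [Or Yr]] := cylext_supp.
pose T := ('I_N * 'I_M * bool)%type.
have /choice[L HL] : forall k : T, exists L, 0 <= L /\ forall z u,
    cell_set (K k.1.1) (hor z) -> yy k.1.2 <= (-1) ^+ k.2 * ver z <= yy k.1.2.+1 ->
    cell_set (K k.1.1) (hor u) -> yy k.1.2 <= (-1) ^+ k.2 * ver u <= yy k.1.2.+1 ->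
    `|w z - w u| <= L * `|z - u|.
  move=> [[i j] sg] /=.
  have [P [CP wP]] := @cylext_piece i j sg (ltn_ord j).
  have [L L0 PL] := C1_lip_cube (ltW r0) (C1_is_C1 CP).
  exists L; split=> // z u z1 z2 u1 u2; rewrite !wP//.
  have H v : cell_set (K i) (hor v) -> yy j <= (-1) ^+ sg * ver v <= yy j.+1 -> cube n.+1 r v.
    move=> v1 /andP[v2 v3]; apply/cube_hv; split; first by apply: Or; exact: cell_sub v1.
    apply: le_trans Yr; case: part => y0 yM _.
    have a1 : 0 <= yy j by rewrite -y0; apply: partition_mono => //; exact: ltnW.
    have a2 : yy j.+1 <= Y by rewrite -yM; apply: partition_mono.
    rewrite ler_norml; move: v2 v3; case: (sg); rewrite ?expr1 ?expr0 ?mulN1r ?mul1r => *.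
      by apply/andP; split; lra.
    by apply/andP; split; lra.
  by apply: PL; apply: H.
have L0 : 0 <= \sum_k L k by apply: sumr_ge0 => k _; case: (HL k).
exists (\sum_k L k) => //.
(* [Some] gives a prism or its mirror image, [None] the complement of the open double cylinder,
   where [w] is zero. *)
pose E (o : option T) : set 'rV[R]_n.+1 := if o is Some k then
  [set z | cell_set (K k.1.1) (hor z)] `&`
  ([set z | 0 <= (-1) ^+ k.2 * ver z - yy k.1.2] `&`
  [set z | 0 <= yy k.1.2.+1 - (-1) ^+ k.2 * ver z])
  else ~` ([set z | Omega (hor z)] `&` [set z | 0 < Y - `|ver z|]).
have cver : continuous (fun z : 'rV[R]_n.+1 => ver z) by move=> z; exact: coord_continuous.
apply: (@glue_lip_fin _ _ _ w _ E).
- case=> [k|] /=.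
    apply: closedI.
      by apply: (@closed_comp _ _ (fun z => hor z)); [move=> z _; exact: continuous_hor|exact: cell_closed].
    have Cv : C1 (fun z : 'rV[R]_n.+1 => (-1) ^+ k.2 * ver z) by apply: C1Z; exact: C1_coord.
    apply: closedI; apply: closed_ge0.
      exact: C1_continuous (C1B Cv (C1_cst _)).
    exact: C1_continuous (C1B (C1_cst _) Cv).
  apply: open_closedC; apply: openI.
    by apply: (@open_comp _ _ (fun z => hor z)) => // z _; exact: continuous_hor.
  apply: open_gt0; apply: (@lip_continuous _ _ 1) => u v.
  rewrite mul1r (_ : _ - _ - _ = `|ver v| - `|ver u|); last by ring.
  rewrite [leRHS]distrC.
  apply: (le_trans (ler_dist_dist _ _)).
  by have := rv_coord_le (v - u) ord_max; rewrite !mxE.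
- move=> z; have [[Oz zY]|nz] := pselect (Omega (hor z) /\ `|ver z| < Y); last first.
    by exists None => -[/= a b]; apply: nz; split => //; rewrite -subr_gt0.
  have : closure Omega (hor z) by exact: subset_closure.
  rewrite covK => -[i _ Ki].
  have [|j jM /andP[j1 j2]] := @partition_find `|ver z|; first by rewrite normr_ge0.
  exists (Some (i, Ordinal jM, ver z < 0)); split=> //=.
  have -> : (-1) ^+ (ver z < 0)%R * ver z = `|ver z|.
    have [v0|v0] := ltrP (ver z) 0; first by rewrite expr1 mulN1r ltr0_norm.
    by rewrite expr0 mul1r ger0_norm.
  by split; rewrite subr_ge0 ?j1// ltW.
- case=> [k|] z u.
    rewrite /E /= !subr_ge0 => -[z1 [z2 z3]] [u1 [u2 u3]].
    have [Lk H] := HL k; apply: (@le_trans _ _ (L k * `|z - u|)).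
      by apply: H => //; rewrite ?z2 ?u2.
    rewrite ler_wpM2r// (bigD1 k)//= lerDl; apply: sumr_ge0 => l _; by case: (HL l).
  move=> /= nz nu; rewrite !cylext_out ?subrr ?normr0 ?mulr_ge0//.
    by move=> [a b]; apply: nu; split => //=; rewrite subr_gt0.
  by move=> [a b]; apply: nz; split => //=; rewrite subr_gt0.
Qed.

(** Away from the faces of the cells and from the levels y = [yy j], the function is a single
    polynomial near the point. Points of the cylinder have y > 0, so only unreflected pieces
    occur. *)
Lemma cylext_strict :
  {ae leb, forall z, cyl Omega Y z -> forall i, exists g, strict_partial w i z g}.
Proof.
have bad i : leb.-negligible [set z : 'rV[R]_n.+1 | cell_set (K i) (hor z) /\
    ~ nbhs z [set u : 'rV[R]_n.+1 | cell_set (K i) (hor u)]].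
  have [m [a [b [a0 H]]]] := cell_halfspaces n1 (ndK i).
  apply: (@negligibleS _ _ _ _
      (\bigcup_(j in [set: 'I_m]) [set z | dot (pt (a j) 0) z + b j = 0])).
    move=> z [/H Kz nz]; apply: contrapT => nb; apply: nz.
    have lpos j : 0 < dot (a j) (hor z) + b j.
      rewrite lt_neqAle Kz andbT eq_sym; apply/eqP => E; apply: nb; exists j => //=.
      by rewrite dot_split hor_pt ver_pt mul0r addr0.
    have hj j : \forall u \near z, 0 < dot (pt (a j) 0) u + b j.
      apply: open_nbhs_nbhs; split; last first.
        by rewrite /= dot_split hor_pt ver_pt mul0r addr0.
      by apply: open_gt0; exact: C1_continuous (C1D (C1_dot _) (C1_cst _)).
    have := filter_forall (nbhs_filter z) hj.
    apply: filterS => u Hu; apply/H => j; have := Hu j.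
    by rewrite /= dot_split hor_pt ver_pt mul0r addr0 => /ltW.
  pose F (k : nat) : set 'rV[R]_n.+1 :=
    if insub k is Some j then [set z | dot (pt (a j) 0) z + b j = 0] else set0.
  apply: (@negligibleS _ _ _ _ (\bigcup_k F k)).
    by move=> z [j _ zj]; exists (j : nat) => //; rewrite /F valK.
  apply: negligible_bigcup => k; rewrite /F; case: insubP=> [j Hj Ej|Nj]; last first.
    exact: negligible_set0.
  apply: negligible_hyperplane.
  apply: contra (a0 j) => /eqP E; apply/eqP; rewrite -(hor_pt (a j) 0) E.
  by apply/rowP => l; rewrite !mxE.
have badv j : leb.-negligible [set z : 'rV[R]_n.+1 | ver z = yy j].
  rewrite (_ : [set z | _] = [set z | dot (pt 0 1) z + - yy j = 0]).
    apply: negligible_hyperplane; apply/eqP => /rowP /(_ ord_max).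
    by rewrite !mxE unlift_none => /eqP; rewrite oner_eq0.
  apply/seteqP; split=> z /=; rewrite dot_split hor_pt ver_pt dot0l add0r mul1r.
    by move=> ->; rewrite subrr.
  by move=> /eqP; rewrite subr_eq0 => /eqP.
pose B (k : nat) : set 'rV[R]_n.+1 := if insub k is Some i then
  [set z : 'rV[R]_n.+1 | cell_set (K i) (hor z) /\
    ~ nbhs z [set u : 'rV[R]_n.+1 | cell_set (K i) (hor u)]] else set0.
have nB k : leb.-negligible (B k).
  rewrite /B; case: insubP=> [i Hi Ei|Ni]; [exact: bad|exact: negligible_set0].
apply: negligibleS (negligibleU (negligible_bigcup nB) (negligible_bigcup badv)).
move=> z /not_implyP[Cz nz]; apply: contrapT => /not_orP[nb nv]; apply: nz => i.
have [Oz /andP[z0 zY]] := Cz.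
have : closure Omega (hor z) by exact: subset_closure.
rewrite covK => -[k _ Kk].
have nk : nbhs z [set u : 'rV[R]_n.+1 | cell_set (K k) (hor u)].
  by apply: contrapT => nk; apply: nb; exists (k : nat) => //; rewrite /B valK.
have [|j jM /andP[j1 j2]] := @partition_find (ver z); first by rewrite ltW.
have j1' : yy j < ver z.
  by rewrite lt_neqAle j1 andbT; apply/eqP => E; apply: nv; exists j.
have [P [CP wP]] := @cylext_piece k j false jM.
exists ('D_(unit_vec i) P z); apply: strict_partial_near (C1_strict_partial i z CP).
have o1 : open [set u : 'rV[R]_n.+1 | 0 < ver u - yy j].
  by apply: open_gt0; exact: C1_continuous (C1B (C1_coord _) (C1_cst _)).
have o2 : open [set u : 'rV[R]_n.+1 | 0 < yy j.+1 - ver u].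
  by apply: open_gt0; exact: C1_continuous (C1B (C1_cst _) (C1_coord _)).
have h1 : nbhs z [set u : 'rV[R]_n.+1 | 0 < ver u - yy j].
  by apply: open_nbhs_nbhs; split=> //=; rewrite subr_gt0.
have h2 : nbhs z [set u : 'rV[R]_n.+1 | 0 < yy j.+1 - ver u].
  by apply: open_nbhs_nbhs; split=> //=; rewrite subr_gt0.
apply: filterS (filterI nk (filterI h1 h2)) => u [Ku [/= u1 u2]].
by apply: wP => //; rewrite expr0 mul1r; apply/andP; split; lra.
Qed.

Lemma cylext_restr0 x : Omega x -> w (pt x 0) = W (pt x 0).
Proof. by move=> Ox; rewrite cylext_in ?hor_pt ?ver_pt ?normr0. Qed.

Lemma cylext_cube : exists2 r, 0 < r & forall z, ~ cube n.+1 r z -> w z = 0.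
Proof.
have [r r0 [Or Yr]] := cylext_supp; exists r => // z nz; apply: cylext_out.
move=> [Oz zY]; apply: nz; apply/cube_hv; split.
  by apply: Or; exact: subset_closure.
by rewrite (le_trans (ltW zY)).
Qed.
End fe_extension.

(** * Truncated mollifications *)

Section truncation.
Context {R : realType}.

(** For e > 0, an odd C^1 soft threshold: zero on [-e, e] and equal to t - 3e/2 for t >= 2e; its
    derivative rises linearly from 0 to 1 between e and 2e. *)
Definition trunc (e t : R) : R := (2 * e)^-1 *
  ((sqpos (t - e) - sqpos (t - 2 * e)) - (sqpos (- t - e) - sqpos (- t - 2 * e))).

Definition dtrunc (e t : R) : R := (2 * e)^-1 *
  ((2 * Num.max 0 (t - e) - 2 * Num.max 0 (t - 2 * e)) +
   (2 * Num.max 0 (- t - e) - 2 * Num.max 0 (- t - 2 * e))).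

Lemma is_derive_sqpos_shift (a c t : R) :
  is_derive t (1 : R) (fun t => sqpos (a * t - c)) (a * (2 * Num.max 0 (a * t - c))).
Proof.
have H : is_derive t (1 : R) (fun t : R => a * t - c) a.
  have K := is_deriveB (is_deriveZ a (is_derive_id t (1 : R))) (is_derive_cst c t (1 : R)).
  rewrite (_ : (fun _ => _) = a \*: id - cst c)//; apply: (is_derive_eq K).
  by rewrite /GRing.scale/= mulr1 subr0.
have := @is_derive1_comp R sqpos (fun t => a * t - c) t _ _ (is_derive_sqpos (a * t - c)) H.
by move=> K; apply: (is_derive_eq K); rewrite mulrC.
Qed.

Lemma is_derive_trunc e t : is_derive t (1 : R) (trunc e) (dtrunc e t).
Proof.
have K1 := is_derive_sqpos_shift 1 e t.
have K2 := is_derive_sqpos_shift 1 (2 * e) t.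
have K3 := is_derive_sqpos_shift (-1) e t.
have K4 := is_derive_sqpos_shift (-1) (2 * e) t.
have K := is_deriveZ ((2 * e)^-1) (is_deriveB (is_deriveB K1 K2) (is_deriveB K3 K4)).
rewrite (_ : trunc e = (2 * e)^-1 \*: ((fun t => sqpos (1 * t - e)) -
   (fun t => sqpos (1 * t - 2 * e)) -
   ((fun t => sqpos (-1 * t - e)) - (fun t => sqpos (-1 * t - 2 * e))))).
  by apply: (is_derive_eq K); rewrite /GRing.scale/= /dtrunc !mul1r !mulN1r; ring.
by apply/funext => x; rewrite !fctE /trunc /GRing.scale/= !mul1r !mulN1r.
Qed.

Lemma continuous_dtrunc e : continuous (dtrunc e).
Proof.
have H (a c : R) : continuous (fun t : R => 2 * Num.max 0 (a * t - c)).
  move=> t; apply: cvgM; first exact: cvg_cst.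
  apply: (@continuous_comp _ _ _ (fun t : R => a * t - c) (fun t => Num.max 0 t)).
    by apply: cvgB; [apply: cvgM; [exact: cvg_cst|exact: cvg_id]|exact: cvg_cst].
  exact: continuous_pos.
have -> : dtrunc e = (fun t => (2 * e)^-1 *
    ((2 * Num.max 0 (1 * t - e) - 2 * Num.max 0 (1 * t - 2 * e)) +
     (2 * Num.max 0 (-1 * t - e) - 2 * Num.max 0 (-1 * t - 2 * e)))).
  by apply/funext => t; rewrite /dtrunc !mul1r !mulN1r.
move=> t; apply: cvgM; first exact: cvg_cst.
by apply: cvgD; apply: cvgB; exact: H.
Qed.

Lemma dtrunc01 e t : 0 < e -> 0 <= dtrunc e t <= 1.
Proof.
move=> e0; rewrite /dtrunc; set X := (X in _ * X).
have /andP[X0 X2] : 0 <= X <= 2 * e.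
  rewrite /X /Num.max; apply/andP; split; do ?case: ltP => ?; lra.
apply/andP; split; last by rewrite ler_pdivrMl ?mulr_gt0// mulr1.
by apply: mulr_ge0 => //; rewrite invr_ge0 mulr_ge0// ltW.
Qed.

Lemma trunc_eq0 e t : 0 < e -> `|t| <= e -> trunc e t = 0.
Proof.
move=> e0; rewrite ler_norml => /andP[? ?].
by rewrite /trunc !sqpos_eq0 ?subrr ?mulr0//; lra.
Qed.

Lemma trunc_approx e t : 0 < e -> `|trunc e t - t| <= 2 * e.
Proof.
move=> e0; have e20 : 0 < 2 * e by rewrite mulr_gt0.
rewrite (_ : trunc e t - t = (2 * e)^-1 * (2 * e * trunc e t - 2 * e * t)); last first.
  by field; rewrite gt_eqF.
rewrite normrM gtr0_norm ?invr_gt0// ler_pdivrMl// /trunc mulrA mulfV ?gt_eqF// mul1r.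
rewrite /sqpos ler_norml /Num.max; apply/andP; split; do ?case: ltP => ?; nra.
Qed.
End truncation.

Section fe_gradient.
Context {R : realType} {n : nat}.
Implicit Types (w : 'rV[R]_n -> R) (U : set 'rV[R]_n).

Lemma strict_partial_lip w L i x g : lip L w -> strict_partial w i x g -> 0 <= L ->
  `|g| <= L.
Proof.
move=> wL sp L0; apply: (cvgr_to_le (cvg_norm (strict_partial_quot sp))); apply: nearW => m /=.
rewrite normrM [`|m.+1%:R|]ger0_norm// -ler_pdivlMr//.
rewrite (le_trans (wL _ _))// opprB addrC subrK normrZ gtr0_norm ?invr_gt0//.
by rewrite ler_wpM2l// -[leRHS]mulr1 ler_wpM2l ?unit_vec_norm// invr_ge0.
Qed.

(** Only the values where the difference quotients converge matter. *)
Lemma lip_gradient w L U : open U -> 0 <= L -> lip L w ->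
  {ae leb, forall z, U z -> forall i, exists g, strict_partial w i z g} ->
  exists G : 'rV[R]_n -> 'rV[R]_n,
    [/\ forall i, measurable_fun setT (fun z => G z 0 i),
        forall i z, `|G z 0 i| <= L,
        {ae leb, forall z, U z -> forall i, strict_partial w i z (G z 0 i)} &
        is_weak_grad U w G].
Proof.
move=> oU L0 wL ae; have cw := lip_continuous wL.
pose dq i (m : nat) (z : 'rV[R]_n) := (w z - w (z - m.+1%:R^-1 *: unit_vec i)) * m.+1%:R.
have dqL i m z : `|dq i m z| <= L.
  rewrite normrM [`|m.+1%:R|]ger0_norm// -ler_pdivlMr//.
  rewrite (le_trans (wL _ _))// opprB addrC subrK normrZ gtr0_norm ?invr_gt0//.
  by rewrite ler_wpM2l// -[leRHS]mulr1 ler_wpM2l ?unit_vec_norm// invr_ge0.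
(* The upper limit gives a measurable function defined everywhere, and clamping to [-L, L] gives the
   bound at every point. *)
pose gp i z := Num.max (- L) (Num.min L (limn_sup (dq i ^~ z))).
have mdq i m : measurable_fun setT (dq i m).
  apply: measurable_funM => //; apply: measurable_funB.
    exact: continuous_rv_measurable.
  apply: continuous_rv_measurable => //; exact: continuous_translate.
have mgp i : measurable_fun setT (gp i).
  apply: measurable_maxr => //; apply: measurable_minr => //.
  apply: measurable_fun_limn_sup => //.
    move=> z _; exists L => _ [m _ <-]; exact: le_trans (ler_norm _) (dqL i m z).
  move=> z _; exists (- L) => _ [m _ <-].
  by rewrite lerNl (le_trans (ler_norm _))// normrN.
have gpE i z g : strict_partial w i z g -> gp i z = g.
  move=> sp; have C := strict_partial_quot sp.
  have gL := strict_partial_lip wL sp L0; move: gL; rewrite ler_norml => /andP[g1 g2].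
  rewrite /gp (_ : limn_sup _ = g) ?min_r// ?max_r//.
  rewrite cvg_limn_supE; first exact: cvg_lim.
  by apply/cvg_ex; exists g.
have gpL i z : `|gp i z| <= L.
  by rewrite ler_norml /gp le_max lexx /= ge_max ge_min lexx /= andbT; lra.
exists (fun z => \row_i gp i z); split.
- by move=> i; under eq_fun do rewrite mxE; exact: mgp.
- by move=> i z; rewrite mxE.
- apply: filterS ae => z H Uz i; rewrite mxE; have [g sp] := H Uz i.
  by rewrite (gpE _ _ _ sp).
- move=> i; rewrite (_ : (fun x => _) = gp i); last by apply/funext => z; rewrite mxE.
  apply: (@lip_weak_partial _ _ L L) => //; first exact: measurable_funTS.
  apply: filterS ae => z H Uz; have [g sp] := H Uz i.
  by rewrite (gpE _ _ _ sp); exact: strict_partial_quot.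
Qed.

Lemma weak_partial_ext U i w w' g : open U -> (forall x, U x -> w x = w' x) ->
  is_weak_partial U i w g -> is_weak_partial U i w' g.
Proof.
move=> oU E [[mw iw] lg H]; split=> //.
  split; first by apply: eq_measurable_fun mw => x; rewrite inE => /E.
  move=> K cK KU; apply: eq_integrable (iw K cK KU); first exact: compact_rv_measurable.
  by move=> x; rewrite inE => /KU /E /= ->.
move=> f fU; rewrite -H//; apply: eq_Rintegral => x; rewrite inE => /E ->.
by [].
Qed.
End fe_gradient.

Section fe_approx.
Context {R : realType} {n : nat}.
Variables (w : 'rV[R]_n.+1 -> R) (L r : R) (Omega : set 'rV[R]_n) (Y : R).
Hypotheses (L0 : 0 <= L) (r0 : 0 < r) (wL : lip L w)
  (ws : forall z, ~ cube n.+1 r z -> w z = 0)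
  (wO : forall z, ~ (Omega (hor z) /\ `|ver z| < Y) -> w z = 0).

(** The threshold exceeds the uniform distance between [w] and its
    mollification, so that the support shrinks back into [Omega x (-Y, Y)]. *)
Definition molltrunc (h : R) z := trunc (2 * (L + 1) * h) (moll h w z).

Definition dmolltrunc (h : R) i z :=
  dtrunc (2 * (L + 1) * h) (moll h w z) * dmoll h w i z.

Let eps0 h : 0 < h -> 0 < 2 * (L + 1) * h.
Proof. by move=> h0; rewrite !mulr_gt0// ltr_wpDl. Qed.

Lemma is_C1_molltrunc h : 0 < h -> is_C1 (molltrunc h) (dmolltrunc h).
Proof.
move=> h0; apply: is_C1_comp.
- exact: (is_C1_moll h0 (ltW r0) wL ws).
- exact: is_derive_trunc.
- exact: continuous_dtrunc.
Qed.

(** The constant 5 is 4 + 1: the truncation moves a value by at most twice its threshold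
    [2 * (L + 1) * h], the mollification by [L * h]. *)
Lemma molltrunc_unif h z : 0 < h -> `|molltrunc h z - w z| <= 5 * (L + 1) * h.
Proof.
move=> h0; rewrite (_ : molltrunc h z - w z = (molltrunc h z - moll h w z) +
  (moll h w z - w z)); last by ring.
rewrite (le_trans (ler_normD _ _))//.
have H1 := trunc_approx (moll h w z) (eps0 h0).
have H2 := moll_approx z h0 L0 wL.
by rewrite (le_trans (lerD H1 H2))//; nra.
Qed.

Lemma molltrunc_supp h z : 0 < h -> molltrunc h z != 0 -> (L + 1) * h <= `|w z|.
Proof.
move=> h0 nz; rewrite leNgt; apply/negP => wz.
move/eqP: nz; apply; apply: trunc_eq0; first exact: eps0.
have H2 := moll_approx z h0 L0 wL.
rewrite (_ : moll h w z = (moll h w z - w z) + w z); last by ring.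
by rewrite (le_trans (ler_normD _ _))//; nra.
Qed.

(** The compact set is the superlevel set of |w| at height [(L + 1) * h]: closed by continuity,
    bounded by the support of [w], and inside the open cylinder since [w] vanishes off it. *)
Lemma molltrunc_compact h : 0 < h -> exists Q : set 'rV[R]_n.+1,
  [/\ compact Q, forall z, Q z -> Omega (hor z) /\ `|ver z| < Y &
      forall z, ~ Q z -> molltrunc h z = 0].
Proof.
move=> h0; exists [set z | (L + 1) * h <= `|w z|].
have Lh : 0 < (L + 1) * h by rewrite mulr_gt0// ltr_wpDl.
split.
- apply: bounded_closed_compact.
    exists r; split; first exact: num_real.
    move=> M' rM z /= wz; apply: le_trans (ltW rM); apply/rv_norm_leP; first exact: ltW.
    apply: contrapT => nz; move: wz; rewrite ws ?normr0//.
    by rewrite leNgt Lh.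
  apply: (@closed_comp _ _ (fun z => `|w z|) [set t | (L + 1) * h <= t]); last exact: closed_ge.
  move=> z _; apply: (@lip_continuous _ _ L) => u v.
  exact: le_trans (ler_dist_dist _ _) (wL u v).
- move=> z /= wz; apply: contrapT => nz; move: wz; rewrite wO// normr0.
  by rewrite leNgt Lh.
- move=> z nz; apply/eqP/negPn/negP => az; apply: nz; exact: molltrunc_supp.
Qed.

Lemma dmolltrunc_le h i z : 0 < h -> `|dmolltrunc h i z| <= `|dmoll h w i z|.
Proof.
move=> h0; have /andP[d0 d1] := dtrunc01 (moll h w z) (eps0 h0).
by rewrite normrM (ger0_norm d0) -[leRHS]mul1r ler_wpM2r.
Qed.
End fe_approx.

(** * One-dimensional inequalities *)

Section oned.
Context {R : realType}.
Local Notation mu := (@lebesgue_measure R).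
Implicit Types (F f v dv : R -> R).

(** The shift [k.+3] removes at most a third of the length at each end, so every closed interval is
    nondegenerate. *)
Lemma itvoo_bigcup_cc (a b : R) : a < b -> `]a, b[%classic =
  \bigcup_k `[a + (b - a) * k.+3%:R^-1, b - (b - a) * k.+3%:R^-1]%classic.
Proof.
move=> ab; have d0 : 0 < b - a by rewrite subr_gt0.
apply/seteqP; split=> x /=; last first.
  move=> [k _]; rewrite /= !in_itv/=.
  have : 0 < (b - a) * k.+3%:R^-1 by rewrite mulr_gt0// invr_gt0.
  move: (_ * _) => e e0 /andP[x1 x2].
  by apply/andP; split; lra.
rewrite in_itv/= => /andP[ax xb].
pose m := Num.min (x - a) (b - x) / (b - a).
have m0 : 0 < m by rewrite divr_gt0// lt_min !subr_gt0 ax.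
have [N _ HN] := near_infty_natSinv_lt (PosNum m0).
exists N => //; rewrite /= in_itv/=.
have H : (b - a) * N.+3%:R^-1 <= Num.min (x - a) (b - x).
  rewrite mulrC -ler_pdivlMr//; apply: le_trans (ltW (HN N _)) => //=.
  by rewrite lef_pV2 ?posrE// ler_nat ltnW.
by move: H; rewrite le_min; move: (_ * _) => e /andP[? ?]; apply/andP; split; lra.
Qed.

(** The integrand may blow up at an endpoint, as t^b does at 0 for negative b. Closed subintervals
    exhaust the open one, and nonnegativity lets their integrals converge monotonically. *)
Lemma FTC_oo F f (a b : R) : a < b ->
  (forall x, a < x < b -> is_derive x (1 : R) F (f x)) ->
  (forall x, a < x < b -> {for x, continuous f}) ->
  (forall x, a < x < b -> 0 <= f x) ->
  F x @[x --> a^'+] --> F a -> F x @[x --> b^'-] --> F b ->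
  (\int[mu]_(x in `]a, b[) (f x)%:E = (F b - F a)%:E)%E.
Proof.
move=> ab dF cf f0 Fa Fb; have d0 : 0 < b - a by rewrite subr_gt0.
have [e eE] : exists e : nat -> R, e = fun k => (b - a) * k.+3%:R^-1 by eexists.
have e0 k : 0 < e k by rewrite eE mulr_gt0// invr_gt0.
have e2 k : 3 * e k <= b - a.
  rewrite eE mulrCA; apply: ler_piMr; first exact: ltW.
  by rewrite ler_pdivrMr// mul1r ler_nat.
have sub k x : a + e k <= x <= b - e k -> a < x < b.
  by have := e0 k => ? /andP[? ?]; apply/andP; split; lra.
have mf : measurable_fun `]a, b[%classic f.
  apply: open_continuous_measurable_fun; first exact: interval_open.
  by move=> x; rewrite inE/= in_itv/= => /cf.
have eq0 : e k @[k --> \oo] --> 0.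
  rewrite eE -[X in _ --> X](mulr0 (b - a)); apply: cvgM; first exact: cvg_cst.
  have := @cvg_harmonic R; rewrite -(cvg_shiftn 2); apply: cvg_trans.
  by apply: near_eq_cvg; apply: nearW => k; rewrite /harmonic /= addn2.
have mono : nondecreasing_seq (fun k => `[a + e k, b - e k]%classic : set R).
  move=> k l kl; apply/subsetPset => x /=; rewrite !in_itv/= => /andP[x1 x2].
  have ekl : e l <= e k by rewrite eE ler_wpM2l ?(ltW d0)// lef_pV2 ?posrE// ler_nat.
  by apply/andP; split; lra.
have := @ge0_nondecreasing_set_cvg_integral _ (measurableTypeR R) R (fun k => `[a + e k, b - e k]%classic)
  (EFin \o f) mu mono.
rewrite (_ : \bigcup_i _ = `]a, b[%classic); last by rewrite itvoo_bigcup_cc// eE.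
move=> H.
have {}H : (\int[mu]_(x in `[(a + e k)%R, (b - e k)%R]) (f x)%:E)%E @[k --> \oo] -->
    (\int[mu]_(x in `]a, b[) (f x)%:E)%E.
  apply: H.
  - by move=> k; exact: measurable_itv.
  - move=> k; apply/measurable_EFinP; apply: measurable_funS mf => //.
    by move=> x /=; rewrite !in_itv/= => /sub.
  - by move=> k x /=; rewrite in_itv/= => /sub /f0; rewrite lee_fin.
have E k : (\int[mu]_(x in `[(a + e k)%R, (b - e k)%R]) (f x)%:E)%E =
    (F (b - e k) - F (a + e k))%:E.
  have := e0 k; have := e2 k => ? ?.
  have abk : a + e k < b - e k by lra.
  have dc x : a < x < b -> {for x, continuous F}.
    move=> /dF[dx _]; exact/differentiable_continuous/derivable1_diffP.
  rewrite (@continuous_FTC2 _ f F) //.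
  - apply: continuous_in_subspaceT => x; rewrite inE/= in_itv/= => /sub; exact: cf.
  - split.
    + by move=> x; rewrite in_itv/= => /andP[x1 x2]; case: (dF x _) => //; apply: (sub k); rewrite !ltW.
    + by apply: cvg_at_right_filter; apply: dc; apply: (sub k); rewrite lexx ltW.
    + by apply: cvg_at_left_filter; apply: dc; apply: (sub k); rewrite lexx ltW.
  - move=> x; rewrite in_itv/= => /andP[x1 x2].
    have /dF[_ <-] : a < x < b by apply: (sub k); rewrite !ltW.
    by rewrite derive1E.
have C : (F (b - e k) - F (a + e k))%:E @[k --> \oo] --> (F b - F a)%:E.
  apply/fine_cvgP; split; first exact: nearW.
  rewrite /comp/=; apply: cvgB.
    move/cvg_at_leftP : Fb; apply; split=> [k|]; first by have := e0 k; lra.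
    by rewrite -[X in _ --> X]subr0; apply: cvgB => //; exact: cvg_cst.
  move/cvg_at_rightP : Fa; apply; split=> [k|]; first by have := e0 k; lra.
  by rewrite -[X in _ --> X]addr0; apply: cvgD => //; exact: cvg_cst.
move: H; under eq_fun do rewrite E.
by move=> H; exact: (cvg_unique _ H C).
Qed.

Lemma continuous_powR (b x : R) : 0 < x -> {for x, continuous (fun y : R => y `^ b)}.
Proof.
move=> x0; apply/differentiable_continuous/derivable1_diffP.
by have [] := is_derive1_powR b x0.
Qed.

Lemma integral_powR (b l : R) : -1 < b -> 0 < l ->
  (\int[mu]_(x in `]0%R, l[) (x `^ b)%:E = (l `^ (b + 1) / (b + 1))%:E)%E.
Proof.
move=> b1 l0; have b10 : 0 < b + 1 by lra.
pose F (x : R) := (b + 1)^-1 * x `^ (b + 1).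
have -> : l `^ (b + 1) / (b + 1) = F l - F 0.
  by rewrite /F powR0 ?gt_eqF// mulr0 subr0 mulrC.
apply: FTC_oo => //.
- move=> x /andP[x0 _]; have K := is_deriveZ (b + 1)^-1 (is_derive1_powR (b + 1) x0).
  apply: (is_derive_eq K).
  by rewrite /GRing.scale/= mulrA mulVf ?gt_eqF// mul1r addrK.
- by move=> x /andP[x0 _]; exact: continuous_powR.
- by move=> x _; exact: powR_ge0.
- rewrite /F powR0 ?gt_eqF//; apply: cvgM; first exact: cvg_cst.
  exact: powR_cvg0.
- apply: cvg_at_left_filter; apply: cvgM; first exact: cvg_cst.
  exact: continuous_powR.
Qed.

Lemma integrable_powR (b l : R) : -1 < b -> 0 < l ->
  mu.-integrable `]0, l[ (EFin \o (fun y : R => y `^ b)).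
Proof.
move=> b1 l0; apply/integrableP; split.
  apply/measurable_EFinP; apply: measurable_funTS; exact: measurable_powR.
under eq_integral do rewrite /= ger0_norm ?powR_ge0//.
by rewrite integral_powR// ltry.
Qed.

(** The integrand of the Gamma integral is dominated by [t^(x-1)] near [0]
    and by [2 exp(-t/2)] near infinity. *)
Lemma EulerGamma_gt0 (x : R) : 0 < x < 2 -> 0 < EulerGamma x.
Proof.
move=> /andP[x0 x2]; pose g (t : R) := t `^ (x - 1) * expR (- t).
have mg : measurable_fun setT g.
  apply: measurable_funM; first exact: measurable_powR.
  by apply: measurableT_comp => //; exact: measurableT_comp.
have g0 t : 0 <= g t by rewrite mulr_ge0 ?powR_ge0 ?expR_ge0.
have mE D : measurable_fun D (EFin \o g).
  by apply/measurable_EFinP; exact: measurable_funTS.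
have U : `]0, +oo[%classic = `]0, 1[%classic `|` `[1, +oo[%classic :> set R.
  apply/seteqP; split=> t /=; rewrite !in_itv/= !andbT.
    by move=> t0; have [t1|t1] := ltP t 1; [left; rewrite t0|right].
  by move=> [/andP[]//|]; exact: lt_le_trans.
have I1 : (\int[mu]_(t in `]0%R, 1%R[) (g t)%:E < +oo)%E.
  apply: (@le_lt_trans _ _ (\int[mu]_(t in `]0%R, 1%R[) (t `^ (x - 1))%:E)%E); last first.
    by rewrite integral_powR ?ltry//; lra.
  apply: ge0_le_integral => //.
  - by move=> t _; rewrite lee_fin.
  - exact: mE.
  - by apply/measurable_EFinP; apply: measurable_funTS; exact: measurable_powR.
  - move=> t; rewrite /= in_itv/= => /andP[t0 _]; rewrite lee_fin.
    by rewrite -[leRHS]mulr1 ler_wpM2l ?powR_ge0// -expR0 ler_expR oppr_le0 ltW.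
have I2 : (\int[mu]_(t in `[1%R, +oo[) (g t)%:E < +oo)%E.
  have me : measurable_fun setT (fun t : R => 2 * expR (- t / 2)).
    apply: measurable_funM => //; apply: measurableT_comp => //.
    by apply: measurable_funM => //; exact: measurableT_comp.
  apply: (@le_lt_trans _ _ (\int[mu]_(t in `[1%R, +oo[) (2 * expR (- t / 2))%:E)%E).
    apply: ge0_le_integral => //.
    - by move=> t _; rewrite lee_fin.
    - exact: mE.
    - by apply/measurable_EFinP; exact: measurable_funTS.
    - move=> t; rewrite /= in_itv/= andbT => t1; rewrite lee_fin.
      have t0 : 0 < t by lra.
      have eE : expR (- t) = expR (- t / 2) * expR (- t / 2).
        by rewrite -expRD; congr expR; field.
      rewrite /g eE mulrA ler_wpM2r ?expR_ge0//.
      apply: (@le_trans _ _ (t * expR (- t / 2))).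
        rewrite ler_wpM2r ?expR_ge0//.
        have h : t `^ (x - 1) <= t `^ 1 by rewrite ler_powR//; lra.
        by apply: (le_trans h); rewrite powRr1// ltW.
      rewrite mulNr expRN ler_pdivrMr ?expR_gt0//.
      by have := expR_ge1Dx (t / 2); lra.
  have := @ge0_continuous_FTC2y R (fun t => 2 * expR (- t / 2)) (fun t => - 4 * expR (- t / 2)) 1 0.
  have dE t : is_derive t (1 : R) (fun t : R => - 4 * expR (- t / 2)) (2 * expR (- t / 2)).
    have d1 : is_derive t (1 : R) (fun t : R => - t / 2) (- 2^-1).
      have K := is_deriveZ (- 2^-1 : R) (is_derive_id t (1 : R)).
      rewrite (_ : (fun _ => _) = (- 2^-1 : R) \*: id).
        by apply: (is_derive_eq K); rewrite /GRing.scale/= mulr1.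
      by apply/funext => y; rewrite /= /GRing.scale/=; field.
    have K := is_deriveZ (- 4 : R) (@is_derive1_comp R expR (fun t => - t / 2) t _ _ (is_derive_expR _) d1).
    by apply: (is_derive_eq K); rewrite /GRing.scale/=; field.
  have cE t : {for t, continuous (fun t : R => - 4 * expR (- t / 2))}.
    by apply/differentiable_continuous/derivable1_diffP; case: (dE t).
  move=> ->; first by rewrite -EFinB ltry.
  - by move=> t _; rewrite mulr_ge0// expR_ge0.
  - apply: continuous_subspaceT => t.
    have -> : (fun t : R => 2 * expR (- t / 2)) = (fun t => - 2^-1 * (- 4 * expR (- t / 2))).
      by apply/funext => y; field.
    by apply: cvgM; [exact: cvg_cst|exact: cE].
  - rewrite -[X in _ --> X](mulr0 (-4)); apply: cvgM; first exact: cvg_cst.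
    have h2 : (fun t : R => expR (- t / 2)) = (fun t => expR (- t)) \o (fun t => t / 2).
      by apply/funext => y /=; rewrite mulNr.
    rewrite h2; apply: (@cvg_comp _ _ _ (fun t : R => t / 2) (fun t => expR (- t)) _ (+oo) _).
      exact: gt0_cvgMly.
    exact: cvgr_expR.
  - by move=> t _; case: (dE t).
  - by apply: cvg_at_right_filter; exact: cE.
  - by move=> t _; rewrite derive1E; case: (dE t).
have I : (\int[mu]_(t in `]0%R, +oo[) (g t)%:E < +oo)%E.
  rewrite U integral_setU//=; [exact: lte_add_pinfty|exact: mE|].
  by apply/disj_setPS => t [] /=; rewrite !in_itv/= andbT => /andP[_ /lt_le_trans H] /H; rewrite ltxx.
rewrite /EulerGamma /Rintegral fine_gt0//; apply/andP; split; last exact: I.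
(* Positivity is read on [1, 2], where t^(x - 1) >= 1/t >= 1/2 since x > 0. *)
apply: (@lt_le_trans _ _ (\int[mu]_(t in `[1%R, 2%R]) (2^-1 * expR (- 2))%:E)%E).
  rewrite integral_cst//= lebesgue_measure_itv/= lte_fin ifT; last by rewrite ltr1n.
  by rewrite -EFinB -EFinM lte_fin mulr_gt0 ?mulr_gt0 ?expR_gt0//; lra.
apply: (@le_trans _ _ (\int[mu]_(t in `[1%R, 2%R]) (g t)%:E)%E); last first.
  apply: ge0_subset_integral => //.
  - exact: mE.
  - by move=> t _; rewrite lee_fin g0.
  - by move=> t /=; rewrite !in_itv/= andbT => /andP[t1 _]; lra.
apply: ge0_le_integral => //.
- exact: mE.
move=> t; rewrite /= in_itv/= => /andP[t1 t2]; rewrite lee_fin.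
have t0 : 0 < t by lra.
apply: ler_pM; rewrite ?invr_ge0 ?expR_ge0//; last by rewrite ler_expR lerN2.
apply: (@le_trans _ _ (t `^ (-1))); last by rewrite ler_powR//; lra.
by rewrite powR_inv1 ?(ltW t0)// lef_pV2 ?posrE.
Qed.
End oned.

(** * One-dimensional weighted trace inequality *)

Section trace_oned.
Context {R : realType}.
Local Notation mu := (@lebesgue_measure R).

Lemma powR_integrable (b l : R) (phi : R -> R) : -1 < b -> 0 < l -> continuous phi ->
  mu.-integrable `]0, l[ (EFin \o (fun t => t `^ b * phi t)).
Proof.
move=> b1 l0 cphi.
have [B HB] : exists B, forall t, 0 <= t <= l -> `|phi t| <= B.
  have /compact_bounded[M [_ HM]] : compact (phi @` `[0, l]).
    by apply: continuous_compact (@segment_compact _ 0 l); exact: continuous_subspaceT.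
  exists (`|M| + 1) => t t0l; apply: (HM (`|M| + 1)).
    by rewrite (le_lt_trans (ler_norm M))// ltrDl.
  by exists t => //=; rewrite in_itv.
have B0 : 0 <= B by apply: le_trans (HB 0 _); rewrite // lexx ltW.
apply: (@le_integrable _ _ _ mu _ _ _ (fun t => (B%:E * (t `^ b)%:E)%E)) => //.
- apply/measurable_EFinP; apply: measurable_funTS; apply: measurable_funM.
    exact: measurable_powR.
  exact: continuous_measurable_fun.
- move=> t /=; rewrite in_itv/= => /andP[t0 tl].
  rewrite lee_fin normrM mulrC [leRHS]normrM ler_wpM2r// (ger0_norm B0).
  by apply: HB; rewrite !ltW.
- by apply: integrableZl => //; exact: integrable_powR.
Qed.

Lemma am_gm_pow (m d : R) : 0 < m -> 2 * `|d| <= m * d ^+ 2 + m^-1.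
Proof.
move=> m0; rewrite -(ler_pM2l m0) mulrDr mulfV ?gt_eqF//.
have := sqr_ge0 (m * `|d| - 1); rewrite sqrrB exprMn real_normK ?num_real// expr1n mulr1.
rewrite -mulrnAl; nra.
Qed.

(** Cauchy-Schwarz for the product of t^(-b/2) and t^(b/2) dv. It is obtained from Young's
    inequality with a free parameter [k], optimised at the end; b in (-1, 1) makes both weights
    integrable. *)
Lemma increment_le (l y : R) (b : R) (v dv : R -> R) : -1 < b < 1 -> 0 < y < l ->
  (forall t, is_derive t (1 : R) v (dv t)) -> continuous dv ->
  (v 0 - v y) ^+ 2 <= (\int[mu]_(t in `]0, l[) t `^ (- b)) *
    (\int[mu]_(t in `]0, l[) (t `^ b * dv t ^+ 2)).
Proof.
move=> /andP[b1 b2] /andP[y0 yl] dvE cdv.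
have l0 : 0 < l by exact: lt_trans yl.
set P := (X in X * _); set D := (X in _ * X); have [x xE] : {x : R | x = `|v 0 - v y|} by exists `|v 0 - v y|.
have x0' : 0 <= x by rewrite xE.
have cdv2 : continuous (fun t => dv t ^+ 2).
  by move=> t; apply: (@continuous_comp _ _ _ dv (fun u => u ^+ 2)); [exact: cdv|exact: exprn_continuous].
have iP : mu.-integrable `]0, l[ (EFin \o (fun t => t `^ (- b))).
  by apply: integrable_powR => //; lra.
have iD := powR_integrable b1 l0 cdv2.
have P0 : 0 <= P by apply: Rintegral_ge0 => t _; exact: powR_ge0.
have D0 : 0 <= D by apply: Rintegral_ge0 => t _; rewrite mulr_ge0 ?powR_ge0 ?sqr_ge0.
have mdv : measurable_fun setT dv by exact: continuous_measurable_fun.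
have H k : 0 < k -> 2 * x <= k * D + P / k.
  move=> k0.
  have cv : forall t, {for t, continuous v}.
    by move=> t; apply/differentiable_continuous/derivable1_diffP; case: (dvE t).
  have E : (\int[mu]_(t in `[0%R, y]) (dv t)%:E = (v y - v 0)%:E)%E.
    rewrite (@continuous_FTC2 _ dv v) //.
    - exact: continuous_subspaceT.
    - split; first by move=> t _; case: (dvE t).
        by apply: cvg_at_right_filter; exact: cv.
      by apply: cvg_at_left_filter; exact: cv.
    - by move=> t _; rewrite derive1E; case: (dvE t).
  have H1 : (x%:E <= \int[mu]_(t in `]0%R, l[) `|dv t|%:E)%E.
    have -> : x%:E = `|\int[mu]_(t in `[0%R, y]) (dv t)%:E|%E by rewrite E /= xE distrC.
    apply: (@le_trans _ _ (\int[mu]_(t in `[0%R, y]) `|dv t|%:E)%E).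
      by apply: le_abse_integral => //; apply/measurable_EFinP; exact: measurable_funTS.
    rewrite -integral_itv_obnd_cbnd//; last first.
      by apply/measurable_EFinP; apply: measurable_funTS; exact: measurableT_comp.
    apply: ge0_subset_integral => //.
      by apply/measurable_EFinP; apply: measurable_funTS; exact: measurableT_comp.
    by move=> t /=; rewrite !in_itv/= => /andP[-> ty]; exact: le_lt_trans yl.
  have iS : mu.-integrable `]0, l[
      (EFin \o (fun t => k * (t `^ b * dv t ^+ 2) + k^-1 * t `^ (- b))).
    exact: (integrableD _ (integrableZl _ k iD) (integrableZl _ k^-1 iP)).
  have : (2%:E * x%:E <= \int[mu]_(t in `]0%R, l[)
      (k * (t `^ b * dv t ^+ 2) + k^-1 * t `^ (- b))%:E)%E.
    apply: (@le_trans _ _ (2%:E * \int[mu]_(t in `]0%R, l[) `|dv t|%:E)%E).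
      by apply: lee_pmul => //; rewrite lee_fin.
    rewrite -ge0_integralZl//; last first.
      by apply/measurable_EFinP; apply: measurable_funTS; exact: measurableT_comp.
    apply: ge0_le_integral => //.
    - apply/measurable_EFinP; apply: measurable_funTS; apply: measurable_funM => //.
      exact: measurableT_comp.
    - by have /integrableP[] := iS.
    - move=> t /=; rewrite in_itv/= => /andP[t0 _]; rewrite -EFinM lee_fin.
      have a0 := powR_gt0 b t0.
      have := @am_gm_pow (k * t `^ b) (dv t) (mulr_gt0 k0 a0).
      by rewrite invfM -powRN -mulrA => h; exact: h.
  rewrite -[X in (_ <= X)%E]fineK; last exact: integrable_fin_num iS.
  rewrite -EFinM lee_fin => /le_trans; apply.
  rewrite (_ : fine _ = \int[mu]_(t in `]0, l[)
    (k * (t `^ b * dv t ^+ 2) + k^-1 * t `^ (- b)))//.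
  rewrite RintegralD//; [|exact: (integrableZl _ k iD)|exact: (integrableZl _ k^-1 iP)].
  by rewrite !RintegralZl// mulrC [_ / k]mulrC lexx.
have [x0|x0] := eqVneq x 0.
  move: x0 => /eqP; rewrite xE normr_eq0 => /eqP ->; rewrite expr0n /=.
  exact: mulr_ge0.
have xp : 0 < x by rewrite lt_def x0.
rewrite -real_normK ?num_real// -xE.
have [P1|P1] := eqVneq P 0.
  (* If [P] were 0, this [k] would give [2 * x <= x * D / (D + 1)], impossible for x > 0. *)
  have := H (x / (D + 1)) (divr_gt0 xp (ltr_wpDl D0 ltr01)).
  rewrite P1 !mul0r addr0 mulrAC ler_pdivlMr ?ltr_wpDl//; nra.
have Pp : 0 < P by rewrite lt_def P1.
(* This [k] makes the second term equal to [x], leaving [x <= P * D / x]. *)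
have := H (P / x) (divr_gt0 Pp xp).
rewrite invf_div mulrCA mulfV// mulr1 => H1.
have : x <= P / x * D by lra.
by rewrite mulrAC ler_pdivlMr// expr2.
Qed.

(** With b = 1 - 2 s and l = lam^(-1/2), integrate t^b v(0)^2 <= 2 t^b (v(0) - v(t))^2 + 2 t^b
    v(t)^2 over (0, l). After multiplication by lam^s the powers of l leave the factor s^-1 for the
    derivative and 4 - 4 s for lam v^2; [4 + s^-1] dominates both. *)
Lemma trace_oned (s Y lam : R) (v dv : R -> R) : 0 < s < 1 -> 0 <= lam ->
  (forall t, is_derive t (1 : R) v (dv t)) -> continuous dv ->
  (forall t, Y <= t -> v t = 0) -> (forall t, Y <= t -> dv t = 0) ->
  ((lam `^ s * v 0 ^+ 2)%:E <= (4 + s^-1)%:E * \int[mu]_(t in `]0%R, Y[)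
    (t `^ (1 - 2 * s) * (dv t ^+ 2 + lam * v t ^+ 2))%:E)%E.
Proof.
move=> /andP[s0 s1] lam0 dvE cdv vY dvY.
pose g t := t `^ (1 - 2 * s) * (dv t ^+ 2 + lam * v t ^+ 2).
have g0 t : 0 <= g t.
  by rewrite mulr_ge0 ?powR_ge0// addr_ge0 ?sqr_ge0// mulr_ge0 ?sqr_ge0.
have c0 : 0 <= 4 + s^-1 by rewrite addr_ge0// invr_ge0 ltW.
(* The length lam^(-1/2) makes sense for positive [lam] only; for [lam = 0] the left side is 0
   because s > 0. *)
have [->|lamn0] := eqVneq lam 0.
  rewrite powR0 ?gt_eqF// mul0r; apply: mule_ge0 => //.
  by apply: integral_ge0 => t _; rewrite lee_fin mul0r addr0 mulr_ge0 ?powR_ge0 ?sqr_ge0.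
have lamp : 0 < lam by rewrite lt_def lamn0.
set b := 1 - 2 * s; have b1 : -1 < b by rewrite /b; lra.
have b2 : b < 1 by rewrite /b; lra.
pose l := lam `^ (- 2^-1); have l0 : 0 < l by exact: powR_gt0.
have cv : continuous v.
  by move=> t; apply/differentiable_continuous/derivable1_diffP; case: (dvE t).
have csq (f : R -> R) : continuous f -> continuous (fun t => f t ^+ 2).
  move=> cf t; apply: (@continuous_comp _ _ _ f (fun u => u ^+ 2)); first exact: cf.
  exact: exprn_continuous.
have iD := powR_integrable b1 l0 (csq _ cdv).
have iB := powR_integrable b1 l0 (csq _ cv).
have iQ := integrable_powR b1 l0.
set D := \int[mu]_(t in `]0, l[) (t `^ b * dv t ^+ 2).
set B := \int[mu]_(t in `]0, l[) (t `^ b * v t ^+ 2).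
have QE : \int[mu]_(t in `]0, l[) t `^ b = l `^ (b + 1) / (b + 1).
  by rewrite /Rintegral integral_powR.
have PE : \int[mu]_(t in `]0, l[) t `^ (- b) = l `^ (- b + 1) / (- b + 1).
  by rewrite /Rintegral integral_powR//; lra.
have b10 : 0 < b + 1 by lra.
have nb10 : 0 < - b + 1 by lra.
have lb : l `^ (b + 1) = (lam `^ (1 - s))^-1.
  rewrite /l -powRrM -powRN; congr (_ `^ _); rewrite /b; lra.
have lnb : l `^ (- b + 1) = (lam `^ s)^-1.
  rewrite /l -powRrM -powRN; congr (_ `^ _); rewrite /b; lra.
have D0 : 0 <= D by apply: Rintegral_ge0 => t _; rewrite mulr_ge0 ?powR_ge0 ?sqr_ge0.
have B0 : 0 <= B by apply: Rintegral_ge0 => t _; rewrite mulr_ge0 ?powR_ge0 ?sqr_ge0.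
set P := l `^ (- b + 1) / (- b + 1) in PE.
set Q := l `^ (b + 1) / (b + 1) in QE.
have H : (v 0 ^+ 2 - 2 * (P * D)) * Q <= 2 * B.
  have [k kE] : {k : R | k = v 0 ^+ 2 - 2 * (P * D)} by eexists.
  rewrite -QE -kE.
  have -> : k * (\int[mu]_(t in `]0, l[) t `^ b) = \int[mu]_(t in `]0, l[) (k * t `^ b).
    by rewrite RintegralZl.
  have -> : 2 * B = \int[mu]_(t in `]0, l[) (2 * (t `^ b * v t ^+ 2)).
    by rewrite RintegralZl.
  apply: le_Rintegral => //.
  - exact: (integrableZl _ _ iQ).
  - exact: (integrableZl _ _ iB).
  move=> t /=; rewrite in_itv/= => /andP[t0 tl].
  have := @increment_le l t b v dv; rewrite b1 b2 t0 tl => /(_ isT isT dvE cdv).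
  rewrite PE -/P -/D => h.
  rewrite mulrCA mulrC ler_wpM2l ?powR_ge0// kE.
  have h2 := sqr_ge0 (v 0 - 2 * v t).
  have : (v 0 - v t) ^+ 2 = v 0 ^+ 2 - 2 * (v 0 * v t) + v t ^+ 2 by ring.
  have : (v 0 - 2 * v t) ^+ 2 = v 0 ^+ 2 - 4 * (v 0 * v t) + 4 * v t ^+ 2 by ring.
  move: h2 h; move: (P * D) (v 0 * v t) (v 0 ^+ 2) (v t ^+ 2) => p q r r'.
  move: (_ ^+ 2) (_ ^+ 2) => e1 e2; lra.
have Q0 : 0 < Q by rewrite divr_gt0// powR_gt0.
have ls0 : 0 < lam `^ s by exact: powR_gt0.
have l1s0 : 0 < lam `^ (1 - s) by exact: powR_gt0.
have lsl : lam `^ s * lam `^ (1 - s) = lam.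
  rewrite -powRD; last by rewrite lamn0 implybT.
  by rewrite addrC subrK powRr1// ltW.
have main : lam `^ s * v 0 ^+ 2 <= (4 + s^-1) * (D + lam * B).
  have H1 : v 0 ^+ 2 <= 2 * (P * D) + 2 * B / Q.
    by rewrite -lerBlDl ler_pdivlMr.
  have EP : lam `^ s * P = (2 * s)^-1.
    rewrite /P lnb mulrA mulfV ?gt_eqF// mul1r; congr _^-1; rewrite /b; ring.
  have EQ : lam `^ s * Q^-1 = (2 - 2 * s) * lam.
    rewrite /Q lb invf_div invrK -[in RHS]lsl /b; ring.
  apply: (@le_trans _ _ (lam `^ s * (2 * (P * D) + 2 * B / Q))).
    by rewrite ler_wpM2l// ltW.
  have -> : lam `^ s * (2 * (P * D) + 2 * B / Q) =
      2 * (lam `^ s * P) * D + 2 * B * (lam `^ s * Q^-1) by ring.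
  rewrite EP EQ (_ : 2 * (2 * s)^-1 = s^-1); last by field; rewrite gt_eqF.
  have lB : 0 <= lam * B by rewrite mulr_ge0.
  have sv : 0 <= s^-1 by rewrite invr_ge0 ltW.
  have h1 : 0 <= s * (lam * B) by rewrite mulr_ge0// ltW.
  have h2 : 0 <= s^-1 * (lam * B) by exact: mulr_ge0.
  nra.
have ig : mu.-integrable `]0, l[ (EFin \o g).
  apply: (@powR_integrable b l (fun t => dv t ^+ 2 + lam * v t ^+ 2)) => // t.
  apply: cvgD; first exact: csq.
  by apply: cvgM; [exact: cvg_cst|exact: csq].
have E : (\int[mu]_(t in `]0%R, l[) (g t)%:E = (D + lam * B)%:E)%E.
  rewrite -[LHS]fineK; last exact: integrable_fin_num ig.
  congr EFin; rewrite -[LHS]/(\int[mu]_(t in `]0, l[) g t).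
  rewrite /D /B -RintegralZl// -RintegralD//; last exact: (integrableZl _ lam iB).
  by apply: eq_Rintegral => t _; rewrite /g -/b; ring.
have mg : measurable_fun setT g.
  apply: measurable_funM; first exact: measurable_powR.
  apply: continuous_measurable_fun => t.
  apply: cvgD; first exact: csq.
  by apply: cvgM; [exact: cvg_cst|exact: csq].
apply: (@le_trans _ _ ((4 + s^-1)%:E * (D + lam * B)%:E)%E).
  by rewrite -EFinM lee_fin.
apply: lee_pmul => //; first by rewrite lee_fin addr_ge0// mulr_ge0.
(* [l] may exceed [Y]; as [v] and [dv] vanish beyond [Y], the integral over (0, Y) is the one over
   the half-line, which contains (0, l). *)
rewrite -E (_ : (\int[mu]_(t in `]0%R, Y[) _ = \int[mu]_(t in `]0%R, +oo[) (g t)%:E)%E).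
  apply: ge0_subset_integral => //.
  - by apply/measurable_EFinP; exact: measurable_funTS.
  - by move=> t _; rewrite lee_fin.
  - by move=> t /=; rewrite !in_itv/= andbT => /andP[].
rewrite integral_mkcond [RHS]integral_mkcond; congr integral; apply/funext => t.
rewrite !patchE !mem_setE !in_itv/= andbT; case: ltP => //= t0.
case: ltP => // Yt; rewrite /g vY// dvY// !expr0n /= mulr0 addr0 mulr0.
by [].
Qed.
End trace_oned.

Section pointwise_continuity.
Context {R : realType}.

(** Meant for the entries of [A], which are continuous at the points of [Omega] and arbitrary
    outside its closure. *)
Lemma continuous_at_rv_measurable n (f : 'rV[R]_n -> R) (D : set 'rV[R]_n) :
  open D -> (forall x, D x -> {for x, continuous f}) -> measurable_fun D f.
Proof.
move=> oD cf; apply: (measurability _ (RGenOpens.measurableE R)).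
move=> _ [_ [a [b ->] <-]]; apply: open_rv_measurable.
rewrite openE => x [Dx fx]; apply: filterI; first exact: open_nbhs_nbhs.
by apply: cf => //; exact: open_nbhs_nbhs (conj (interval_open _ _) fx).
Qed.
End pointwise_continuity.

(** * Bessel inequalities and the energy form *)

Section quadratic_bessel.
Context {d} {T : measurableType d} {R : realType}.
Variable mu : {measure set T -> \bar R}.

Lemma Rintegral_sum (D : set T) (I : Type) (r : seq I) (f : I -> T -> R) : measurable D ->
  (forall i, mu.-integrable D (EFin \o f i)) ->
  mu.-integrable D (EFin \o (fun x => \sum_(i <- r) f i x)) /\
  \int[mu]_(x in D) (\sum_(i <- r) f i x) = \sum_(i <- r) \int[mu]_(x in D) f i x.
Proof.
move=> mD fi; elim: r => [|i r [IH1 IH2]].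
  rewrite big_nil; under eq_fun do rewrite big_nil; split.
    exact: integrable0.
  by rewrite Rintegral_cst// mul0r.
have E : (fun x => \sum_(j <- i :: r) f j x) = (fun x => f i x + \sum_(j <- r) f j x).
  by apply/funext => x; rewrite big_cons.
rewrite E big_cons; split; first exact: (integrableD _ (fi i) IH1).
by rewrite RintegralD// IH2.
Qed.

Lemma ae_Rintegral_ge0 (D : set T) (f : T -> R) : measurable D ->
  mu.-integrable D (EFin \o f) -> {ae mu, forall x, D x -> 0 <= f x} ->
  0 <= \int[mu]_(x in D) f x.
Proof.
move=> mD fi f0; have mf : measurable_fun D f by apply/measurable_EFinP; case/integrableP: fi.
have -> : \int[mu]_(x in D) f x = \int[mu]_(x in D) `|f x|.
  rewrite /Rintegral; congr fine; apply: ae_eq_integral => //.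
  - by apply/measurable_EFinP.
  - by apply/measurable_EFinP; exact: measurableT_comp.
  by apply: filterS f0 => x H Dx; rewrite ger0_norm// H.
by apply: Rintegral_ge0.
Qed.

Lemma ae_integrable (D : set T) (f g : T -> R) : measurable D -> measurable_fun D g ->
  {ae mu, forall x, D x -> f x = g x} -> mu.-integrable D (EFin \o f) ->
  mu.-integrable D (EFin \o g).
Proof.
move=> mD mg fg /integrableP[mf foo]; apply/integrableP; split; first exact/measurable_EFinP.
rewrite (_ : (\int[mu]_(x in D) _)%E = (\int[mu]_(x in D) `|(EFin \o f) x|)%E)//.
apply: ae_eq_integral => //.
- by apply: measurableT_comp => //; exact/measurable_EFinP.
- exact: measurableT_comp.
by apply: filterS fg => x H Dx /=; rewrite H.
Qed.

(* Bessel's inequality for the form whose Gram matrix on w, phi_0, phi_1, ... is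
   the integral of b. *)
Lemma gram_bessel (D : set T) (b : nat -> nat -> T -> R) (l a : nat -> R) m :
  measurable D -> (forall j k, mu.-integrable D (EFin \o b j k)) ->
  {ae mu, forall x, D x -> forall t : nat -> R,
    0 <= \sum_(j < m.+1) \sum_(k < m.+1) t j * t k * b j k x} ->
  (forall k, \int[mu]_(x in D) b 0%N k.+1 x = l k * a k) ->
  (forall k, \int[mu]_(x in D) b k.+1 0%N x = l k * a k) ->
  (forall j k, \int[mu]_(x in D) b j.+1 k.+1 x = l j * (j == k)%:R) ->
  \sum_(k < m) l k * a k ^+ 2 <= \int[mu]_(x in D) b 0%N 0%N x.
Proof.
move=> mD bi b0 b0k bk0 bjk.
(* The coefficients of [w] minus its projection on the first [m] vectors; the quadratic form at them
   is the squared norm of the residual. *)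
pose t k := if k is k'.+1 then - a k' else 1 : R.
have iz (c : R) j k : mu.-integrable D (EFin \o (fun x => c * b j k x)).
  exact: (integrableZl _ c (bi j k)).
have H1 (j : 'I_m.+1) := Rintegral_sum (index_enum 'I_m.+1) mD (fun k : 'I_m.+1 => iz (t j * t k) j k).
have [H2 H3] := Rintegral_sum (index_enum 'I_m.+1) mD (fun j => proj1 (H1 j)).
have : 0 <= \int[mu]_(x in D)
    (\sum_(j < m.+1) \sum_(k < m.+1) t j * t k * b j k x).
  apply: ae_Rintegral_ge0 => //.
  by apply: filterS b0 => x H Dx; exact: H.
rewrite H3 (eq_bigr (fun j : 'I_m.+1 => \sum_(k < m.+1)
    t j * t k * \int[mu]_(x in D) b j k x)); last first.
  move=> j _; rewrite (proj2 (H1 j)); apply: eq_bigr => k _.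
  by rewrite RintegralZl.
rewrite big_ord_recl big_ord_recl (_ : t (@ord0 m) = 1)// mulr1 mul1r.
rewrite (eq_bigr (fun k : 'I_m => - (l k * a k ^+ 2))); last first.
  by move=> k _; rewrite mul1r lift0 b0k /t; ring.
rewrite [X in _ + X](eq_bigr (fun k : 'I_m => 0)); last first.
  move=> j _; rewrite big_ord_recl !lift0 (_ : t (@ord0 m) = 1)// mulr1 bk0 (bigD1 j)// big1 => [|k kj].
    rewrite ?lift0 bjk eqxx /t [LHS]/=; ring.
  by rewrite ?lift0 bjk eq_sym (_ : (k : nat) == j = false) ?mulr0//; exact: negbTE.
by rewrite [X in _ + X]big1// sumrN addr0 subr_ge0.
Qed.
End quadratic_bessel.

Section L2_products.
Context {R : realType} {n : nat}.
Variable Omega : set 'rV[R]_n.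
Hypotheses (oO : open Omega).

Let mO : measurable Omega. Proof. exact: open_rv_measurable. Qed.

Lemma L2_sq_integrable (w : 'rV[R]_n -> R) : L2 Omega one_weight w ->
  leb.-integrable Omega (EFin \o (fun x => w x ^+ 2)).
Proof.
move=> [mw w2]; apply/integrableP; split.
  by apply/measurable_EFinP; apply: measurable_funX.
move: w2; rewrite /L2sq /one_weight; congr (_ < _)%E; apply: eq_integral => x _ /=.
by rewrite mul1r ger0_norm ?sqr_ge0.
Qed.

Lemma L2_mul_integrable (w v : 'rV[R]_n -> R) : L2 Omega one_weight w ->
  L2 Omega one_weight v -> leb.-integrable Omega (EFin \o (fun x => w x * v x)).
Proof.
move=> Hw Hv; have iw := L2_sq_integrable Hw; have iv := L2_sq_integrable Hv.
apply: (@le_integrable _ _ _ _ _ _ _ (EFin \o (fun x => w x ^+ 2 + v x ^+ 2))) => //.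
- by apply/measurable_EFinP; apply: measurable_funM; [case: Hw|case: Hv].
- move=> x _ /=; rewrite lee_fin normrM [leRHS]ger0_norm ?addr_ge0 ?sqr_ge0//.
  have := sqr_ge0 (`|w x| - `|v x|); rewrite sqrrB !real_normK ?num_real//.
  have := mulr_ge0 (normr_ge0 (w x)) (normr_ge0 (v x)); lra.
- exact: (integrableD _ iw iv).
Qed.

Lemma bounded_mul_integrable (B : R) (p w : 'rV[R]_n -> R) : measurable_fun Omega p ->
  {ae leb, forall x, Omega x -> `|p x| <= B} ->
  leb.-integrable Omega (EFin \o w) ->
  leb.-integrable Omega (EFin \o (fun x => p x * w x)).
Proof.
move=> mp pB iw; have mw : measurable_fun Omega w.
  by apply/measurable_EFinP; case/integrableP: iw.
(* Clamping makes the bound hold at every point; [q] equals [p] almost everywhere in [Omega]. *)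
pose q x := Num.min `|B| (Num.max (- `|B|) (p x)).
have mq : measurable_fun Omega q by apply: measurable_minr => //; exact: measurable_maxr.
have iq : leb.-integrable Omega (EFin \o (fun x => q x * w x)).
  apply: (@le_integrable _ _ _ _ _ _ _ (EFin \o (fun x => `|B| * `|w x|))) => //.
  - by apply/measurable_EFinP; exact: measurable_funM.
  - move=> x _ /=; rewrite lee_fin !normrM normr_id normr_id ler_wpM2r//.
    have B0 := normr_ge0 B; rewrite ler_norml /q; apply/andP; split.
      by rewrite le_min le_max lexx /= andbT; lra.
    by rewrite ge_min lexx.
  - exact: (integrableZl _ `|B| (integrable_abse iw)).
apply: ae_integrable iq => //; first exact: measurable_funM.
apply: filterS pB => x H Dx /=; rewrite /q; congr (_ * _).
have /ler_normlP[h1 h2] := H Dx; have := ler_norm B => h3.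
rewrite max_r; last by lra.
by rewrite min_r//; lra.
Qed.

Lemma bessel (w : 'rV[R]_n -> R) (phi : nat -> 'rV[R]_n -> R) m :
  L2 Omega one_weight w -> (forall k, L2 Omega one_weight (phi k)) ->
  (forall j k, L2dot Omega (phi j) (phi k) = (j == k)%:R) ->
  \sum_(k < m) L2dot Omega w (phi k) ^+ 2 <= \int[leb]_(x in Omega) (w x ^+ 2).
Proof.
move=> Hw Hphi on.
pose v k := if k is k'.+1 then phi k' else w.
have Hv k : L2 Omega one_weight (v k) by case: k => [|k]; [exact: Hw|exact: Hphi].
rewrite (eq_bigr (fun k : 'I_m => 1 * L2dot Omega w (phi k) ^+ 2)); last first.
  by move=> k _; rewrite mul1r.
have -> : \int[leb]_(x in Omega) (w x ^+ 2) = \int[leb]_(x in Omega) (v 0%N x * v 0%N x).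
  by apply: eq_Rintegral => x _; rewrite expr2.
apply: (@gram_bessel _ _ _ leb Omega (fun j k x => v j x * v k x) (fun=> 1)
  (fun k => L2dot Omega w (phi k)) m mO).
- by move=> j k; exact: L2_mul_integrable.
- apply: aeW => x Dx t.
  suff -> : \sum_(j < m.+1) \sum_(k < m.+1) t j * t k * (v j x * v k x) =
    (\sum_(j < m.+1) t j * v j x) ^+ 2 by exact: sqr_ge0.
  rewrite expr2 mulr_suml; apply: eq_bigr => j _; rewrite mulr_sumr.
  by apply: eq_bigr => k _; ring.
- by move=> k; rewrite mul1r.
- by move=> k; rewrite mul1r; apply: eq_Rintegral => x _; rewrite mulrC.
- by move=> j k; rewrite mul1r -on.
Qed.
End L2_products.

(** * Weak gradients of C^1 functions and Poincare's inequality *)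

Section weak_gradients.
Context {R : realType} {n : nat}.
Implicit Types (U : set 'rV[R]_n) (f : 'rV[R]_n -> R).

Definition grad f (x : 'rV[R]_n) : 'rV[R]_n := \row_i 'D_(unit_vec i) f x.

Lemma measurable_partial U f i : measurable U -> C1 f ->
  measurable_fun U ('D_(unit_vec i) f).
Proof. by move=> mU /(_ i)[_]; exact: continuous_rv_measurable. Qed.

Lemma C1c_weak_grad U f : open U -> C1c U f -> is_weak_grad U f (grad f).
Proof.
move=> oU fU i; have [L L0 fL] := C1c_lip fU; have C1f := proj1 fU; have fL' : lip L f := fL.
have -> : (fun x => grad f x 0 i) = 'D_(unit_vec i) f by apply/funext => x; rewrite mxE.
apply: (@lip_weak_partial _ _ L L) => //.
- by apply: measurable_partial => //; exact: open_rv_measurable.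
- by move=> z _; exact: strict_partial_lip fL' (C1_strict_partial _ _ C1f) L0.
- by apply: aeW => z Uz; exact: strict_partial_quot (C1_strict_partial _ _ C1f).
Qed.

Lemma C1c_bound U f : C1c U f -> exists B, (forall x, `|f x| <= B) /\
  forall x i, `|'D_(unit_vec i) f x| <= B.
Proof.
move=> fU; have [L L0 fL] := C1c_lip fU; have fL' : lip L f := fL; have [C1f [K [cK KU f0]]] := fU.
have [r r0 Kr] := compact_cube cK.
have [B HB] := continuous_bounded_cube (ltW r0) (C1_continuous C1f).
exists (`|B| + L); split=> [x|x i].
  have [Kx|/f0->] := pselect (K x); last by rewrite normr0 addr_ge0.
  by rewrite (le_trans (HB _ (Kr _ Kx)))// (le_trans (ler_norm B))// lerDl.
rewrite (le_trans (strict_partial_lip fL' (C1_strict_partial _ _ C1f) L0))//.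
by rewrite lerDr.
Qed.

Lemma sub_lt_pinfty U (r : R) : measurable U -> U `<=` cube n r -> (leb U < +oo)%E.
Proof.
move=> mU Ur; apply: le_lt_trans (leb_cube n r); apply: le_measure => //; rewrite inE//.
exact: measurable_cube.
Qed.

Lemma bounded_L2 U f (B : R) : measurable U -> (leb U < +oo)%E -> measurable_fun U f ->
  (forall x, U x -> `|f x| <= B) -> L2 U one_weight f.
Proof.
move=> mU Uoo mf fB; split=> //.
have : leb.-integrable U (EFin \o (fun x => f x ^+ 2)).
  apply: measurable_bounded_integrable => //; first exact: measurable_funX.
  exists (B ^+ 2); split; first exact: num_real.
  move=> M BM x Ux /=; rewrite normrX (le_trans _ (ltW BM))//.
  have h := fB x Ux; rewrite ler_sqr ?nnegrE//; exact: le_trans h.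
move=> /integrableP[_]; congr (_ < _)%E; apply: eq_integral => x _ /=.
by rewrite /one_weight mul1r ger0_norm ?sqr_ge0.
Qed.

Lemma L2sq_ae_eq U f g : measurable U -> measurable_fun U f -> measurable_fun U g ->
  {ae leb, forall x, U x -> f x = g x} -> L2sq U one_weight f = L2sq U one_weight g.
Proof.
move=> mU mf mg fg; rewrite /L2sq /one_weight; apply: ae_eq_integral => //.
- by apply/measurable_EFinP; apply: measurable_funM => //; exact: measurable_funX.
- by apply/measurable_EFinP; apply: measurable_funM => //; exact: measurable_funX.
by apply: filterS fg => x H Ux; rewrite H.
Qed.

Lemma wgrad_measurable U f i : (exists G, is_weak_grad U f G) ->
  measurable_fun U (fun x => wgrad U f x 0 i).
Proof.
move=> [G H]; have W : is_weak_grad U f (wgrad U f).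
  by rewrite /wgrad; apply: xgetPex; exists G.
by have [_ [m _] _] := W i.
Qed.

Lemma weak_grad0 U : open U -> {ae leb, forall x, U x -> wgrad U (fun=> 0) x = 0}.
Proof.
move=> oU; have [_ H] := weak_grad_wgrad oU (C1c_weak_grad oU (C1c0 U)).
apply: filterS H => x H Ux; rewrite H//; apply/rowP => i; rewrite !mxE.
by rewrite derive_cst.
Qed.

Lemma C1c_H10 U f (r : R) : open U -> U `<=` cube n r -> C1c U f -> H10 U f.
Proof.
move=> oU Ur fU; have mU := open_rv_measurable oU.
have Uoo := sub_lt_pinfty mU Ur; have [B [fB dB]] := C1c_bound fU.
have wG := C1c_weak_grad oU fU; have [_ ae] := weak_grad_wgrad oU wG.
have C1f := proj1 fU.
have exG : exists G, is_weak_grad U f G by exists (grad f).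
split; first split.
- apply: (bounded_L2 mU Uoo) => //.
  exact: (continuous_rv_measurable mU (C1_continuous C1f)).
- exact: exG.
- move=> i; split; first exact: wgrad_measurable.
  rewrite (@L2sq_ae_eq U _ ('D_(unit_vec i) f))//.
  + by apply: (proj2 (bounded_L2 mU Uoo (measurable_partial i mU C1f) (fun x _ => dB x i))).
  + exact: wgrad_measurable.
  + exact: measurable_partial.
  + by apply: filterS ae => x H Ux; rewrite H// mxE.
(* The approximating sequence is constant; yet [wgrad] of the zero function is itself a choice and
   vanishes only almost everywhere, so the distance of [f] to itself needs an argument. *)
exists (fun=> f) => // ; rewrite /H1_cvg (_ : (fun _ => _) = fun=> 0%E); first exact: cvg_cst.
apply/funext => j; rewrite (_ : f \- f = fun=> 0); last first.
  by apply/funext => x /=; rewrite subrr.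
rewrite /H1sq /L2sq integral0_eq ?add0e; last first.
  by move=> x _; rewrite expr0n /= mulr0.
rewrite /gradsq -[RHS](@integral0 _ _ R leb U).
apply: ae_eq_integral => //.
  apply/measurable_EFinP; apply: measurable_funM; first exact: measurable_cst.
  have mw i : measurable_fun U (fun x => wgrad U (fun=> 0) x 0 i).
    by apply: wgrad_measurable; exists (grad (fun=> 0)); exact: C1c_weak_grad (C1c0 U).
  exact: (measurable_sum (index_enum 'I_n) (fun i => measurable_funM (mw i) (mw i))).
apply: filterS (weak_grad0 oU) => x H Ux; rewrite H//.
by rewrite dot0l mulr0.
Qed.

(** Testing the weak derivative of the constant 1 with x_i f^2 shows that the integral of f^2 + 2
    x_i f d_i f is zero. With |x_i| <= r, Young's inequality absorbs half of f^2 and leaves the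
    constant 4 r^2. *)
Lemma poincare U f (r : R) (i : 'I_n) : open U -> 0 <= r -> U `<=` cube n r -> C1c U f ->
  \int[leb]_(x in U) (f x ^+ 2) <=
  4 * r ^+ 2 * \int[leb]_(x in U) ('D_(unit_vec i) f x ^+ 2).
Proof.
move=> oU r0 Ur fU; have mU := open_rv_measurable oU.
have Uoo := sub_lt_pinfty mU Ur; have [B [fB dB]] := C1c_bound fU.
have C1f := proj1 fU; have fD := C1_is_C1 C1f.
have mf := continuous_rv_measurable mU (C1_continuous C1f).
have mdf := measurable_partial i mU C1f.
have L2f : L2 U one_weight f by apply: (bounded_L2 mU Uoo mf) => x _; exact: fB.
have L2d : L2 U one_weight ('D_(unit_vec i) f).
  by apply: (bounded_L2 mU Uoo mdf) => x _; exact: dB.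
have if2 := L2_sq_integrable L2f; have id2 := L2_sq_integrable L2d.
have fg := is_C1M (@is_C1_coord R n i) (is_C1M fD fD).
have gU : C1c U (fun x => x 0 i * (f x * f x)).
  split; first exact: is_C1_C1 fg.
  have [_ [K [cK KU f0]]] := fU; exists K; split=> // x /f0 ->.
  by rewrite !mulr0.
have lip1 : lip 0 (fun _ : 'rV[R]_n => 1 : R) by move=> x y; rewrite subrr normr0 mul0r.
have [_ _ /(_ _ gU)] : is_weak_partial U i (fun=> 1) (fun=> 0).
  apply: (@lip_weak_partial _ _ 0 0 _ _ i _ oU lip1) => //.
    by move=> z _; rewrite normr0.
  by apply: aeW => z _; under eq_fun do rewrite subrr mul0r; exact: cvg_cst.
move=> E.
have ixfd : leb.-integrable U (EFin \o (fun x : 'rV[R]_n => x 0 i * (f x * 'D_(unit_vec i) f x))).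
  apply: (@bounded_mul_integrable _ _ _ oU r).
  - exact: measurable_funTS (measurable_coord i).
  - by apply: aeW => x Ux; exact: Ur.
  - exact: (L2_mul_integrable oU L2f L2d).
have {}E : \int[leb]_(x in U) (f x ^+ 2 + 2 * (x 0 i * (f x * 'D_(unit_vec i) f x))) = 0.
  transitivity (\int[leb]_(x in U) (1 * 'D_(unit_vec i) (fun x : 'rV[R]_n => x 0 i * (f x * f x)) x)).
    apply: eq_Rintegral => x _.
    by have -> := congr1 (@^~ x) (is_C1_derive i fg); rewrite eqxx /=; ring.
  rewrite E (_ : (fun x => _) = fun=> 0); first by rewrite Rintegral_cst// mul0r oppr0.
  by apply/funext => x; rewrite mul0r.
rewrite RintegralD// in E; last exact: (integrableZl _ 2 ixfd).
rewrite RintegralZl// in E.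
have H : \int[leb]_(x in U) ((- 2) * (x 0 i * (f x * 'D_(unit_vec i) f x))) <=
    \int[leb]_(x in U) (2^-1 * f x ^+ 2 + 2 * r ^+ 2 * 'D_(unit_vec i) f x ^+ 2).
  apply: le_Rintegral => //.
  - exact: (integrableZl _ (- 2) ixfd).
  - exact: (integrableD _ (integrableZl _ 2^-1 if2) (integrableZl _ (2 * r ^+ 2) id2)).
  move=> x Ux; have := Ur x Ux i; rewrite -ler_sqr ?nnegrE// real_normK ?num_real// => xr.
  have h1 := sqr_ge0 (f x + 2 * (x 0 i * 'D_(unit_vec i) f x)).
  have h2 := ler_wpM2r (sqr_ge0 ('D_(unit_vec i) f x)) xr.
  move: h1 h2; move: (f x) (x 0 i) ('D_(unit_vec i) f x) => a b c h1 h2.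
  have -> : - 2 * (b * (a * c)) = 2^-1 * a ^+ 2 + 2 * (b ^+ 2 * c ^+ 2) -
    2^-1 * (a + 2 * (b * c)) ^+ 2 by field.
  lra.
rewrite RintegralZl// RintegralD// in H; last 2 first.
- exact: (integrableZl _ 2^-1 if2).
- exact: (integrableZl _ (2 * r ^+ 2) id2).
rewrite !RintegralZl// in H.
move: E H; move: (Rintegral _ _ _) (Rintegral _ _ _) (Rintegral _ _ _) => a b c; lra.
Qed.
End weak_gradients.

Lemma cvg_sumR {R : realType} {T : Type} (F : set_system T) {FF : Filter F} (I : Type)
    (r : seq I) (f : I -> T -> R) (a : I -> R) :
  (forall i, f i x @[x --> F] --> a i) ->
  \sum_(i <- r) f i x @[x --> F] --> \sum_(i <- r) a i.
Proof.
move=> H; elim: r => [|i r IH].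
  by rewrite big_nil; under eq_fun do rewrite big_nil; exact: cvg_cst.
by rewrite big_cons; under eq_fun do rewrite big_cons; exact: cvgD.
Qed.

(** * Uniform ellipticity and the energy form *)

Section ellipticity.
Context {R : realType} {n : nat}.
Variables (Omega : set 'rV[R]_n) (A : 'rV[R]_n -> 'M[R]_n) (c : 'rV[R]_n -> R).
Hypotheses (oO : open Omega) (bO : bounded_set Omega) (HA : admissible_A Omega A)
  (Hc : admissible_c Omega c).

Let mO : measurable Omega. Proof. exact: open_rv_measurable. Qed.

Lemma mx_entry_le (X : 'M[R]_n) i j : `|X i j| <= `|X|.
Proof. by rewrite [leRHS]mx_normrE; exact: (le_bigmax _ _ (i, j)). Qed.

Lemma A_lip : exists2 L, 0 <= L & forall x y, closure Omega x -> closure Omega y ->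
  forall i j, `|A x i j - A y i j| <= L * `|x - y|.
Proof.
have [[M [Mr HM]] _ _ _] := HA.
exists (`|M| + 1) => [|x y Ox Oy i j]; first by rewrite addr_ge0.
have M1 : M < `|M| + 1 by rewrite (le_lt_trans (ler_norm M)) ?ltrDl.
have := HM _ M1 (x, y) (conj Ox Oy); rewrite /= => H; apply: le_trans H.
have -> : A x i j - A y i j = (A x - A y) i j by rewrite !mxE.
exact: mx_entry_le.
Qed.

Lemma A_measurable i j : measurable_fun Omega (fun x => A x i j).
Proof.
have [L L0 H] := A_lip.
have L1 : 0 < L + 1 by rewrite ltr_wpDl.
apply: continuous_at_rv_measurable => // x Ox B /= /(nbhs_ballP (A x i j))[e /= e0 He].
have : nbhs x (Omega `&` ball x (e / (L + 1))).
  apply: filterI; first exact: open_nbhs_nbhs.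
  by apply: nbhsx_ballx; exact: divr_gt0.
apply: filterS => y [Oy]; rewrite mx_norm_ball /ball_/= => xy; apply: He.
apply: le_lt_trans (H x y (subset_closure Ox) (subset_closure Oy) i j) _.
rewrite ltr_pdivlMr// in xy; apply: le_lt_trans xy.
by rewrite mulrC ler_wpM2l// lerDl.
Qed.

Lemma A_bound : exists2 B, 0 <= B & forall x, closure Omega x ->
  forall i j, `|A x i j| <= B.
Proof.
have [L L0 H] := A_lip.
have [->|/set0P[x0 Ox0]] := eqVneq Omega set0.
  by exists 0 => // x; rewrite closure0.
have [r r0 Or] := bounded_cube bO.
have Cr : closure Omega `<=` cube n r.
  by have /closure_id -> := @closed_cube R n r; exact: closureS.
exists (`|A x0| + L * (r + r)) => [|x Ox i j].
  by rewrite addr_ge0// mulr_ge0// addr_ge0// ltW.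
have Ox0' := subset_closure Ox0.
rewrite -[A x i j](subrK (A x0 i j)) addrC (le_trans (ler_normD _ _))// lerD//.
  exact: mx_entry_le.
rewrite (le_trans (H _ _ Ox Ox0' i j))// ler_wpM2l// (le_trans (ler_normB _ _))//.
by apply: lerD; apply/(rv_norm_leP _ (ltW r0)); exact: Cr.
Qed.

Lemma dot_flux (g h : 'rV[R]_n) x :
  dot (g *m (A x)^T) h = \sum_i \sum_j A x i j * (g 0 j * h 0 i).
Proof.
apply: eq_bigr => i _; rewrite mxE mulr_suml; apply: eq_bigr => j _.
by rewrite mxE; ring.
Qed.

Lemma dot_ge0 (g : 'rV[R]_n) : 0 <= dot g g.
Proof. by apply: sumr_ge0 => i _; rewrite -expr2 sqr_ge0. Qed.

Lemma flux_le : exists2 B, 0 <= B & forall x, closure Omega x -> forall g : 'rV[R]_n,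
  dot (g *m (A x)^T) g <= B * dot g g.
Proof.
have [B B0 HB] := A_bound; exists (n%:R * B); first by rewrite mulr_ge0.
move=> x Ox g; rewrite dot_flux.
apply: (@le_trans _ _ (\sum_(i < n) \sum_(j < n) (B / 2 * g 0 j ^+ 2 + B / 2 * g 0 i ^+ 2))).
  apply: ler_sum => i _; apply: ler_sum => j _.
  rewrite (le_trans (ler_norm _))// !normrM.
  apply: (@le_trans _ _ (B * (`|g 0 j| * `|g 0 i|))).
    by rewrite ler_wpM2r ?mulr_ge0// HB.
  rewrite -[g 0 j ^+ 2]real_normK ?num_real// -[g 0 i ^+ 2]real_normK ?num_real//.
  have := mulr_ge0 B0 (sqr_ge0 (`|g 0 j| - `|g 0 i|)); rewrite sqrrB; lra.
have E : \sum_(i < n) g 0 i ^+ 2 = dot g g by apply: eq_bigr => i _; rewrite expr2.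
rewrite (eq_bigr (fun i => B / 2 * dot g g + n%:R * (B / 2 * g 0 i ^+ 2))); last first.
  move=> i _; rewrite big_split /= -mulr_sumr E; congr (_ + _).
  by rewrite sumr_const card_ord mulr_natl.
rewrite big_split /= [X in _ + X <= _](_ : _ = n%:R * (B / 2 * dot g g)); last first.
  by rewrite -!mulr_sumr E.
rewrite sumr_const card_ord -[X in X + _]mulr_natl.
by rewrite le_eqVlt; apply/orP; left; apply/eqP; field.
Qed.

(** Positive definiteness is pointwise; compactness of the closure of [Omega] times the unit sphere
    keeps the quadratic form away from 0, and homogeneity extends the bound to all vectors. *)
Lemma flux_ge : exists2 a0, 0 < a0 & forall x, closure Omega x -> forall g : 'rV[R]_n,
  a0 * dot g g <= dot (g *m (A x)^T) g.
Proof.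
have [L L0 HL] := A_lip; have [r r0 Or] := bounded_cube bO.
have [_ _ _ pos] := HA.
pose S := [set g : 'rV[R]_n | dot g g = 1].
pose q (z : 'rV[R]_n * 'rV[R]_n) := \sum_i \sum_j A z.1 i j * (z.2 0 j * z.2 0 i).
have cdot : continuous (fun g : 'rV[R]_n => dot g g).
  by apply: C1_continuous; apply: C1_sum => i _; apply: C1M; exact: C1_coord.
have cS : compact S.
  apply: bounded_closed_compact.
    exists 1; split; first exact: num_real.
    move=> M M1 g /= g1; apply: le_trans (ltW M1); apply/rv_norm_leP => // i.
    rewrite -[leRHS]ger0_norm// -ler_sqr ?nnegrE// !real_normK ?num_real//.
    rewrite expr1n -g1 /dot (bigD1 i)//= -expr2 lerDl.
    by apply: sumr_ge0 => j _; rewrite -expr2 sqr_ge0.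
  apply: (@closed_comp _ _ (fun g : 'rV[R]_n => dot g g) [set 1]); last exact: closed_eq.
  by move=> g _; exact: cdot.
have cO : compact (closure Omega).
  apply: bounded_closed_compact; last exact: closed_closure.
  have Cr : closure Omega `<=` cube n r.
  by have /closure_id -> := @closed_cube R n r; exact: closureS.
  exists r; split; first exact: num_real.
  by move=> M rM z /Cr Hz; apply: le_trans (ltW rM); apply/(rv_norm_leP _ (ltW r0)).
have cK : compact (closure Omega `*` S) by exact: compact_setX.
(* Continuity is relative to the closure of [Omega], where [A] is Lipschitz. *)
have cq : {within closure Omega `*` S, continuous q}.
  apply/subspace_continuousP => -[x g] [/= Ox Sg].
  apply: cvg_sumR => i; apply: cvg_sumR => j; apply: cvgM.
    apply/cvgrPdist_lt => e e0.
    have L1 : 0 < L + 1 by rewrite ltr_wpDl.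
    have d0 : 0 < e / (L + 1) by exact: divr_gt0.
    rewrite /prop_near1 /within /=.
    apply/nbhs_ballP; exists (e / (L + 1)) => //= -[y h] [/= xy _] [Oy _].
    have {}xy : `|x - y| < e / (L + 1) by move: xy; rewrite /= mx_norm_ball.
    apply: le_lt_trans (HL x y Ox Oy i j) _.
    rewrite ltr_pdivlMr// in xy; apply: le_lt_trans xy.
    by rewrite mulrC ler_wpM2l// lerDl.
  have c2 (k : 'I_n) : (fun z : 'rV[R]_n * 'rV[R]_n => z.2 0 k) @
      within (closure Omega `*` S) (nbhs ((x, g) : ('rV[R]_n * 'rV[R]_n)%type)) --> g 0 k.
    apply: cvg_within_filter.
    apply: (@continuous_comp _ _ _ snd (fun h : 'rV[R]_n => h 0 k) (x, g)).
      exact: cvg_snd.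
    exact: (C1_continuous (C1_coord k)).
  by apply: cvgM; exact: c2.
have cI := continuous_compact cq cK.
have : open (~` (q @` (closure Omega `*` S))).
  by apply: closed_openC; apply: compact_closed => //; exact: Rhausdorff.
have n0 : (~` (q @` (closure Omega `*` S))) 0.
  move=> [[x g] [/= Ox Sg] q0].
  have gn0 : g != 0 by apply: contra_eq_neq Sg => ->; rewrite dot0l eq_sym oner_neq0.
  by have := pos x Ox g gn0; rewrite dot_flux -/(q (x, g)) q0 ltxx.
rewrite openE => /(_ 0 n0) /nbhs_ballP[a0 /= a00 Ha]; exists a0 => // x Ox g.
have [->|gn0] := eqVneq g 0.
  by rewrite dot0l mulr0 mul0mx dot0l.
have g0 : 0 < dot g g.
  rewrite lt_def dot_ge0 andbT; apply: contra_neq gn0 => g0.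
  move: g0; rewrite /dot => /eqP; rewrite psumr_eq0 => [/allP H|i _]; last by rewrite -expr2 sqr_ge0.
  apply/rowP => i; rewrite mxE.
  by have := H i (mem_index_enum i); rewrite mulf_eq0 orbb => /eqP.
set t := Num.sqrt (dot g g); have t0 : 0 < t by rewrite sqrtr_gt0.
have tE : t ^+ 2 = dot g g by rewrite sqr_sqrtr// ltW.
have qE : q (x, t^-1 *: g) = t^-1 ^+ 2 * dot (g *m (A x)^T) g.
  rewrite dot_flux /q mulr_sumr; apply: eq_bigr => i _; rewrite mulr_sumr.
  by apply: eq_bigr => j _; rewrite !mxE; ring.
have Sg : S (t^-1 *: g).
  rewrite /S /= (_ : dot _ _ = t^-1 ^+ 2 * dot g g); last first.
    by rewrite /dot mulr_sumr; apply: eq_bigr => i _; rewrite !mxE; ring.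
  by rewrite -tE -exprMn mulVf ?expr1n// gt_eqF.
have : ~ ball (0 : R) a0 (q (x, t^-1 *: g)).
  by move=> /Ha; apply; exists (x, t^-1 *: g).
have qpos : 0 < q (x, t^-1 *: g).
  by rewrite qE mulr_gt0 ?exprn_gt0 ?invr_gt0//; exact: pos.
rewrite /ball/= sub0r normrN gtr0_norm// => /negP; rewrite -leNgt qE exprVn tE.
by rewrite mulrC ler_pdivlMr.
Qed.
End ellipticity.

Section energy.
Context {R : realType} {n : nat}.
Variables (Omega : set 'rV[R]_n) (A : 'rV[R]_n -> 'M[R]_n) (c : 'rV[R]_n -> R).
Hypotheses (oO : open Omega) (bO : bounded_set Omega) (HA : admissible_A Omega A)
  (Hc : admissible_c Omega c).

Let mO : measurable Omega. Proof. exact: open_rv_measurable. Qed.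

Definition form_density (w v : 'rV[R]_n -> R) x :=
  dot (flux A (wgrad Omega w) x) (wgrad Omega v x) + c x * w x * v x.

Lemma form_integrable w v : H1 Omega one_weight w -> H1 Omega one_weight v ->
  leb.-integrable Omega (EFin \o form_density w v).
Proof.
move=> [w2 _ gw] [v2 _ gv].
have [B B0 AB] := A_bound bO HA.
have i1 : leb.-integrable Omega (EFin \o
    (fun x => dot (flux A (wgrad Omega w) x) (wgrad Omega v x))).
  have -> : (fun x => dot (flux A (wgrad Omega w) x) (wgrad Omega v x)) = (fun x =>
      \sum_i \sum_j A x i j * (wgrad Omega w x 0 j * wgrad Omega v x 0 i)).
    by apply/funext => x; rewrite /flux dot_flux.
  have H i j : leb.-integrable Omega (EFin \o (fun x => A x i j *
      (wgrad Omega w x 0 j * wgrad Omega v x 0 i))).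
    apply: (@bounded_mul_integrable _ _ _ oO B).
    - exact: A_measurable.
    - by apply: aeW => x Ox; apply: AB; exact: subset_closure.
    - exact: (L2_mul_integrable oO (gw j) (gv i)).
  exact: (proj1 (Rintegral_sum _ mO (fun i => proj1 (Rintegral_sum _ mO (H i))))).
have [mc [M HM]] := Hc.
have i2 : leb.-integrable Omega (EFin \o (fun x => c x * (w x * v x))).
  apply: (@bounded_mul_integrable _ _ _ oO M) => //.
    by apply: filterS HM => x H Ox; have /andP[h1 h2] := H Ox; rewrite ger0_norm.
  exact: (L2_mul_integrable oO w2 v2).
have -> : form_density w v = (fun x =>
    dot (flux A (wgrad Omega w) x) (wgrad Omega v x) + c x * (w x * v x)).
  by apply/funext => x; rewrite /form_density mulrA.
exact: (integrableD _ i1 i2).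
Qed.

Lemma form_L_sym w v : form_L Omega A c w v = form_L Omega A c v w.
Proof.
have [_ _ sym _] := HA.
apply: eq_Rintegral => x; rewrite inE => Ox; rewrite /flux !dot_flux; congr (_ + _); last by ring.
rewrite exchange_big; apply: eq_bigr => i _; apply: eq_bigr => j _ /=.
have -> : A x j i = A x i j by rewrite -[in RHS](sym _ (subset_closure Ox)) mxE.
by ring.
Qed.

Lemma flux_ge0 x g : Omega x -> 0 <= dot (g *m (A x)^T) g.
Proof.
move=> Ox; have [a0 a00 H] := flux_ge bO HA.
apply: le_trans (H x (subset_closure Ox) g).
by rewrite mulr_ge0 ?dot_ge0// ltW.
Qed.

Variables (lam : nat -> R) (phi : nat -> 'rV[R]_n -> R).
Hypothesis eig : dirichlet_eigenpairs Omega A c lam phi.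

(** The Gram argument in the energy form. Positivity is checked pointwise on the linear combination
    of the chosen gradients, since [wgrad] is linear only almost everywhere; the zero-order term
    adds [c * W ^+ 2]. *)
Lemma energy_bessel u m : H10 Omega u ->
  \sum_(k < m) lam k * L2dot Omega u (phi k) ^+ 2 <= form_L Omega A c u u.
Proof.
have [phi0 phiE on _] := eig => u0.
have [mc [M HM]] := Hc.
pose v k := if k is k'.+1 then phi k' else u.
have v0 k : H10 Omega (v k) by case: k => [|k]; [exact: u0|exact: phi0].
apply: (@gram_bessel _ _ _ leb Omega (fun j k => form_density (v j) (v k)) lam
  (fun k => L2dot Omega u (phi k)) m mO).
- by move=> j k; apply: form_integrable; [case: (v0 j)|case: (v0 k)].
- apply: filterS HM => x H Ox t; have /andP[c0 _] := H Ox.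
  pose G := \sum_(j < m.+1) t j *: wgrad Omega (v j) x.
  pose W := \sum_(j < m.+1) t j * v j x.
  have -> : \sum_(j < m.+1) \sum_(k < m.+1) t j * t k * form_density (v j) (v k) x
      = dot (G *m (A x)^T) G + c x * W ^+ 2.
    rewrite (eq_bigr (fun j : 'I_m.+1 =>
      dot ((t j *: wgrad Omega (v j) x) *m (A x)^T) G + c x * (t j * v j x * W))); last first.
      move=> j _; rewrite /G /W.
      have -> : dot ((t j *: wgrad Omega (v j) x) *m (A x)^T)
          (\sum_(k < m.+1) t k *: wgrad Omega (v k) x) =
          \sum_(k < m.+1) t j * t k * dot (wgrad Omega (v j) x *m (A x)^T) (wgrad Omega (v k) x).
        rewrite /dot (eq_bigr (fun i => \sum_(k < m.+1) t j * t k *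
            ((wgrad Omega (v j) x *m (A x)^T) 0 i * wgrad Omega (v k) x 0 i))); last first.
          move=> i _; rewrite summxE mulr_sumr; apply: eq_bigr => k _.
          by rewrite -scalemxAl !mxE; ring.
        by rewrite exchange_big; apply: eq_bigr => k _; rewrite mulr_sumr.
      rewrite 2!mulr_sumr -big_split; apply: eq_bigr => k _ /=.
      by rewrite /form_density /flux; ring.
    rewrite big_split /=; congr (_ + _).
      rewrite /dot exchange_big; apply: eq_bigr => i _ /=.
      by rewrite -mulr_suml; congr (_ * _); rewrite /G mulmx_suml summxE.
    by rewrite -mulr_sumr -mulr_suml expr2.
  by rewrite addr_ge0// ?flux_ge0// mulr_ge0// sqr_ge0.
- move=> k; rewrite -[LHS]/(form_L Omega A c u (phi k)) form_L_sym phiE//.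
  by congr (_ * _); apply: eq_Rintegral => x _; rewrite mulrC.
- move=> k; transitivity (form_L Omega A c (phi k) u); first by [].
  rewrite (phiE k u u0).
  by congr (_ * _); apply: eq_Rintegral => x _; rewrite mulrC.
- move=> j k; transitivity (form_L Omega A c (phi j) (phi k)); first by [].
  by rewrite (phiE j _ (phi0 k)) on.
Qed.

Lemma eigenvalue_ge0 k : 0 <= lam k.
Proof.
have [phi0 phiE on _] := eig; have [mc [M HM]] := Hc.
have -> : lam k = form_L Omega A c (phi k) (phi k) by rewrite phiE// on eqxx mulr1.
have [h1 _] := phi0 k; apply: ae_Rintegral_ge0 => //; first exact: form_integrable.
apply: filterS HM => x H Ox; have /andP[c0 _] := H Ox.
by rewrite addr_ge0 ?flux_ge0// -mulrA mulr_ge0// -expr2 sqr_ge0.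
Qed.

(** Poincare's inequality in the direction [i0] absorbs the zero-order term, because the norm on the
    cylinder measures gradients only. *)
Lemma form_L_le (i0 : 'I_n) : exists2 C, 0 <= C & forall u, C1c Omega u ->
  form_L Omega A c u u <= C * \int[leb]_(x in Omega) dot (grad u x) (grad u x).
Proof.
have [B B0 HB] := flux_le bO HA; have [r r0 Or] := bounded_cube bO.
have [mc [M HM]] := Hc.
exists (B + `|M| * (4 * r ^+ 2)); first by rewrite addr_ge0// mulr_ge0// mulr_ge0// sqr_ge0.
move=> u uO; have u0 := C1c_H10 oO Or uO; have [h1 _] := u0; have [u2 _ _] := h1.
have C1u := proj1 uO.
have Uoo := sub_lt_pinfty mO Or; have [Bu [_ dB]] := C1c_bound uO.
have [_ ae] := weak_grad_wgrad oO (C1c_weak_grad oO uO).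
have L2d i : L2 Omega one_weight ('D_(unit_vec i) u).
  by apply: (bounded_L2 mO Uoo (measurable_partial i mO C1u)) => x _; exact: dB.
have id2 i := L2_sq_integrable (L2d i).
have gE x : dot (grad u x) (grad u x) = \sum_i 'D_(unit_vec i) u x ^+ 2.
  by apply: eq_bigr => i _; rewrite mxE expr2.
have [ig IgE] := Rintegral_sum (index_enum 'I_n) mO id2.
have {}ig : leb.-integrable Omega (EFin \o (fun x => dot (grad u x) (grad u x))).
  by rewrite (_ : (fun x => _) = (fun x => \sum_i 'D_(unit_vec i) u x ^+ 2))//; apply/funext.
have iu := L2_sq_integrable u2.
have iS : leb.-integrable Omega (EFin \o
    (fun x => B * dot (grad u x) (grad u x) + `|M| * u x ^+ 2)).
  exact: (integrableD _ (integrableZl _ B ig) (integrableZl _ `|M| iu)).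
have := @ae_Rintegral_ge0 _ _ _ leb Omega
  (fun x => B * dot (grad u x) (grad u x) + `|M| * u x ^+ 2 - form_density u u x) mO.
have iF := form_integrable h1 h1.
move=> /(_ (integrableB mO iS iF)).
have H : {ae leb, forall x, Omega x ->
    0 <= B * dot (grad u x) (grad u x) + `|M| * u x ^+ 2 - form_density u u x}.
  apply: filterS2 ae HM => x gx cx Ox; rewrite subr_ge0 /form_density /flux gx//.
  have /andP[c0 cM] := cx Ox; apply: lerD; first by apply: HB; exact: subset_closure.
  by rewrite -mulrA -expr2 ler_wpM2r ?sqr_ge0// (le_trans cM)// ler_norm.
have SE : \int[leb]_(x in Omega) (B * dot (grad u x) (grad u x) + `|M| * u x ^+ 2) =
    B * \int[leb]_(x in Omega) dot (grad u x) (grad u x) +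
    `|M| * \int[leb]_(x in Omega) (u x ^+ 2).
  rewrite -(RintegralZl B mO ig) -(RintegralZl `|M| mO iu).
  exact: (RintegralD mO (integrableZl _ B ig) (integrableZl _ `|M| iu)).
move=> /(_ H); rewrite (RintegralB mO iS iF) subr_ge0 SE => /le_trans; apply.
rewrite mulrDl lerD2l -mulrA; apply: ler_wpM2l => //.
apply: le_trans (poincare i0 oO (ltW r0) Or uO) _.
apply: ler_wpM2l; first by rewrite mulr_ge0 ?sqr_ge0.
apply: (le_Rintegral mO (id2 i0) ig) => x _; rewrite gE (bigD1 i0)//= lerDl.
by apply: sumr_ge0 => i _; exact: sqr_ge0.
Qed.
End energy.

(** * Trace inequality and coercivity *)

Section slices.
Context {R : realType} {n : nat}.
Local Notation mu := (@lebesgue_measure R).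

Lemma continuous_ptl (y : R) : continuous (fun x : 'rV[R]_n => pt x y).
Proof.
move=> x A /= /(nbhs_ballP (pt x y))[e /= e0 H].
apply/nbhs_ballP; exists e => //= x' /(rv_ballP _ _ e0) xx'; apply: H.
apply/(rv_ballP _ _ e0) => i; rewrite !mxE; case: unliftP => [j _ | _]; first exact: xx'.
by rewrite subrr normr0.
Qed.

Lemma continuous_ptr (x : 'rV[R]_n) : continuous (fun y : R => pt x y).
Proof.
move=> y A /= /(nbhs_ballP (pt x y))[e /= e0 H].
apply/nbhs_ballP; exists e => //= y' yy'; apply: H.
apply/(rv_ballP _ _ e0) => i; rewrite !mxE; case: unliftP => [j _ | _]; last exact: yy'.
by rewrite subrr normr0.
Qed.

Lemma continuous_slice (f : 'rV[R]_n.+1 -> R) y :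
  continuous f -> continuous (fun x => f (pt x y)).
Proof.
move=> cf x; apply: (@continuous_comp _ _ _ (fun x => pt x y) f x).
  exact: continuous_ptl.
exact: cf.
Qed.

Lemma continuous_vslice (f : 'rV[R]_n.+1 -> R) x :
  continuous f -> continuous (fun y => f (pt x y)).
Proof.
move=> cf y; apply: (@continuous_comp _ _ _ (fun y => pt x y) f y).
  exact: continuous_ptr.
exact: cf.
Qed.

Lemma is_C1_slice (u : 'rV[R]_n.+1 -> R) D y : is_C1 u D ->
  is_C1 (fun x => u (pt x y)) (fun i x => D (lift ord_max i) (pt x y)).
Proof.
move=> uD i; have [ud uc] := uD (lift ord_max i); split=> [x|]; last exact: continuous_slice.
apply: is_derive_line0.
have -> : (fun t : R => u (pt (x + t *: unit_vec i) y)) =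
    (fun t : R => u (pt x y + t *: unit_vec (lift ord_max i))).
  apply/funext => t; congr u; apply/rowP => j; rewrite !mxE.
  case: (unliftP ord_max j) => [k ->|->]; rewrite ?mxE.
    by rewrite !eqxx /= (inj_eq lift_inj).
  by rewrite !eqxx /= (negPf (neq_lift _ _)) mulr0 addr0.
by apply: is_derive_line; rewrite scale0r addr0.
Qed.

Lemma is_derive_vslice (u : 'rV[R]_n.+1 -> R) D x (y : R) : is_C1 u D ->
  is_derive y (1 : R) (fun t : R => u (pt x t)) (D ord_max (pt x y)).
Proof.
move=> uD; have [ud _] := uD ord_max.
have ptE t : pt x t = pt x 0 + t *: unit_vec ord_max.
  apply/rowP => j; rewrite !mxE; case: (unliftP ord_max j) => [k ->|->].
    by rewrite eqxx /= eq_sym (negPf (neq_lift _ _)) mulr0 addr0.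
  by rewrite !eqxx /= mulr1 add0r.
have -> : (fun t : R => u (pt x t)) = (fun t : R => u (pt x 0 + t *: unit_vec ord_max)).
  by apply/funext => t; rewrite ptE.
by apply: is_derive_line; rewrite -ptE.
Qed.

Lemma C1_partial_out (m : nat) (f : 'rV[R]_m -> R) (Q : set 'rV[R]_m) i x : closed Q ->
  (forall z, ~ Q z -> f z = 0) -> ~ Q x -> 'D_(unit_vec i) f x = 0.
Proof.
move=> cQ f0 nQx; rewrite (@near_eq_derive _ _ _ f (cst 0)) ?derive_cst//.
by apply: filterS (open_nbhs_nbhs (conj (closed_openC cQ) nQx)) => z nQz; exact: f0.
Qed.

Variables (Omega : set 'rV[R]_n).
Hypothesis oO : open Omega.
Let mO : measurable Omega. Proof. exact: open_rv_measurable. Qed.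

Section slice_integral.
Variables (g : 'rV[R]_n.+1 -> R) (h : 'rV[R]_n -> R) (B : R).
Hypotheses (cg : continuous g) (gB : forall z, `|g z| <= B)
  (ih : leb.-integrable Omega (EFin \o h)).

Lemma slice_integrable y : leb.-integrable Omega (EFin \o (fun x => g (pt x y) * h x)).
Proof.
apply: (@bounded_mul_integrable _ _ _ oO B) => //; last exact: aeW.
by apply: continuous_rv_measurable => //; exact: continuous_slice.
Qed.

Let iB : leb.-integrable Omega (EFin \o (fun x => B * `|h x|)).
Proof. exact: (integrableZl _ B (integrable_abse ih)). Qed.

Let gh_le y x : `|g (pt x y) * h x| <= B * `|h x|.
Proof. by rewrite normrM ler_wpM2r. Qed.

Lemma slice_integral_continuous : continuous (fun y => \int[leb]_(x in Omega) (g (pt x y) * h x)).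
Proof.
move=> t; have := @continuity_under_integral R _ _ leb (fun y x => g (pt x y) * h x)
  Omega mO (t - 1) (t + 1) _ _ _ iB.
apply.
- by move=> y _; exact: slice_integrable.
- apply: aeW => x _ y _; apply: (@continuousM _ _ (fun y => g (pt x y)) (fun=> h x)).
    exact: continuous_vslice.
  exact: cst_continuous.
- by move=> y _; apply: aeW => x _; exact: gh_le.
- by rewrite inE /= in_itv /= ltrDl ltr01 andbT ltrBlDr ltrDl ltr01.
Qed.
End slice_integral.

(** Makes the modes y -> (u(., y), phi_k) differentiable, as the one-dimensional inequality demands;
    [B * |h x|] dominates the differentiated integrand. *)
Lemma slice_integral_derive (u : 'rV[R]_n.+1 -> R) D (h : 'rV[R]_n -> R) (B : R) (t : R) :
  is_C1 u D -> (forall z, `|u z| <= B) -> (forall i z, `|D i z| <= B) ->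
  leb.-integrable Omega (EFin \o h) ->
  is_derive t (1 : R) (fun y => \int[leb]_(x in Omega) (u (pt x y) * h x))
    (\int[leb]_(x in Omega) (D ord_max (pt x t) * h x)).
Proof.
move=> uD uB DB ih; have cu : continuous u := C1_c uD.
have B0 : 0 <= B by exact: le_trans (uB 0).
have It : `]t - 1, t + 1[%classic t.
  by rewrite /= in_itv /= ltrDl ltr01 andbT ltrBlDr ltrDl ltr01.
have dE y x : is_derive y (1 : R) (fun y : R => u (pt x y) * h x) (D ord_max (pt x y) * h x).
  have H := is_derive_vslice x y uD.
  rewrite (_ : (fun y => _) = (fun y => h x *: u (pt x y))); last first.
    by apply/funext => z; rewrite mulrC.
  by rewrite mulrC; exact: is_deriveZ.
have pE y x : partial1of2 (fun y x => u (pt x y) * h x) y x = D ord_max (pt x y) * h x.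
  by rewrite partial1of2E; case: (dE y x).
have i1 y : `]t - 1, t + 1[%classic y -> leb.-integrable Omega (EFin \o (fun x => u (pt x y) * h x)).
  by move=> _; exact: (slice_integrable cu uB ih).
have i2 y x : `]t - 1, t + 1[%classic y -> Omega x ->
    derivable (fun y : R => u (pt x y) * h x) y 1 by move=> _ _; case: (dE y x).
have i3 (x : 'rV[R]_n) : 0 <= B * `|h x| by rewrite mulr_ge0.
have i4 : leb.-integrable Omega (EFin \o (fun x => B * `|h x|)).
  exact: (integrableZl _ B (integrable_abse ih)).
have i5 y x : `]t - 1, t + 1[%classic y -> Omega x ->
    `|partial1of2 (fun y x => u (pt x y) * h x) y x| <= B * `|h x|.
  by move=> _ _; rewrite pE normrM ler_wpM2r.
have H1 := @derivable_under_integral R _ _ leb _ Omega mO t _ _ It i1 i2 _ i3 i4 i5.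
have H2 := @differentiation_under_integral R _ _ leb _ Omega mO t _ _ It i1 i2 _ i3 i4 i5.
apply: DeriveDef => //; rewrite -derive1E H2.
by apply: eq_Rintegral => x _; rewrite pE.
Qed.
End slices.

(** * Trace inequality for C^1 functions *)

Section trace_C1.
Context {R : realType} {n : nat}.
Local Notation mu := (@lebesgue_measure R).
Variables (Omega : set 'rV[R]_n) (A : 'rV[R]_n -> 'M[R]_n) (c : 'rV[R]_n -> R)
  (lam : nat -> R) (phi : nat -> 'rV[R]_n -> R) (s : R).
Hypotheses (oO : open Omega) (bO : bounded_set Omega) (HA : admissible_A Omega A)
  (Hc : admissible_c Omega c) (eig : dirichlet_eigenpairs Omega A c lam phi)
  (s01 : 0 < s < 1) (i0 : 'I_n).
Let mO : measurable Omega. Proof. exact: open_rv_measurable. Qed.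

Lemma measurable_weight (D : set 'rV[R]_n.+1) : measurable_fun D (weight s).
Proof.
apply: measurable_funTS; apply: (measurableT_comp (measurable_powR _)).
exact: measurable_coord.
Qed.

Lemma open_cyl Y : open (cyl Omega Y).
Proof.
have cv : continuous (@ver R n) by apply: C1_continuous; exact: C1_coord.
have -> : cyl Omega Y = [set z | Omega (hor z)] `&` (@ver R n @^-1` `]0, Y[).
  by apply/seteqP; split => z /=; rewrite in_itv.
apply: openI.
  by apply: (@open_comp _ _ (@hor R n)) => // z _; exact: continuous_hor.
by apply: (@open_comp _ _ (@ver R n)) => [z _|]; [exact: cv|exact: interval_open].
Qed.

Lemma measurable_cyl Y : measurable (cyl Omega Y).
Proof. by apply: open_rv_measurable; exact: open_cyl. Qed.

Lemma cyl_tonelli Y (f : 'rV[R]_n.+1 -> R) : measurable_fun setT f -> (forall z, 0 <= f z) ->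
  (\int[leb]_(z in cyl Omega Y) (f z)%:E =
   \int[mu]_(y in `]0%R, Y[) \int[leb]_(x in Omega) (f (pt x y))%:E)%E.
Proof.
move=> mf f0; rewrite integral_mkcond leb_tonelli; last 2 first.
- apply/(measurable_restrictT _ (measurable_cyl Y)).
  by apply/measurable_EFinP; exact: measurable_funTS.
- by move=> z; rewrite patchE; case: ifP => // _; rewrite lee_fin.
rewrite [RHS]integral_mkcond; apply: eq_integral => y _; rewrite patchE.
case: ifPn => [|] /=; rewrite mem_setE ?in_itv/= => yY.
  rewrite [RHS]integral_mkcond; apply: eq_integral => x _; rewrite !patchE.
  have -> // : (pt x y \in cyl Omega Y) = (x \in Omega).
  by apply/idP/idP; rewrite !inE /cyl /= hor_pt ver_pt => // -[].
rewrite integral0_eq// => x _; rewrite patchE memNset// /cyl /= hor_pt ver_pt => -[_].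
by rewrite (negPf yY).
Qed.

Lemma L2_integrable (w : 'rV[R]_n -> R) : L2 Omega one_weight w ->
  leb.-integrable Omega (EFin \o w).
Proof.
move=> w2; have [r r0 Or] := bounded_cube bO.
have H1 : L2 Omega one_weight (fun=> 1).
  by apply: (@bounded_L2 _ _ _ _ 1) => //; [exact: sub_lt_pinfty Or|rewrite normr1].
have := L2_mul_integrable oO w2 H1.
by rewrite (_ : (fun x => _) = w)//; apply/funext => x; rewrite mulr1.
Qed.

Lemma trace_C1 : exists2 C, 0 <= C & forall (Y : R) (u : 'rV[R]_n.+1 -> R) D (Q : set 'rV[R]_n.+1) m,
  is_C1 u D -> compact Q -> Q `<=` [set z | Omega (hor z) /\ `|ver z| < Y] ->
  (forall z, ~ Q z -> u z = 0) ->
  ((\sum_(k < m) lam k `^ s * L2dot Omega (restr0 u) (phi k) ^+ 2)%:E <=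
   C%:E * \int[leb]_(z in cyl Omega Y) (weight s z * \sum_i D i z ^+ 2)%:E)%E.
Proof.
have [CE CE0 HCE] := form_L_le oO bO HA Hc i0.
have [r r0 Or] := bounded_cube bO; have Uoo := sub_lt_pinfty mO Or.
have [phi0 _ on _] := eig.
have phi2 k : L2 Omega one_weight (phi k) by have [[]] := phi0 k.
have iphi k := L2_integrable (phi2 k).
have [s0 s1] := andP s01.
have C0 : 0 <= 4 + s^-1 by rewrite addr_ge0// invr_ge0 ltW.
(* [4 + s^-1] comes from each mode in y, 1 from Bessel's inequality for the derivative in y, and
   [CE] from the energy of the slices. *)
exists ((4 + s^-1) * (1 + CE)) => [|Y u D Q m uD cQ QO u0].
  by rewrite mulr_ge0// addr_ge0.
have clQ : closed Q by apply: compact_closed => //; exact: norm_hausdorff.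
have C1u := is_C1_C1 uD.
have uC : C1c setT u by split => //; exists Q; split.
have DE i : 'D_(unit_vec i) u = D i := is_C1_derive i uD.
have [B [uB dB]] := C1c_bound uC.
have DB i z : `|D i z| <= B by rewrite -DE.
have Dout i z : ~ Q z -> D i z = 0 by move=> nQ; rewrite -DE; exact: C1_partial_out nQ.
have cu : continuous u := C1_c uD.
have cD i : continuous (D i) by have [] := uD i.
pose us y x := u (pt x y).
have usD y := is_C1_slice y uD.
(* The projection of [Q] supports every slice, so slices belong to H^1_0(Omega) and may be tested
   against the eigenfunctions. *)
have usC y : C1c Omega (us y).
  split; first exact: is_C1_C1 (usD y).
  exists (@hor R n @` Q); split.
  - by apply: continuous_compact => //; apply: continuous_subspaceT; exact: continuous_hor.
  - by move=> _ [z /QO[Oz _] <-].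
  - move=> x nx; apply: u0 => Qx; apply: nx; exists (pt x y) => //; exact: hor_pt.
have nQ x y : Y <= y -> ~ Q (pt x y).
  by move=> Yy /QO[_]; rewrite ver_pt => /(le_lt_trans (ler_norm y)); rewrite ltNge Yy.
pose v k y := L2dot Omega (us y) (phi k).
pose dv k y := \int[leb]_(x in Omega) (D ord_max (pt x y) * phi k x).
have dvE k t : is_derive t (1 : R) (v k) (dv k t).
  exact: (slice_integral_derive oO t uD uB DB (iphi k)).
have cdv k : continuous (dv k).
  exact: (slice_integral_continuous oO (cD ord_max) (DB ord_max) (iphi k)).
have cv k : continuous (v k).
  exact: (slice_integral_continuous oO cu uB (iphi k)).
have vY k t : Y <= t -> v k t = 0.
  move=> Yt; rewrite /v /L2dot (_ : (fun x => _) = fun=> 0) ?Rintegral_cst ?mul0r//.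
  by apply/funext => x; rewrite /us u0 ?mul0r//; exact: nQ.
have dvY k t : Y <= t -> dv k t = 0.
  move=> Yt; rewrite /dv (_ : (fun x => _) = fun=> 0) ?Rintegral_cst ?mul0r//.
  by apply/funext => x; rewrite Dout ?mul0r//; exact: nQ.
have lam0 k : 0 <= lam k := eigenvalue_ge0 oO bO HA Hc eig k.
pose S z := \sum_i D i z ^+ 2.
have S0 z : 0 <= S z by apply: sumr_ge0 => i _; exact: sqr_ge0.
have cS : continuous S.
  move=> z; apply: (@cvg_sumR R _ (nbhs z) (nbhs_filter z) _ (index_enum 'I_n.+1)
    (fun i z => D i z ^+ 2) (fun i => D i z ^+ 2)) => i.
  apply: (@continuous_comp _ _ _ (D i) (fun t => t ^+ 2)); first exact: cD.
  exact: exprn_continuous.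
have mS : measurable_fun setT S by exact: continuous_rv_measurable.
have i1 : leb.-integrable Omega (EFin \o (fun=> 1 : R)).
  by apply: L2_integrable; apply: (@bounded_L2 _ _ _ _ 1) => //; rewrite normr1.
have SB z : `|S z| <= \sum_(i < n.+1) B ^+ 2.
  rewrite ger0_norm//; apply: ler_sum => i _.
  rewrite -real_normK ?num_real// ler_sqr ?nnegrE// ?DB//.
  exact: le_trans (DB i z).
have iS y : leb.-integrable Omega (EFin \o (fun x => S (pt x y))).
  have := slice_integrable oO cS SB i1 y.
  by under eq_fun do rewrite mulr1.
pose g k t := t `^ (1 - 2 * s) * (dv k t ^+ 2 + lam k * v k t ^+ 2).
have g0 k t : 0 <= g k t.
  by rewrite mulr_ge0 ?powR_ge0// addr_ge0 ?sqr_ge0// mulr_ge0 ?sqr_ge0.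
have csq (f : R -> R) : continuous f -> continuous (fun t => f t ^+ 2).
  move=> cf t; apply: (@continuous_comp _ _ _ f (fun u => u ^+ 2)); first exact: cf.
  exact: exprn_continuous.
have mg k : measurable_fun setT (g k).
  apply: measurable_funM; first exact: measurable_powR.
  apply: continuous_measurable_fun => t.
  apply: cvgD; first exact: csq.
  by apply: cvgM; [exact: cvg_cst|exact: csq].
have H1 k : ((lam k `^ s * L2dot Omega (restr0 u) (phi k) ^+ 2)%:E <=
    (4 + s^-1)%:E * \int[mu]_(t in `]0%R, Y[) (g k t)%:E)%E.
  have := @trace_oned R s Y (lam k) (v k) (dv k) s01 (lam0 k) (dvE k) (cdv k) (vY k) (dvY k).
  by apply.
apply: (@le_trans _ _ ((4 + s^-1)%:E * \int[mu]_(t in `]0%R, Y[) (\sum_(k < m) g k t)%:E)%E).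
  have -> : (\int[mu]_(t in `]0%R, Y[) (\sum_(k < m) g k t)%:E =
      \sum_(k < m) \int[mu]_(t in `]0%R, Y[) (g k t)%:E)%E.
    under eq_integral do rewrite -sumEFin.
    apply: (@ge0_integral_sum _ _ R mu `]0, Y[ _ _ (fun (k : 'I_m) t => (g k t)%:E)) => //.
      by move=> k; apply/measurable_EFinP; exact: measurable_funTS (mg k).
    by move=> k t _; rewrite lee_fin; exact: g0.
  rewrite ge0_sume_distrr; last first.
    by move=> k _; apply: integral_ge0 => t _; rewrite lee_fin.
  by rewrite -sumEFin; apply: lee_sum => k _; exact: H1.
rewrite EFinM -muleA; apply: lee_wpmul2l; first by rewrite lee_fin.
rewrite (@cyl_tonelli Y (fun z => weight s z * S z)); last 2 first.
- by apply: measurable_funM => //; exact: measurable_weight.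
- by move=> z; rewrite mulr_ge0 ?powR_ge0.
pose E t := \int[leb]_(x in Omega) S (pt x t).
have E0 t : 0 <= E t by apply: Rintegral_ge0.
have EE t : (\int[leb]_(x in Omega) (weight s (pt x t) * S (pt x t))%:E =
    (t `^ (1 - 2 * s) * E t)%:E)%E.
  under eq_integral do rewrite /weight ver_pt.
  rewrite -[LHS]fineK; last exact: integrable_fin_num (integrableZl _ (t `^ (1 - 2 * s)) (iS t)).
  by congr EFin; exact: (RintegralZl _ mO (iS t)).
under [X in (_ <= _ * X)%E]eq_integral do rewrite EE.
have cE : continuous E.
  rewrite (_ : E = fun y => \int[leb]_(x in Omega) (S (pt x y) * 1)).
    exact: (slice_integral_continuous oO cS SB i1).
  by apply/funext => y; apply: eq_Rintegral => x _; rewrite mulr1.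
have mE : measurable_fun setT (fun t => t `^ (1 - 2 * s) * E t).
  by apply: measurable_funM; [exact: measurable_powR|exact: continuous_measurable_fun].
rewrite -ge0_integralZl//; last 3 first.
- by apply/measurable_EFinP; exact: measurable_funTS.
- by move=> t _; rewrite lee_fin mulr_ge0 ?powR_ge0.
- by rewrite lee_fin addr_ge0.
apply: ge0_le_integral => //.
- by move=> t _; rewrite lee_fin; apply: sumr_ge0.
- apply/measurable_EFinP; apply: measurable_funTS.
  exact: (measurable_sum (index_enum 'I_m) (fun k : 'I_m => mg k)).
- by apply/measurable_EFinP; apply: measurable_funTS; exact: measurable_funM.
(* The common factor t^(1 - 2 s) is removed; what is left, at each height [t], is Bessel's
   inequality in L^2 for the derivative in y and in the energy form for the slice. *)
move=> t _; rewrite -EFinM lee_fin /g -mulr_sumr mulrCA ler_wpM2l ?powR_ge0//.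
rewrite big_split /=.
have HE : \int[leb]_(x in Omega) (D ord_max (pt x t) ^+ 2) +
    \int[leb]_(x in Omega) dot (grad (us t) x) (grad (us t) x) = E t.
  have iD : leb.-integrable Omega (EFin \o (fun x => D ord_max (pt x t) ^+ 2)).
    apply: L2_sq_integrable => //; apply: (@bounded_L2 _ _ _ _ B) => //.
    by apply: continuous_rv_measurable => //; exact: continuous_slice.
  have dE x : dot (grad (us t) x) (grad (us t) x) = \sum_i D (lift ord_max i) (pt x t) ^+ 2.
    apply: eq_bigr => i _; rewrite mxE expr2.
    by have -> := congr1 (@^~ x) (is_C1_derive i (usD t)).
  have SE x : S (pt x t) = D ord_max (pt x t) ^+ 2 + dot (grad (us t) x) (grad (us t) x).
    rewrite dE /S big_ord_recr /= addrC; congr (_ + _); apply: eq_bigr => i _.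
    congr (D _ _ ^+ 2); apply: val_inj; rewrite /= /bump leqNgt ltn_ord add0n.
    by [].
  have iG : leb.-integrable Omega (EFin \o (fun x => dot (grad (us t) x) (grad (us t) x))).
    have := integrableB mO (iS t) iD; congr (leb.-integrable Omega _); apply/funext => x /=.
    by rewrite SE; congr EFin; ring.
  by rewrite -RintegralD//; apply: eq_Rintegral => x _; rewrite SE.
rewrite mulrDl mul1r -HE; apply: lerD.
  apply: le_trans (_ : \int[leb]_(x in Omega) (D ord_max (pt x t) ^+ 2) <= _).
    apply: (bessel oO m _ phi2 on); apply: (@bounded_L2 _ _ _ _ B) => //.
    by apply: continuous_rv_measurable => //; exact: continuous_slice.
  by rewrite lerDl; apply: Rintegral_ge0 => x _; exact: dot_ge0.
apply: le_trans (energy_bessel oO bO HA Hc eig m (C1c_H10 oO Or (usC t))) _.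
apply: le_trans (HCE _ (usC t)) _; apply: ler_wpM2l => //.
by rewrite lerDr; apply: Rintegral_ge0 => x _; exact: sqr_ge0.
Qed.
End trace_C1.

Section fe_gradients.
Context {R : realType} {n : nat}.
Variables (Omega : set 'rV[R]_n) (Y : R) (N : nat) (K : 'I_N -> cell R n)
  (M : nat) (yy : nat -> R) (W : 'rV[R]_n.+1 -> R).
Hypotheses (n1 : (1 <= n)%N) (oO : open Omega) (bO : bounded_set Omega)
  (Y0 : 0 < Y) (ndK : forall i, Defs.nondegenerate (K i))
  (covK : closure Omega = \bigcup_i cell_set (K i))
  (part : is_partition Y M yy) (WV : in_V Omega Y K M yy W).

(* The mesh enters the estimates below only through this statement. *)
Lemma fe_lipschitz_extension : exists (L r : R) (w : 'rV[R]_n.+1 -> R) (G : 'rV[R]_n.+1 -> 'rV[R]_n.+1),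
  [/\ [/\ 0 <= L, 0 < r & lip L w],
      (forall z, ~ cube n.+1 r z -> w z = 0) /\
      (forall z, ~ (Omega (hor z) /\ `|ver z| < Y) -> w z = 0),
      (forall z, cyl Omega Y z -> w z = W z) /\
      (forall x, Omega x -> w (pt x 0) = W (pt x 0)),
      [/\ forall i, measurable_fun setT (fun z => G z 0 i), forall i z, `|G z 0 i| <= L &
        {ae leb, forall z, cyl Omega Y z -> forall i, strict_partial w i z (G z 0 i)}] &
      is_weak_grad (cyl Omega Y) W G].
Proof.
have [L L0 wL] := cylext_lip n1 oO bO ndK covK part WV.
have [r r0 ws] := cylext_cube Y W bO.
have sp := cylext_strict n1 ndK covK part WV.
have oC := @open_cyl R n Omega oO Y.
have [G [mG GL Gsp wG]] := lip_gradient oC L0 wL sp.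
exists L, r, (cylext Omega Y W), G; split => //.
- by split=> // z; exact: cylext_out.
- by split=> [z|x]; [exact: cylext_cyl|exact: cylext_restr0].
- by move=> i; apply: weak_partial_ext (wG i) => // z; exact: cylext_cyl.
Qed.
End fe_gradients.

Section cylinder_integrals.
Context {R : realType} {n : nat}.
Variables (Omega : set 'rV[R]_n) (s : R).
Hypotheses (oO : open Omega) (bO : bounded_set Omega) (s01 : 0 < s < 1).

(** The exponent 1 - 2 s exceeds -1, so the weight, singular at y = 0 when s > 1/2, is integrable
    over the bounded cylinder. *)
Lemma weight_integrable Y : 0 < Y -> leb.-integrable (cyl Omega Y) (EFin \o weight s).
Proof.
move=> Y0; have [r r0 Or] := bounded_cube bO.
have mO : measurable Omega by exact: open_rv_measurable.
have Oo := sub_lt_pinfty mO Or.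
have mw := @measurable_weight R n s setT.
apply/integrableP; split; first by apply/measurable_EFinP; exact: measurable_weight.
under eq_integral do rewrite /= ger0_norm ?powR_ge0//.
rewrite (@cyl_tonelli _ _ _ oO Y (weight s)) //; last by move=> z; exact: powR_ge0.
have [s0 s1] := andP s01.
have b1 : -1 < 1 - 2 * s by lra.
have iP := integrable_powR b1 Y0.
have -> : (\int[lebesgue_measure]_(y in `]0%R, Y[) \int[leb]_(x in Omega) (weight s (pt x y))%:E =
    \int[lebesgue_measure]_(y in `]0%R, Y[) ((leb Omega) * (y `^ (1 - 2 * s))%:E))%E.
  apply: eq_integral => y _; rewrite /weight; under eq_integral do rewrite ver_pt.
  by rewrite integral_cst// muleC.
rewrite ge0_integralZl//; last 2 first.
- apply/measurable_EFinP; apply: measurable_funTS; exact: measurable_powR.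
- by move=> y _; rewrite lee_fin powR_ge0.
rewrite lte_mul_pinfty ?ge0_fin_numE// integral_powR// ltry.
by [].
Qed.

Lemma weighted_integrable Y (B : R) (p : 'rV[R]_n.+1 -> R) : 0 < Y ->
  measurable_fun (cyl Omega Y) p ->
  {ae leb, forall z, cyl Omega Y z -> `|p z| <= B} ->
  leb.-integrable (cyl Omega Y) (EFin \o (fun z => weight s z * p z)).
Proof.
move=> Y0 mp pB; rewrite (_ : (fun z => _) = (fun z => p z * weight s z)); last first.
  by apply/funext => z; rewrite mulrC.
by apply: (@bounded_mul_integrable _ _ _ (@open_cyl R n Omega oO Y) B) => //; exact: weight_integrable.
Qed.

Lemma measurable_hor_comp Y (f : 'rV[R]_n -> R) : measurable_fun Omega f ->
  measurable_fun (cyl Omega Y) (fun z => f (hor z)).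
Proof.
move=> mf; apply: (measurable_comp (F := Omega)) => //.
- exact: open_rv_measurable.
- by move=> _ [z [Oz _] <-].
- by apply: measurable_funTS; apply: measurable_rvP => i; under eq_fun do rewrite mxE; exact: measurable_coord.
Qed.

(** Lifts the almost everywhere bounds on [c] to the cylinder: the preimage of a null set under
    [hor] has null horizontal sections. *)
Lemma ae_cyl Y (P : 'rV[R]_n -> Prop) : {ae leb, forall x, Omega x -> P x} ->
  {ae leb, forall z, cyl Omega Y z -> P (hor z)}.
Proof.
move=> [B [mB B0 HB]]; exists (@hor R n @^-1` B).
have mh : measurable_fun setT (@hor R n).
  by apply: measurable_rvP => i; under eq_fun do rewrite mxE; exact: measurable_coord.
have mhB : measurable (@hor R n @^-1` B) by rewrite -[X in measurable X]setTI; exact: mh.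
split => //; last first.
  move=> z /= nz; apply: HB => /= H; apply: nz => -[Oz _]; exact: H.
apply: leb_null_hsections => // y; rewrite -[RHS]B0; congr (leb _).
by apply/seteqP; split => x /=; rewrite hor_pt.
Qed.
End cylinder_integrals.

Lemma cvg_sqr {R : realType} (a : nat -> R) (l : R) : a j @[j --> \oo] --> l ->
  a j ^+ 2 @[j --> \oo] --> l ^+ 2.
Proof. by move=> al; rewrite expr2; under eq_fun do rewrite expr2; exact: cvgM. Qed.

(** * Trace inequality and coercivity for discrete functions *)

Section trace_and_coercivity.
Context {R : realType} {n : nat}.
Variables (Omega : set 'rV[R]_n) (A : 'rV[R]_n -> 'M[R]_n) (c : 'rV[R]_n -> R)
  (lam : nat -> R) (phi : nat -> 'rV[R]_n -> R) (s : R).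
Hypotheses (n1 : (1 <= n)%N) (oO : open Omega) (bO : bounded_set Omega) (HA : admissible_A Omega A)
  (Hc : admissible_c Omega c) (eig : dirichlet_eigenpairs Omega A c lam phi)
  (s01 : 0 < s < 1).

Let mO : measurable Omega. Proof. exact: open_rv_measurable. Qed.

Lemma fe_restr0_L2 Y N (K : 'I_N -> cell R n) M yy W : 0 < Y ->
  (forall i, Defs.nondegenerate (K i)) -> closure Omega = \bigcup_i cell_set (K i) ->
  is_partition Y M yy -> in_V Omega Y K M yy W -> L2 Omega one_weight (restr0 W).
Proof.
move=> Y0 ndK covK part WV; have [r' r'0 Or] := bounded_cube bO.
have [L [r [w [G [[L0 r0 wL] [ws _] [_ w0] _ _]]]]] :=
  fe_lipschitz_extension n1 oO bO Y0 ndK covK part WV.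
have [B HB] := continuous_bounded_cube (ltW r0) (lip_continuous wL).
apply: (@bounded_L2 _ _ _ _ `|B|) => //; first exact: sub_lt_pinfty Or.
  apply: (eq_measurable_fun (fun x => w (pt x 0))).
    by move=> x; rewrite inE => Ox; rewrite w0.
  by apply: continuous_rv_measurable => //; apply: continuous_slice; exact: lip_continuous wL.
move=> x Ox; rewrite /restr0 -w0//.
have [zr|/ws->] := pselect (cube n.+1 r (pt x 0)); last by rewrite normr0.
by rewrite (le_trans (HB _ zr))// ler_norm.
Qed.

Lemma fe_gradsq Y W (G : 'rV[R]_n.+1 -> 'rV[R]_n.+1) L : 0 < Y ->
  (forall i, measurable_fun setT (fun z => G z 0 i)) -> (forall i z, `|G z 0 i| <= L) ->
  is_weak_grad (cyl Omega Y) W G ->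
  [/\ {ae leb, forall z, cyl Omega Y z -> wgrad (cyl Omega Y) W z = G z},
     leb.-integrable (cyl Omega Y) (EFin \o (fun z => weight s z * dot (G z) (G z))) &
     gradsq (cyl Omega Y) (weight s) W =
     (\int[leb]_(z in cyl Omega Y) (weight s z * dot (G z) (G z)))%:E].
Proof.
move=> Y0 mG GL wG; have oC := @open_cyl R n Omega oO Y.
have mC := open_rv_measurable oC.
have [wg ae] := weak_grad_wgrad oC wG.
have mGG : measurable_fun (cyl Omega Y) (fun z => dot (G z) (G z)).
  apply: measurable_funTS.
  exact: (measurable_sum (index_enum 'I_n.+1) (fun i => measurable_funM (mG i) (mG i))).
have iG : leb.-integrable (cyl Omega Y) (EFin \o (fun z => weight s z * dot (G z) (G z))).
  apply: (weighted_integrable oO bO s01 (B := \sum_(i < n.+1) L ^+ 2)) => //.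
  apply: aeW => z _; rewrite ger0_norm ?dot_ge0//; apply: ler_sum => i _.
  rewrite -expr2 -real_normK ?num_real// ler_sqr ?nnegrE//.
  exact: le_trans (GL i z).
split => //; rewrite -[RHS]/(fine _)%:E fineK; last exact: integrable_fin_num iG.
rewrite /gradsq; apply: ae_eq_integral => //.
- apply/measurable_EFinP; apply: measurable_funM; first exact: measurable_weight.
  have mw i : measurable_fun (cyl Omega Y) (fun x => wgrad (cyl Omega Y) W x 0 i).
    by apply: wgrad_measurable; exists G.
  exact: (measurable_sum (index_enum 'I_n.+1) (fun i => measurable_funM (mw i) (mw i))).
- by case/integrableP: iG.
- by apply: filterS ae => z H Cz; rewrite H.
Qed.

(** The inequality for C^1 functions is applied to truncated mollifications with finitely many
    modes; the radius tends to 0 first, and only afterwards does the number of modes tend to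
    infinity. *)
Lemma fe_trace : exists2 C, 0 <= C & forall Y N (K : 'I_N -> cell R n) M yy W, 0 < Y ->
  (forall i, Defs.nondegenerate (K i)) -> closure Omega = \bigcup_i cell_set (K i) ->
  is_partition Y M yy -> in_V Omega Y K M yy W ->
  gradsq (cyl Omega Y) (weight s) W \is a fin_num /\
  (Hs_sq Omega lam phi s (restr0 W) <= C%:E * gradsq (cyl Omega Y) (weight s) W)%E.
Proof.
have [C C0 HC] := trace_C1 oO bO HA Hc eig s01 (Ordinal n1).
exists C => // Y N K M yy W Y0 ndK covK part WV.
have [L [r [w [G [[L0 r0 wL] [ws wO] [wW w0] [mG GL Gsp] wG]]]]] :=
  fe_lipschitz_extension n1 oO bO Y0 ndK covK part WV.
have [_ iG gE] := fe_gradsq Y0 mG GL wG; rewrite gE; split=> //.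
have mC := measurable_cyl oO Y.
pose h j : R := j.+1%:R^-1; have h0 j : 0 < h j by rewrite invr_gt0.
have hc : h j @[j --> \oo] --> 0 by exact: cvg_harmonic.
have r0' := ltW r0.
(* The gradients are majorised by those of the untruncated mollifications, whose limit is known
   almost everywhere; the derivative of the truncation need not tend to 1 where [w] vanishes. *)
pose S j z := \sum_i dmoll (h j) w i z ^+ 2.
pose S0 z := dot (G z) (G z).
have mS j : measurable_fun setT (S j).
  apply: (measurable_sum (index_enum 'I_n.+1)) => i; apply: measurable_funX.
  apply: continuous_rv_measurable => //.
  by have [] := is_C1_moll (h0 j) r0' wL ws i.
pose B := \sum_(i < n.+1) L ^+ 2.
have SB j z : 0 <= S j z <= B.
  apply/andP; split; first by apply: sumr_ge0 => i _; exact: sqr_ge0.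
  apply: ler_sum => i _; rewrite -real_normK ?num_real// ler_sqr ?nnegrE//.
  exact: dmoll_lip (h0 j) r0' wL ws L0.
have mw : measurable_fun (cyl Omega Y) (weight s) by exact: measurable_weight.
have iS j : leb.-integrable (cyl Omega Y) (EFin \o (fun z => weight s z * S j z)).
  apply: (weighted_integrable oO bO s01 (B := B)) => //; first exact: measurable_funTS.
  by apply: aeW => z _; have /andP[h1 h2] := SB j z; rewrite ger0_norm.
have [_ cS] : leb.-integrable (cyl Omega Y) (EFin \o (fun z => weight s z * S0 z)) /\
    \int[leb]_(z in cyl Omega Y) (weight s z * S j z) @[j --> \oo] -->
    \int[leb]_(z in cyl Omega Y) (weight s z * S0 z).
  apply: (@Rdominated_cvg _ _ _ leb (cyl Omega Y) (fun j z => weight s z * S j z)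
    (fun z => weight s z * S0 z) (fun z => weight s z * B)) => //.
  - by move=> j; apply: measurable_funM => //; exact: measurable_funTS.
  - by apply/measurable_EFinP; case/integrableP: iG.
  - apply: filterS Gsp => z H Cz; apply: cvgM; first exact: cvg_cst.
    apply: cvg_sumR => i; rewrite -expr2.
    have D := dmoll_cvg r0' wL ws h0 hc (H Cz i).
    exact: (cvg_sqr D).
  - apply: (weighted_integrable oO bO s01 (B := `|B|)) => //.
    by apply: aeW => z _; rewrite lexx.
  - move=> j z Cz; have /andP[h1 h2] := SB j z.
    by rewrite ger0_norm ?mulr_ge0 ?powR_ge0// ler_wpM2l ?powR_ge0.
have [phi0 _ _ _] := eig.
have iphi k : leb.-integrable Omega (EFin \o phi k).
  by apply: L2_integrable => //; have [[]] := phi0 k.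
have [Bw HBw] := continuous_bounded_cube r0' (lip_continuous wL).
have wB z : `|w z| <= `|Bw|.
  have [zr|/ws->] := pselect (cube n.+1 r z); last by rewrite normr0.
  by rewrite (le_trans (HBw _ zr))// ler_norm.
have cA j : continuous (molltrunc w L (h j)).
  have := is_C1_molltrunc r0 wL ws (h0 j); exact: C1_c.
have ca k : L2dot Omega (restr0 (molltrunc w L (h j))) (phi k) @[j --> \oo] -->
    L2dot Omega (restr0 W) (phi k).
  have -> : L2dot Omega (restr0 W) (phi k) = \int[leb]_(x in Omega) (w (pt x 0) * phi k x).
    by apply: eq_Rintegral => x; rewrite inE => Ox; rewrite w0.
  apply: (proj2 (@Rdominated_cvg _ _ _ leb Omega
    (fun j (x : 'rV[R]_n) => molltrunc w L (h j) (pt x 0) * phi k x) (fun x : 'rV[R]_n => w (pt x 0) * phi k x)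
    (fun x => (`|Bw| + 5 * (L + 1)) * `|phi k x|) mO _ _ _ _ _)).
  - move=> j; apply: measurable_funM; last by apply/measurable_EFinP; case/integrableP: (iphi k).
    apply: continuous_rv_measurable => //; exact: continuous_slice (cA j).
  - apply: measurable_funM; last by apply/measurable_EFinP; case/integrableP: (iphi k).
    by apply: continuous_rv_measurable => //; apply: continuous_slice; exact: lip_continuous wL.
  - apply: aeW => x _; apply: cvgM; last exact: cvg_cst.
    apply/cvgrPdist_le => e e0.
    have : (5 * (L + 1)) * h j @[j --> \oo] --> 0.
      by rewrite -[X in _ --> X](mulr0 (5 * (L + 1))); apply: cvgM => //; exact: cvg_cst.
    move=> /cvgrPdist_le/(_ _ e0); apply: filterS => j; rewrite sub0r normrN => Hj.
    rewrite distrC (le_trans (molltrunc_unif L0 wL (pt x 0) (h0 j)))//.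
    exact: le_trans (ler_norm _) Hj.
  - exact: (integrableZl _ (`|Bw| + 5 * (L + 1)) (integrable_abse (iphi k))).
  - move=> j x _; rewrite normrM ler_wpM2r//.
    rewrite -[molltrunc _ _ _ _](subrK (w (pt x 0))) addrC (le_trans (ler_normD _ _))// lerD//.
    rewrite (le_trans (molltrunc_unif L0 wL (pt x 0) (h0 j)))// ler_piMr//.
      by rewrite mulr_ge0// addr_ge0.
    by rewrite invf_le1// ler1n.
have key m : \sum_(k < m) lam k `^ s * L2dot Omega (restr0 W) (phi k) ^+ 2 <=
    C * \int[leb]_(z in cyl Omega Y) (weight s z * S0 z).
  have c1 : \sum_(k < m) lam k `^ s * L2dot Omega (restr0 (molltrunc w L (h j))) (phi k) ^+ 2
      @[j --> \oo] --> \sum_(k < m) lam k `^ s * L2dot Omega (restr0 W) (phi k) ^+ 2.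
    apply: cvg_sumR => k; apply: cvgM; first exact: cvg_cst.
    exact: (cvg_sqr (ca k)).
  have c2 : C * \int[leb]_(z in cyl Omega Y) (weight s z * S j z) @[j --> \oo] -->
      C * \int[leb]_(z in cyl Omega Y) (weight s z * S0 z).
    by apply: cvgM => //; exact: cvg_cst.
  apply: (ler_cvg_to c1 c2).
  apply: nearW => j; rewrite -lee_fin.
  have [Q [cQ QO Q0]] := molltrunc_compact L0 r0 wL ws wO (h0 j).
  apply: le_trans (HC Y _ _ Q m (is_C1_molltrunc r0 wL ws (h0 j)) cQ QO Q0) _.
  rewrite EFinM; apply: lee_wpmul2l; first by rewrite lee_fin.
  rewrite -[X in (_ <= X)%E]/((fine _)%:E) fineK; last exact: integrable_fin_num (iS j).
  apply: ge0_le_integral => //.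
  - by move=> z _; rewrite lee_fin mulr_ge0 ?powR_ge0//; apply: sumr_ge0 => i _; exact: sqr_ge0.
  - apply/measurable_EFinP; apply: measurable_funM => //; apply: measurable_funTS.
    apply: (measurable_sum (index_enum 'I_n.+1)) => i; apply: measurable_funX.
    apply: continuous_rv_measurable => //.
    by have [] := is_C1_molltrunc r0 wL ws (h0 j) i.
  - by case/integrableP: (iS j).
  - move=> z _; rewrite lee_fin ler_wpM2l ?powR_ge0//; apply: ler_sum => i _.
    rewrite -[leLHS]real_normK ?num_real// -[leRHS]real_normK ?num_real//.
    by rewrite ler_sqr ?nnegrE//; exact: dmolltrunc_le.
rewrite -EFinM /Hs_sq; apply: lime_le.
  by apply: is_cvg_nneseries => k _ _; rewrite lee_fin mulr_ge0 ?powR_ge0 ?sqr_ge0.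
by apply: nearW => m; rewrite sumEFin lee_fin big_mkord; exact: key.
Qed.

Lemma d_gt0 : 0 < d_ s.
Proof.
have [s0 s1] := andP s01.
have g1 : 0 < EulerGamma (1 - s) by apply: EulerGamma_gt0; lra.
have g2 : 0 < EulerGamma s by apply: EulerGamma_gt0; lra.
by rewrite divr_gt0// mulr_gt0// powR_gt0.
Qed.

Lemma fe_coercive : exists2 c0, 0 < c0 & forall Y N (K : 'I_N -> cell R n) M yy W, 0 < Y ->
  (forall i, Defs.nondegenerate (K i)) -> closure Omega = \bigcup_i cell_set (K i) ->
  is_partition Y M yy -> in_V Omega Y K M yy W ->
  c0 * fine (gradsq (cyl Omega Y) (weight s) W) <= form_Y Omega Y A c s W W.
Proof.
have [a0 a00 Ha] := flux_ge bO HA; have [Bf Bf0 HBf] := flux_le bO HA.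
have [mc [Mc HMc]] := Hc.
(* [a0] bounds the horizontal part of the diffusion from below; the vertical coefficient is 1. *)
pose a1 := Num.min a0 1; have a10 : 0 < a1 by rewrite lt_min a00 ltr01.
exists ((d_ s)^-1 * a1) => [|Y N K M yy W Y0 ndK covK part WV].
  by rewrite mulr_gt0// invr_gt0 d_gt0.
have [L [r [w [G [[L0 r0 wL] [ws wO] [wW w0] [mG GL Gsp] wG]]]]] :=
  fe_lipschitz_extension n1 oO bO Y0 ndK covK part WV.
have [ae iG gE] := fe_gradsq Y0 mG GL wG; rewrite gE /= /form_Y -mulrA.
apply: ler_wpM2l; first by rewrite invr_ge0 ltW// d_gt0.
have mC := measurable_cyl oO Y.
set E := (X in _ <= Rintegral _ _ X).
pose p z := dot (hor (G z) *m (A (hor z))^T) (hor (G z)) + ver (G z) * ver (G z) +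
  c (hor z) * w z ^+ 2.
have [Bw HBw] := continuous_bounded_cube (ltW r0) (lip_continuous wL).
have wB z : `|w z| <= `|Bw|.
  have [zr|/ws->] := pselect (cube n.+1 r z); last by rewrite normr0.
  by rewrite (le_trans (HBw _ zr))// ler_norm.
have aec := ae_cyl Y HMc.
have mp : measurable_fun (cyl Omega Y) p.
  apply: measurable_funD; first apply: measurable_funD.
  - rewrite (_ : (fun z => _) = (fun z => \sum_i \sum_j A (hor z) i j *
        (hor (G z) 0 j * hor (G z) 0 i))); last by apply/funext => z; rewrite dot_flux.
    apply: (measurable_sum (index_enum 'I_n)) => i.
    apply: (measurable_sum (index_enum 'I_n)) => j.
    apply: measurable_funM.
      exact: (measurable_hor_comp oO (A_measurable oO HA i j)).
    have mh k : measurable_fun (cyl Omega Y) (fun z => hor (G z) 0 k).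
      by under eq_fun do rewrite mxE; exact: measurable_funTS (mG _).
    exact: (measurable_funM (mh j) (mh i)).
  - apply: measurable_funTS; exact: (measurable_funM (mG ord_max) (mG ord_max)).
  - apply: measurable_funM; first exact: (measurable_hor_comp oO mc).
    apply: measurable_funX; apply: continuous_rv_measurable => //; exact: lip_continuous wL.
have pEG z : dot (G z) (G z) = dot (hor (G z)) (hor (G z)) + ver (G z) * ver (G z) by exact: dot_split.
have dG z : 0 <= dot (G z) (G z) <= \sum_(i < n.+1) L ^+ 2.
  rewrite dot_ge0; apply: ler_sum => i _; rewrite -expr2 -real_normK ?num_real//.
  by rewrite ler_sqr ?nnegrE// GL.
have vG z : 0 <= ver (G z) * ver (G z) by rewrite -expr2 sqr_ge0.
have hG z : 0 <= dot (hor (G z)) (hor (G z)) by exact: dot_ge0.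
have p_ge z : cyl Omega Y z -> 0 <= c (hor z) -> a1 * dot (G z) (G z) <= p z.
  move=> [Oz _] cz; rewrite pEG mulrDr /p -[leLHS]addr0; apply: lerD; last by rewrite mulr_ge0 ?sqr_ge0.
  apply: lerD.
    apply: le_trans (Ha _ (subset_closure Oz) _); rewrite ler_wpM2r//.
    by rewrite /a1 ge_min lexx.
  by rewrite -[leRHS]mul1r ler_wpM2r// /a1 ge_min lexx orbT.
(* This bound depends on the discrete function through [L] and [Bw], and serves for integrability
   only. *)
pose Bp := (Bf + 1) * \sum_(i < n.+1) L ^+ 2 + `|Mc| * `|Bw| ^+ 2.
have ip : leb.-integrable (cyl Omega Y) (EFin \o (fun z => weight s z * p z)).
  apply: (weighted_integrable oO bO s01 (B := Bp)) => //.
  apply: filterS aec => z H Cz; have /andP[c0 cM] := H Cz; have [Oz _] := Cz.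
  have /andP[g0 g1] := dG z.
  rewrite ger0_norm; last first.
    by apply: le_trans (p_ge z Cz c0); rewrite mulr_ge0// ltW.
  apply: lerD; last first.
    apply: ler_pM => //; first exact: sqr_ge0.
      exact: le_trans cM (ler_norm _).
    by rewrite -real_normK ?num_real// ler_sqr ?nnegrE.
  apply: le_trans (_ : (Bf + 1) * dot (G z) (G z) <= _); last first.
    by rewrite ler_wpM2l// addr_ge0.
  rewrite pEG mulrDr; apply: lerD.
    apply: le_trans (HBf _ (subset_closure Oz) _) _.
    by rewrite ler_wpM2r// lerDl.
  by rewrite -[leLHS]mul1r ler_wpM2r// lerDr.
have EE : \int[leb]_(z in cyl Omega Y) E z = \int[leb]_(z in cyl Omega Y) (weight s z * p z).
  have aeE : {ae leb, forall z, cyl Omega Y z -> weight s z * p z = E z}.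
    apply: filterS ae => z H Cz; rewrite /E H// /p -(wW z Cz); ring.
  have mE : measurable_fun (cyl Omega Y) E.
    have mW : measurable_fun (cyl Omega Y) W.
      apply: (eq_measurable_fun w); first by move=> z; rewrite inE => /wW.
      by apply: continuous_rv_measurable => //; exact: lip_continuous wL.
    have mwt : measurable_fun (cyl Omega Y) (weight s) by exact: measurable_weight.
    have mwg i : measurable_fun (cyl Omega Y) (fun x => wgrad (cyl Omega Y) W x 0 i).
      by apply: wgrad_measurable; exists G.
    have mwh k : measurable_fun (cyl Omega Y) (fun z => hor (wgrad (cyl Omega Y) W z) 0 k).
      by under eq_fun do rewrite mxE; exact: mwg.
    apply: measurable_funD; last first.
      apply: measurable_funM => //; apply: measurable_funM => //; apply: measurable_funM => //.
      exact: (measurable_hor_comp oO mc).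
    apply: measurable_funM => //; apply: measurable_funD; last first.
      exact: (measurable_funM (mwg ord_max) (mwg ord_max)).
    rewrite (_ : (fun z => _) = (fun z => \sum_i \sum_j A (hor z) i j *
        (hor (wgrad (cyl Omega Y) W z) 0 j * hor (wgrad (cyl Omega Y) W z) 0 i))); last first.
      by apply/funext => z; rewrite dot_flux.
    apply: (measurable_sum (index_enum 'I_n)) => i.
    apply: (measurable_sum (index_enum 'I_n)) => j.
    apply: measurable_funM; last exact: (measurable_funM (mwh j) (mwh i)).
    exact: (measurable_hor_comp oO (A_measurable oO HA i j)).
  rewrite /Rintegral; congr fine; apply: ae_eq_integral => //.
  - exact/measurable_EFinP.
  - by case/integrableP: ip.
  - by apply: filterS aeE => z H Cz; rewrite /= H.
rewrite EE -(RintegralZl a1 mC iG).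
have := @ae_Rintegral_ge0 _ _ _ leb (cyl Omega Y)
  (fun z => weight s z * p z - a1 * (weight s z * dot (G z) (G z))) mC.
have iaG := integrableZl mC a1 iG.
rewrite (RintegralB mC ip iaG) subr_ge0; apply.
  exact: (integrableB mC ip iaG).
apply: filterS aec => z H Cz; have /andP[c0 _] := H Cz.
by rewrite mulrCA -mulrBr mulr_ge0 ?powR_ge0// subr_ge0 p_ge.
Qed.
End trace_and_coercivity.

(** * Time stepping *)

Section fractional_integral.
Context {R : realType}.
Local Notation mu := (@lebesgue_measure R).

(** For b < 1 the kernel is singular at r = T, which is reached when [u = T]; hence the fundamental
    theorem on open intervals. *)
Lemma integral_kernel (T b t u : R) : 0 < b -> 0 <= t -> t < u -> u <= T ->
  (\int[mu]_(r in `]t, u[) ((T - r) `^ (b - 1))%:E =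
   (((T - t) `^ b - (T - u) `^ b) / b)%:E)%E.
Proof.
move=> b0 t0 tu uT.
pose F r := - (b^-1 * (T - r) `^ b).
have -> : ((T - t) `^ b - (T - u) `^ b) / b = F u - F t by rewrite /F; ring.
have pos r : r < u -> 0 < T - r by move=> ru; rewrite subr_gt0 (lt_le_trans ru).
have dT (r : R) : is_derive r (1 : R) (fun r => T - r) (- 1).
  have K := is_deriveB (is_derive_cst T r 1) (is_derive_id r (1 : R)).
  by apply: (is_derive_eq K); rewrite sub0r.
have cT (r : R) : {for r, continuous (fun r : R => T - r)}.
  by apply: cvgB; [exact: cvg_cst|exact: cvg_id].
have dP (r : R) : r < u -> is_derive r (1 : R) (fun r => (T - r) `^ b)
    (- (b * (T - r) `^ (b - 1))).
  move=> ru; have H := is_derive1_powR b (pos r ru).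
  have := @is_derive1_comp R (fun x => x `^ b) (fun r => T - r) r _ _ H (dT r).
  by rewrite /GRing.scale/= mulrN1.
have dF r : r < u -> is_derive r (1 : R) F ((T - r) `^ (b - 1)).
  move=> ru; have K := is_deriveN (is_deriveZ b^-1 (dP r ru)).
  apply: (is_derive_eq K); rewrite /GRing.scale/= mulrN opprK mulrA mulVf ?mul1r//.
  by rewrite gt_eqF.
apply: FTC_oo => //.
- by move=> r /andP[_ ru]; exact: dF.
- move=> r /andP[_ ru].
  apply: (@continuous_comp _ _ _ (fun r => T - r) (fun x => x `^ (b - 1))); first exact: cT.
  by apply: continuous_powR; exact: pos.
- by move=> r _; exact: powR_ge0.
- apply: cvg_at_right_filter; apply/differentiable_continuous/derivable1_diffP.
  by have [] := dF t tu.
- move: uT; rewrite le_eqVlt => /predU1P[uT|uT]; last first.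
    apply: cvg_at_left_filter; apply: cvgN; apply: cvgM; first exact: cvg_cst.
    apply: (@continuous_comp _ _ _ (fun r => T - r) (fun x => x `^ b)); first exact: cT.
    by apply: continuous_powR; rewrite subr_gt0.
  apply: cvgN; apply: cvgM; first exact: cvg_cst.
  rewrite uT subrr powR0 ?gt_eqF//; apply/cvg_at_leftP => v [vu vc].
  have /cvg_at_rightP/(_ (fun k => T - v k)) := powR_cvg0 b0; apply; split.
    by move=> k; rewrite subr_gt0.
  by rewrite -[X in _ --> X](subrr T); apply: cvgB => //; exact: cvg_cst.
Qed.

Lemma step_funE (tau : R) (g : nat -> R) l r : 0 < tau ->
  l%:R * tau < r <= l.+1%:R * tau -> step_fun tau g r = g l.+1.
Proof.
move=> tau0 /andP[r1 r2]; rewrite /step_fun (_ : Num.ceil _ = l.+1%:Z)//.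
apply/eqP; rewrite ceil_eq ltr_pdivlMr// ler_pdivrMr//.
by rewrite -pmulrn r2 andbT -addn1 PoszD addrK -pmulrn.
Qed.

(** Intervals closed on the right match the pieces of the step function, so the induction adds one
    piece at a time; measurability is carried along because splitting the integral requires it. *)
Lemma integral_step (b tau : R) (g : nat -> R) m l : 0 < b -> 0 < tau ->
  (forall k, 0 <= g k) -> (l <= m)%N ->
  let F r := (m%:R * tau - r) `^ (b - 1) * step_fun tau g r in
  measurable_fun `]0, l%:R * tau] F /\
  (\int[mu]_(r in `]0%R, (l%:R * tau)%R]) (F r)%:E = (b^-1 * tau `^ b *
    \sum_(i < l) ((m - i)%:R `^ b - (m - i.+1)%:R `^ b) * g i.+1)%:E)%E.
Proof.
move=> b0 tau0 g0 + F; have tau0' := ltW tau0.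
have F0 r : 0 <= F r by rewrite mulr_ge0 ?powR_ge0// /step_fun.
elim: l => [_|l IH lm].
  rewrite mul0r set_itvoc0 big_ord0 mulr0 integral_set0; split=> //.
  exact: measurable_fun_set0.
have [m1 I1] := IH (ltnW lm).
pose t := l%:R * tau; pose u := l.+1%:R * tau.
have t0 : 0 <= t by rewrite mulr_ge0.
have tu : t < u by rewrite ltr_pM2r// ltr_nat.
have uT : u <= m%:R * tau by rewrite ler_pM2r// ler_nat.
have U : `]0, u]%classic = `]0, t]%classic `|` `]t, u]%classic :> set R.
  apply/seteqP; split=> r /=; rewrite !in_itv/=.
    by move=> /andP[r0 ru]; case: (leP r t) => rt; [left|right]; rewrite ?r0.
  move=> [/andP[r0 rt]|/andP[tr ru]]; first by rewrite r0 (le_trans rt)// ltW.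
  by rewrite ru (le_lt_trans t0).
have FE r : `]t, u]%classic r -> F r = (m%:R * tau - r) `^ (b - 1) * g l.+1.
  by rewrite /= in_itv/= => tru; rewrite /F (step_funE g tau0 tru).
have mk : measurable_fun setT (fun r : R => (m%:R * tau - r) `^ (b - 1)).
  by apply: (measurableT_comp (measurable_powR _)); exact: measurable_funB.
have m2 : measurable_fun `]t, u] F.
  have mf : measurable_fun `]t, u] (fun r => (m%:R * tau - r) `^ (b - 1) * g l.+1).
    by apply: measurable_funM => //; exact: measurable_funTS.
  by apply: eq_measurable_fun mf => r; rewrite inE => /FE.
have mF : measurable_fun `]0, u] F.
  by rewrite U; apply/measurable_funU.
split => //; rewrite -/u U ge0_integral_setU//; last first.
- apply/disj_setPS => r [] /=; rewrite !in_itv/= => /andP[_ rt] /andP[tr _].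
  by move: (lt_le_trans tr rt); rewrite ltxx.
- by move=> r _; rewrite lee_fin.
- by rewrite -U; apply/measurable_EFinP.
rewrite I1 big_ord_recr /=.
rewrite (_ : (\int[mu]_(r in `]t, u]) (F r)%:E =
    \int[mu]_(r in `]t, u]) ((g l.+1)%:E * ((m%:R * tau - r) `^ (b - 1))%:E))%E); last first.
  by apply: eq_integral => r; rewrite inE => /FE ->; rewrite mulrC EFinM.
rewrite ge0_integralZl//; last 3 first.
- by apply/measurable_EFinP; exact: measurable_funTS.
- by move=> r _; rewrite lee_fin powR_ge0.
- by rewrite lee_fin.
rewrite -integral_itv_bndo_bndc; last by apply/measurable_EFinP; exact: measurable_funTS.
rewrite integral_kernel// -EFinM -EFinD; congr EFin.
rewrite /t /u -!mulrBl -!natrB//; last exact: ltnW.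
rewrite !powRM//; field; rewrite gt_eqF//.
Qed.

Lemma frac_int_step (b tau : R) (g : nat -> R) m : 0 < b -> 0 < tau ->
  (forall k, 0 <= g k) ->
  frac_int b (step_fun tau g) (m%:R * tau) = (EulerGamma b)^-1 * (b^-1 * tau `^ b *
    \sum_(j < m) (j.+1%:R `^ b - j%:R `^ b) * g (m - j)%N).
Proof.
move=> b0 tau0 g0; rewrite /frac_int gt_eqF//; congr (_ * _).
have [mF IF] := integral_step b0 tau0 g0 (leqnn m).
rewrite /Rintegral integral_itv_bndo_bndc; last first.
  apply/measurable_EFinP; apply: measurable_funS mF => //.
  by move=> r /=; rewrite !in_itv/= => /andP[-> /ltW].
(* Reversing the order of summation turns the kernel increments into (j + 1)^b - j^b paired with
   [g (m - j)], as in the discrete derivative. *)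
rewrite IF /=; congr (_ * _); rewrite (reindex_inj rev_ord_inj) /=.
apply: eq_bigr => j _; have jm := ltn_ord j.
by rewrite subKn// -subSn// subSS subKn 1?ltnW// subnSK.
Qed.
End fractional_integral.

(** * Discrete fractional derivative *)

Section discrete_derivative.
Context {R : realType}.

(** Concavity of x^b at the midpoint of j and j + 2, read off from the convexity of its inverse
    x^(1/b). *)
Lemma concave_powR_incr (b : R) (j : nat) : 0 < b < 1 ->
  j.+2%:R `^ b - j.+1%:R `^ b <= j.+1%:R `^ b - j%:R `^ b :> R.
Proof.
move=> /andP[b0 b1].
have p1 : 1 <= b^-1 by rewrite invf_ge1// ltW.
pose u : R := j.+2%:R `^ b; pose v : R := j%:R `^ b.
have u0 : 0 <= u := powR_ge0 _ _; have v0 : 0 <= v := powR_ge0 _ _.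
have K (x : R) : 0 <= x -> (x `^ b) `^ b^-1 = x.
  by move=> x0; rewrite -powRrM mulfV ?gt_eqF// powRr1.
have H : ((u + v) / 2) `^ b^-1 <= (u `^ b^-1 + v `^ b^-1) / 2.
  have h1 : 0 <= 2^-1 :> R by rewrite invr_ge0.
  have h2 : 2^-1 <= 1 :> R by rewrite invf_le1// ler1n.
  have h : (2^-1 * u + (1 - 2^-1) * v) `^ b^-1 <=
      2^-1 * u `^ b^-1 + (1 - 2^-1) * v `^ b^-1.
    by apply: (convex_powR p1 (Itv01 h1 h2)); rewrite inE /= in_itv /= andbT.
  have h3 : 1 - 2^-1 = 2^-1 :> R by lra.
  by rewrite h3 -!mulrDr ![2^-1 * _]mulrC in h.
suff : (u + v) / 2 <= j.+1%:R `^ b by rewrite /u /v; lra.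
move: H; rewrite !K// => H.
have -> : (u + v) / 2 = (((u + v) / 2) `^ b^-1) `^ b.
  by rewrite -powRrM mulVf ?gt_eqF// powRr1// divr_ge0// addr_ge0.
apply: ge0_ler_powR; rewrite ?nnegrE ?powR_ge0//; first exact: ltW.
by apply: le_trans H _; rewrite -!natrD !addSn; nra.
Qed.
End discrete_derivative.

Section discrete_energy.
Context {R : realType}.
Variables (gamma tau : R).
Hypotheses (g01 : 0 < gamma <= 1) (tau0 : 0 < tau).

(** Besides the boundary term, summation by parts leaves only the products
    [(b j - b j.+1) * e j.+1], all nonnegative. *)
Lemma abel_ge (b e : nat -> R) m : (forall j, 0 <= b j) -> (forall j, b j.+1 <= b j) ->
  e 0%N = 0 -> (forall j, 0 <= e j) ->
  b m * e m.+1 <= \sum_(j < m.+1) b j * (e j.+1 - e j).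
Proof.
move=> b0 bd e0 eg; elim: m => [|m IH]; first by rewrite big_ord_recr big_ord0 /= add0r e0 subr0.
rewrite big_ord_recr /=; apply: le_trans (lerD IH (lexx _)).
have := ler_wpM2r (eg m.+1) (bd m); rewrite mulrBr; lra.
Qed.

(** One family of weights for both cases; when gamma = 1 only the weight of index 0 survives, which
    keeps the family nonincreasing. *)
Definition fd_coef (j : nat) : R :=
  if gamma == 1 then (if j == 0%N then tau^-1 else 0)
  else (EulerGamma (2 - gamma))^-1 *
    ((j.+1%:R `^ (1 - gamma) - j%:R `^ (1 - gamma)) * tau `^ (- gamma)).

Lemma frac_diffE g k : frac_diff gamma tau g k =
  \sum_(j < k.+1) fd_coef j * (g (k.+1 - j)%N - g (k - j)%N).
Proof.
rewrite /frac_diff /fd_coef; case: ifP => _.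
  rewrite big_ord_recl /= !subn0 big1 ?addr0// => i _.
  by rewrite mul0r.
rewrite big_mkord mulr_sumr; apply: eq_bigr => j _; by rewrite !mulrA.
Qed.

Lemma gamma_lt1 : gamma != 1 -> 0 < 1 - gamma < 1.
Proof. by have /andP[h0 h1] := g01 => gn; move: h1; rewrite le_eqVlt (negPf gn)/=; lra. Qed.

Lemma fd_coef_ge0 j : 0 <= fd_coef j.
Proof.
rewrite /fd_coef; case: eqVneq => [_|/gamma_lt1 /andP[h0 h1]].
  by case: ifP => // _; rewrite invr_ge0 ltW.
rewrite mulr_ge0 ?invr_ge0 ?mulr_ge0 ?powR_ge0//.
  by apply: ltW; apply: EulerGamma_gt0; lra.
by rewrite subr_ge0 ge0_ler_powR ?nnegrE ?ler_nat// ltW.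
Qed.

Lemma fd_coef_decr j : fd_coef j.+1 <= fd_coef j.
Proof.
rewrite /fd_coef; case: eqVneq => [_ /=|/gamma_lt1 h].
  by case: ifP => // _; rewrite invr_ge0 ltW.
rewrite ler_wpM2l ?invr_ge0//.
  by apply: ltW; apply: EulerGamma_gt0; lra.
by rewrite ler_wpM2r ?powR_ge0//; exact: concave_powR_incr.
Qed.

(** With z the last value, 2 z (x - y) - (x^2 - y^2) = (z - y)^2 - (z - x)^2. Hence twice the gap
    between the two sides is a weighted sum of increments of [e], to which summation by parts
    applies. *)
Lemma frac_diff_mul (g : nat -> R) k :
  2^-1 * frac_diff gamma tau (fun j => g j ^+ 2) k <= frac_diff gamma tau g k * g k.+1.
Proof.
rewrite -subr_ge0 !frac_diffE.
pose e j := (g k.+1 - g (k.+1 - j)%N) ^+ 2.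
have e0 : e 0%N = 0 by rewrite /e subn0 subrr expr0n.
have eg j : 0 <= e j by exact: sqr_ge0.
have := @abel_ge fd_coef e k fd_coef_ge0 fd_coef_decr e0 eg.
have h := mulr_ge0 (fd_coef_ge0 k) (eg k.+1).
move=> /(le_trans h) H.
rewrite (_ : _ - _ = 2^-1 * \sum_(j < k.+1) fd_coef j * (e j.+1 - e j)); first by rewrite mulr_ge0// invr_ge0.
rewrite mulr_suml !mulr_sumr -sumrB; apply: eq_bigr => j _.
by rewrite /e subSS; field.
Qed.

(** After exchanging the sums, the differences carrying a fixed weight [fd_coef j] telescope. *)
Lemma frac_diff_sum g m : \sum_(k < m) frac_diff gamma tau g k =
  \sum_(j < m) fd_coef j * (g (m - j)%N - g 0%N).
Proof.
elim: m => [|m IH]; first by rewrite !big_ord0.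
rewrite big_ord_recr IH /= frac_diffE.
rewrite big_ord_recr /= [in RHS]big_ord_recr /= subSnn subnn addrA; congr (_ + _).
rewrite -big_split; apply: eq_bigr => j _ /=.
by ring.
Qed.

(** For gamma < 1 this is (1 - gamma) Gamma(1 - gamma) / Gamma(2 - gamma), equal to 1 by the
    functional equation of Gamma; it is carried as a positive factor free of tau. *)
Definition fd_ratio : R := if gamma == 1 then 1
  else (EulerGamma (2 - gamma))^-1 * (EulerGamma (1 - gamma) * (1 - gamma)).

Lemma fd_ratio_gt0 : 0 < fd_ratio.
Proof.
rewrite /fd_ratio; case: eqVneq => // /gamma_lt1 /andP[h0 h1].
rewrite mulr_gt0 ?invr_gt0 ?mulr_gt0//; apply: EulerGamma_gt0; lra.
Qed.

Lemma step_fun_end (g : nat -> R) m : step_fun tau g (m%:R * tau) = g m.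
Proof.
case: m => [|m]; first by rewrite /step_fun !mul0r ceil0.
by rewrite (@step_funE _ tau g m)// lexx andbT ltr_pM2r// ltr_nat.
Qed.

Lemma frac_int_ge0 (g : nat -> R) m : (forall k, 0 <= g k) ->
  0 <= frac_int (1 - gamma) (step_fun tau g) (m%:R * tau).
Proof.
move=> g0; have [gE|/gamma_lt1 /andP[h0 h1]] := eqVneq gamma 1.
  by rewrite /frac_int gE subrr eqxx step_fun_end.
rewrite frac_int_step// mulr_ge0//.
  by rewrite invr_ge0; apply: ltW; apply: EulerGamma_gt0; lra.
rewrite !mulr_ge0 ?powR_ge0 ?invr_ge0 ?(ltW h0)//; apply: sumr_ge0 => j _.
by rewrite mulr_ge0// subr_ge0 ge0_ler_powR ?nnegrE ?ler_nat// ltW.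
Qed.

(** Up to a common factor, the weights of the scheme are the integrals of the fractional kernel over
    the time steps, so the identity is exact. The initial value enters as the step function of a
    constant sequence. *)
Lemma frac_diff_frac_int (g : nat -> R) m : (0 < m)%N -> (forall k, 0 <= g k) ->
  \sum_(k < m) tau * frac_diff gamma tau g k =
  fd_ratio * (frac_int (1 - gamma) (step_fun tau g) (m%:R * tau) -
              frac_int (1 - gamma) (fun=> g 0%N) (m%:R * tau)).
Proof.
move=> m0 g0; rewrite -mulr_sumr frac_diff_sum /fd_ratio /fd_coef.
have [gE|/gamma_lt1 /andP[h0 h1]] := eqVneq gamma 1.
  rewrite /frac_int gE subrr eqxx step_fun_end mul1r.
  case: m m0 => // m _; rewrite big_ord_recl /= subn0 big1 => [|j _]; last by rewrite mul0r.
  by rewrite addr0 mulrA mulfV ?gt_eqF// mul1r.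
have -> : (fun=> g 0%N) = step_fun tau (fun=> g 0%N) by [].
have G0 : 0 < EulerGamma (1 - gamma) by apply: EulerGamma_gt0; lra.
rewrite !frac_int_step// -mulrBr -mulrBr -sumrB.
have tE : tau `^ (1 - gamma) = tau * tau `^ (- gamma).
  by rewrite powRD ?gt_eqF ?implybT// powRr1 ?ltW.
rewrite tE; set E := EulerGamma (2 - gamma); set E1 := EulerGamma (1 - gamma) in G0 *.
have alg (t S : R) : E^-1 * (E1 * (1 - gamma)) * (E1^-1 * ((1 - gamma)^-1 * t * S)) =
    E^-1 * t * S.
  have -> : E^-1 * (E1 * (1 - gamma)) * (E1^-1 * ((1 - gamma)^-1 * t * S)) =
      E^-1 * ((E1 * E1^-1) * ((1 - gamma) * (1 - gamma)^-1) * t * S) by ring.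
  have n1 : E1 != 0 by rewrite gt_eqF.
  have n2 : 1 - gamma != 0 by rewrite gt_eqF.
  by rewrite (mulfV n1) (mulfV n2) !mul1r mulrA.
rewrite alg.
rewrite !mulr_sumr; apply: eq_bigr => j _; ring.
Qed.
End discrete_energy.

(** * Discrete energy inequality in L^2 *)

Section discrete_L2.
Context {R : realType} {n : nat}.
Variables (Omega : set 'rV[R]_n) (gamma tau : R).
Hypotheses (oO : open Omega) (g01 : 0 < gamma <= 1) (tau0 : 0 < tau).
Let mO : measurable Omega. Proof. exact: open_rv_measurable. Qed.

Lemma L2norm_sqr (w : 'rV[R]_n -> R) :
  L2norm Omega w ^+ 2 = \int[leb]_(x in Omega) (w x ^+ 2).
Proof.
rewrite /L2norm sqr_sqrtr; last first.
  by apply/fine_ge0/integral_ge0 => x _; rewrite lee_fin mulr_ge0 ?sqr_ge0 /one_weight.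
by rewrite /L2sq /Rintegral; congr fine; apply: eq_integral => x _; rewrite /one_weight mul1r.
Qed.

Lemma frac_diff_L2 (r : nat -> 'rV[R]_n -> R) k :
  (forall j, (j <= k.+1)%N -> L2 Omega one_weight (r j)) ->
  2^-1 * frac_diff gamma tau (fun j => L2norm Omega (r j) ^+ 2) k <=
  L2dot Omega (fun x => frac_diff gamma tau (fun j => r j x) k) (r k.+1).
Proof.
move=> r2.
have sq j : (j <= k.+1)%N -> leb.-integrable Omega (EFin \o (fun x => r j x ^+ 2)).
  by move=> jk; apply: L2_sq_integrable => //; exact: r2.
have pr j : (j <= k.+1)%N -> leb.-integrable Omega (EFin \o (fun x => r j x * r k.+1 x)).
  by move=> jk; apply: L2_mul_integrable => //; exact: r2.
have l1 j : (k.+1 - j <= k.+1)%N by rewrite leq_subr.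
have l2 j : (k - j <= k.+1)%N by apply: leq_trans (leq_subr _ _) _.
pose b := fd_coef gamma tau.
have i1 j : leb.-integrable Omega (EFin \o
    (fun x => 2^-1 * b j * (r (k.+1 - j)%N x ^+ 2 - r (k - j)%N x ^+ 2))).
  exact: (integrableZl mO (2^-1 * b j) (integrableB mO (sq _ (l1 j)) (sq _ (l2 j)))).
have i2 j : leb.-integrable Omega (EFin \o
    (fun x => b j * (r (k.+1 - j)%N x * r k.+1 x - r (k - j)%N x * r k.+1 x))).
  exact: (integrableZl mO (b j) (integrableB mO (pr _ (l1 j)) (pr _ (l2 j)))).
have [I1 E1] := Rintegral_sum (index_enum 'I_k.+1) mO (fun j : 'I_k.+1 => i1 j).
have [I2 E2] := Rintegral_sum (index_enum 'I_k.+1) mO (fun j : 'I_k.+1 => i2 j).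
have -> : L2dot Omega (fun x => frac_diff gamma tau (fun j => r j x) k) (r k.+1) =
    \int[leb]_(x in Omega) (\sum_(j < k.+1)
      b j * (r (k.+1 - j)%N x * r k.+1 x - r (k - j)%N x * r k.+1 x)).
  apply: eq_Rintegral => x _; rewrite frac_diffE mulr_suml; apply: eq_bigr => j _.
  by rewrite /b; ring.
have -> : 2^-1 * frac_diff gamma tau (fun j => L2norm Omega (r j) ^+ 2) k =
    \int[leb]_(x in Omega) (\sum_(j < k.+1)
      2^-1 * b j * (r (k.+1 - j)%N x ^+ 2 - r (k - j)%N x ^+ 2)).
  rewrite E1 frac_diffE mulr_sumr; apply: eq_bigr => j _.
  rewrite !L2norm_sqr mulrA -/b.
  rewrite (RintegralZl (2^-1 * b j) mO (integrableB mO (sq _ (l1 j)) (sq _ (l2 j)))).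
  by rewrite (RintegralB mO (sq _ (l1 j)) (sq _ (l2 j))).
apply: (le_Rintegral mO I1 I2) => x _.
have := frac_diff_mul g01 tau0 (fun j => r j x) k.
rewrite !frac_diffE mulr_sumr mulr_suml; congr (_ <= _); apply: eq_bigr => j _; rewrite /b; ring.
Qed.
End discrete_L2.

(** * Duality in the spectral spaces *)

Section dual_norm.
Context {R : realType} {n : nat}.
Variables (Omega : set 'rV[R]_n) (lam : nat -> R) (phi : nat -> 'rV[R]_n -> R) (s : R).
Hypotheses (oO : open Omega) (phi2 : forall k, L2 Omega one_weight (phi k)).
Let mO : measurable Omega. Proof. exact: open_rv_measurable. Qed.
Local Notation Hs := (Hs Omega lam phi s).
Local Notation Hs_norm := (Hs_norm Omega lam phi s).

Lemma Hs_scale a w : Hs w -> Hs (fun x => a * w x) /\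
  Hs_norm (fun x => a * w x) = `|a| * Hs_norm w.
Proof.
move=> [w2 ws]; have [mw wL] := w2.
have iw := L2_sq_integrable w2.
have L2a : L2 Omega one_weight (fun x => a * w x).
  split; first exact: measurable_funM.
  have /integrableP[_] := integrableZl mO (a ^+ 2) iw; congr (_ < _)%E.
  apply: eq_integral => x _ /=; rewrite ger0_norm; last by apply: mulr_ge0; exact: sqr_ge0.
  by rewrite /one_weight mul1r exprMn.
have E : Hs_sq Omega lam phi s (fun x => a * w x) =
    ((a ^+ 2)%:E * Hs_sq Omega lam phi s w)%E.
  rewrite /Hs_sq -nneseriesZl//; last first.
    by move=> k _; rewrite lee_fin mulr_ge0 ?powR_ge0 ?sqr_ge0.
  apply: eq_eseriesr => k _; rewrite -EFinM; congr EFin.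
  have -> : L2dot Omega (fun x => a * w x) (phi k) = a * L2dot Omega w (phi k).
    rewrite /L2dot -(RintegralZl a mO (L2_mul_integrable oO w2 (phi2 k))).
    by apply: eq_Rintegral => y _; rewrite mulrA.
  ring.
have s0 : (0 <= Hs_sq Omega lam phi s w)%E.
  by apply: nneseries_ge0 => k _ _; rewrite lee_fin mulr_ge0 ?powR_ge0 ?sqr_ge0.
have fs : Hs_sq Omega lam phi s w \is a fin_num by rewrite ge0_fin_numE.
split; first by split=> //; rewrite E -(fineK fs) -EFinM ltry.
rewrite /Defs.Hs_norm E -(fineK fs) -EFinM /= sqrtrM ?sqr_ge0// sqrtr_sqr.
by [].
Qed.

Lemma Hs0 : Hs (fun=> 0).
Proof.
split; first split.
- exact: measurable_cst.
- by rewrite /L2sq integral0_eq ?ltry// => x _; rewrite expr0n /= mulr0.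
rewrite /Hs_sq eseries0 ?ltry// => k _ _; rewrite /L2dot.
rewrite (_ : (fun x => _) = fun=> 0); last by apply/funext => x; rewrite mul0r.
by rewrite Rintegral_cst// mul0r expr0n /= mulr0.
Qed.

(** [w] is scaled to norm 1, and the bound [C] in [Hs_dual] keeps the set of values bounded, so that
    its [sup] is a genuine upper bound. At norm 0, boundedness forces [F w = 0]. *)
Lemma Hs_dual_le F w : Hs_dual Omega lam phi s F -> Hs w ->
  `|F w| <= Hs_dual_norm Omega lam phi s F * Hs_norm w.
Proof.
move=> [lin [C HC]] Hw; have [hw|hw] := eqVneq (Hs_norm w) 0.
  by have := HC w Hw; rewrite hw !mulr0.
have hp : 0 < Hs_norm w by rewrite lt_def hw sqrtr_ge0.
have F0 : F (fun=> 0) = 0.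
  have := lin 1 _ _ Hs0 Hs0; rewrite (_ : (fun x => _) = fun=> 0); last first.
    by apply/funext => x; rewrite mulr0 addr0.
  by rewrite mul1r => /eqP; rewrite -subr_eq subrr eq_sym => /eqP.
have FZ a : F (fun x => a * w x) = a * F w.
  have := lin a _ _ Hw Hs0; rewrite F0 addr0 => <-; congr F.
  by apply/funext => x; rewrite addr0.
have [Hv nv] := Hs_scale (Hs_norm w)^-1 Hw.
rewrite -ler_pdivrMr// /Hs_dual_norm.
have -> : `|F w| / Hs_norm w = `|F (fun x => (Hs_norm w)^-1 * w x)|.
  by rewrite FZ normrM gtr0_norm ?invr_gt0// mulrC.
apply: ub_le_sup; last first.
  exists (fun x => (Hs_norm w)^-1 * w x) => //; split=> //.
  by rewrite nv gtr0_norm ?invr_gt0// mulVf.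
exists `|C| => _ [v [Hv' nv'] <-]; apply: le_trans (HC v Hv') _.
apply: le_trans (ler_wpM2r (sqrtr_ge0 _) (ler_norm C)) _.
by rewrite -[leRHS]mulr1 ler_wpM2l.
Qed.
End dual_norm.

Theorem lemma5p1 (R : realType) (n : nat) (Omega : set 'rV[R]_n)
    (A : 'rV[R]_n -> 'M[R]_n) (c : 'rV[R]_n -> R)
    (lam : nat -> R) (phi : nat -> 'rV[R]_n -> R) (T s gamma : R) :
  (1 <= n)%N ->
  open Omega -> bounded_set Omega -> connected Omega ->
  polyhedral_boundary Omega ->
  admissible_A Omega A -> admissible_c Omega c -> H2_regular Omega A c ->
  dirichlet_eigenpairs Omega A c lam phi ->
  0 < T -> 0 < s < 1 -> 0 < gamma <= 1 ->
  exists2 C : R, 0 < C &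
    forall (Y : R) (N : nat) (K : 'I_N -> cell R n) (sigma : R)
      (M : nat) (yy : nat -> R) (KK : nat) (tau : R)
      (u0 : 'rV[R]_n -> R) (U0 : 'rV[R]_n.+1 -> R)
      (f : R -> ('rV[R]_n -> R) -> R) (V : nat -> 'rV[R]_n.+1 -> R),
    1 <= Y ->
    conforming_mesh Omega K -> shape_regular sigma K -> is_partition Y M yy ->
    (1 <= KK)%N -> tau = T / KK%:R ->
    (forall t, 0 < t <= T -> Hs_dual Omega lam phi s (f t)) ->
    is_alpha_harmonic_extension Omega Y A c s u0 U0 ->
    is_galerkin_projection Omega Y A c s K M yy U0 (V 0%N) ->
    fully_discrete_scheme Omega Y A c s gamma tau K M yy f KK V ->
    frac_int (1 - gamma)
      (step_fun tau (fun k => L2norm Omega (restr0 (V k)) ^+ 2)) T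
    + \sum_(1 <= k < KK.+1) tau * H1L_norm Omega Y s (V k) ^+ 2
    <= C * (frac_int (1 - gamma) (fun=> L2norm Omega (restr0 (V 0%N)) ^+ 2) T
      + \sum_(1 <= k < KK.+1)
          tau * Hs_dual_norm Omega lam phi s (f (k%:R * tau)) ^+ 2).
Proof.
move=> n1 oO bO _ _ HA Hc _ eig T0 s01 g01.
(* The final constant is built from [Ct], [c0] and [kap] only, all obtained before the height, the
   mesh, the time step and the data are introduced. *)
have [Ct Ct0 Htr] := fe_trace n1 oO bO HA Hc eig s01.
have [c0 c00 Hco] := fe_coercive n1 oO bO HA Hc s01.
pose kap := fd_ratio gamma; have kap0 : 0 < kap by exact: fd_ratio_gt0.
(* The smaller of the two factors left on the energy side once the estimate is summed in time. *)
pose m0 := Num.min (kap / 2) (c0 / 2).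
have m00 : 0 < m0 by rewrite lt_min !divr_gt0.
(* Young's inequality, with half of the coercivity kept on the left; [Ct + 1] instead of [Ct]
   ensures a positive constant. *)
pose C1 := (Ct + 1) / (2 * c0); have C10 : 0 < C1 by rewrite divr_gt0 ?mulr_gt0// ltr_wpDl.
exists ((kap / 2 + C1) / m0) => [|Y N K sigma M yy KK tau u0 U0 f V Y1 [ndK covK _] _ part KK1 tauE fH _ [V0 _] scheme].
  by rewrite divr_gt0// addr_gt0// divr_gt0.
have Y0 : 0 < Y by exact: lt_le_trans Y1.
have KK0 : 0 < KK%:R :> R by rewrite ltr0n.
have tau0 : 0 < tau by rewrite tauE divr_gt0.
have TE : T = KK%:R * tau by rewrite tauE mulrC divfK// gt_eqF.
have VV k : (k <= KK)%N -> in_V Omega Y K M yy (V k).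
  by case: k => [//|k kK]; have [] := scheme k kK.
have V2 k : (k <= KK)%N -> L2 Omega one_weight (restr0 (V k)).
  by move=> kK; exact: (fe_restr0_L2 n1 oO bO Y0 ndK covK part (VV k kK)).
have phi2 k : L2 Omega one_weight (phi k) by have [/(_ k) [[]]] := eig.
pose nr k := L2norm Omega (restr0 (V k)) ^+ 2.
pose G k := H1L_norm Omega Y s (V k) ^+ 2.
pose D k := Hs_dual_norm Omega lam phi s (f (k%:R * tau)).
have nr0 k : 0 <= nr k by exact: sqr_ge0.
have step k : (k < KK)%N ->
    2^-1 * frac_diff gamma tau nr k + c0 / 2 * G k.+1 <= C1 * D k.+1 ^+ 2.
  move=> kK; have [Vk Hk] := scheme k kK; have := Hk _ Vk.
  have HL := @frac_diff_L2 _ _ Omega gamma tau oO g01 tau0 (fun j => restr0 (V j)) k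
    (fun j jk => V2 j (leq_trans jk kK)).
  have [gfin HsV] := Htr Y N K M yy _ Y0 ndK covK part Vk.
  have HC := Hco Y N K M yy _ Y0 ndK covK part Vk.
  have GE : fine (gradsq (cyl Omega Y) (weight s) (V k.+1)) = G k.+1.
    rewrite /G /H1L_norm sqr_sqrtr//; apply/fine_ge0/integral_ge0 => z _.
    by rewrite lee_fin mulr_ge0 ?powR_ge0 ?dot_ge0.
  have G0 : 0 <= G k.+1 by exact: sqr_ge0.
  rewrite GE in HC; rewrite -(fineK gfin) GE -EFinM in HsV.
  have HsV' : Hs Omega lam phi s (restr0 (V k.+1)).
    by split; [exact: V2|exact: le_lt_trans HsV (ltry _)].
  have Hs0 : (0 <= Hs_sq Omega lam phi s (restr0 (V k.+1)))%E.
    by apply: nneseries_ge0 => j _ _; rewrite lee_fin mulr_ge0 ?powR_ge0 ?sqr_ge0.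
  have Hsf : Hs_sq Omega lam phi s (restr0 (V k.+1)) \is a fin_num.
    by rewrite ge0_fin_numE//; exact: le_lt_trans HsV (ltry _).
  have h2 : Hs_norm Omega lam phi s (restr0 (V k.+1)) ^+ 2 <= (Ct + 1) * G k.+1.
    rewrite /Hs_norm sqr_sqrtr ?fine_ge0// -lee_fin fineK//.
    by apply: le_trans HsV _; rewrite lee_fin ler_wpM2r// lerDl.
  have tk : 0 < k.+1%:R * tau <= T.
    by rewrite mulr_gt0//= TE ler_pM2r// ler_nat.
  have := Hs_dual_le oO phi2 (fH _ tk) HsV'; rewrite -/(D k.+1).
  set h := Hs_norm _ _ _ _ _ in h2 *; set Fv := f _ _ => Fle E.
  have {Fle} : Fv <= D k.+1 * h by exact: le_trans (ler_norm _) Fle.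
  (* Young's inequality with the weight that makes h^2 absorbable into c0 G *)
  have : D k.+1 * h <= c0 / 2 * G k.+1 + C1 * D k.+1 ^+ 2.
    have Cp : 0 < Ct + 1 by rewrite ltr_wpDl.
    have H2 := sqr_ge0 (c0 * h - (Ct + 1) * D k.+1).
    have H1 := ler_wpM2l (mulr_ge0 (ltW c00) (ltW c00)) h2.
    rewrite -(ler_pM2l (mulr_gt0 (mulr_gt0 (ltr0Sn R 1) c00) Cp)).
    have -> : 2 * c0 * (Ct + 1) * (c0 / 2 * G k.+1 + C1 * D k.+1 ^+ 2) =
        c0 * c0 * ((Ct + 1) * G k.+1) + ((Ct + 1) * D k.+1) ^+ 2.
      by rewrite /C1; field; rewrite gt_eqF.
    have -> : 2 * c0 * (Ct + 1) * (D k.+1 * h) = 2 * (c0 * h * ((Ct + 1) * D k.+1)) by ring.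
    have E2 : (c0 * h - (Ct + 1) * D k.+1) ^+ 2 = c0 * c0 * h ^+ 2 -
      2 * (c0 * h * ((Ct + 1) * D k.+1)) + ((Ct + 1) * D k.+1) ^+ 2 by ring.
    lra.
  have : c0 * G k.+1 = c0 / 2 * G k.+1 + c0 / 2 * G k.+1 by field.
  rewrite -/nr in HL; lra.
have sum : \sum_(k < KK) tau * (2^-1 * frac_diff gamma tau nr k + c0 / 2 * G k.+1) <=
    \sum_(k < KK) tau * (C1 * D k.+1 ^+ 2).
  by apply: ler_sum => k _; rewrite ler_wpM2l ?(ltW tau0)//; exact: step.
have Fd := frac_diff_frac_int g01 tau0 KK1 nr0.
have I0 := frac_int_ge0 g01 tau0 KK nr0.
have J0 := @frac_int_ge0 _ gamma tau g01 tau0 (fun=> nr 0%N) KK (fun=> nr0 0%N).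
rewrite TE !big_add1 /= !big_mkord -/nr.
set I := frac_int _ _ _ in Fd I0 *; set J := frac_int _ _ _ in Fd *.
have {}J0 : 0 <= J by [].
pose SG := \sum_(k < KK) tau * G k.+1; pose SD := \sum_(k < KK) tau * D k.+1 ^+ 2.
have SG0 : 0 <= SG by apply: sumr_ge0 => k _; rewrite mulr_ge0 ?sqr_ge0// ltW.
have SD0 : 0 <= SD by apply: sumr_ge0 => k _; rewrite mulr_ge0 ?sqr_ge0// ltW.
(* Half of the summed discrete derivatives is [kap / 2] times the difference of the fractional
   integrals; the other terms, weighted by [tau], are the discrete norms in time. *)
have key : kap / 2 * I + c0 / 2 * SG <= kap / 2 * J + C1 * SD.
  move: sum; rewrite (eq_bigr (fun k : 'I_KK => 2^-1 * (tau * frac_diff gamma tau nr k) +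
    c0 / 2 * (tau * G k.+1))) => [|k _]; last by ring.
  have S1 : \sum_(k < KK) 2^-1 * (tau * frac_diff gamma tau nr k) = 2^-1 * (kap * (I - J)).
    by rewrite -mulr_sumr Fd.
  have S2 : \sum_(k < KK) c0 / 2 * (tau * G k.+1) = c0 / 2 * SG by rewrite -mulr_sumr.
  rewrite big_split /= S1 S2.
  rewrite [X in _ <= X -> _](eq_bigr (fun k : 'I_KK => C1 * (tau * D k.+1 ^+ 2))) => [|k _]; last by ring.
  have S3 : \sum_(k < KK) C1 * (tau * D k.+1 ^+ 2) = C1 * SD by rewrite -mulr_sumr.
  rewrite S3; lra.
change (I + SG <= (kap / 2 + C1) / m0 * (J + SD)).
rewrite mulrAC ler_pdivlMr// mulrC.
apply: (@le_trans _ _ (kap / 2 * I + c0 / 2 * SG)).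
  rewrite mulrDr; apply: lerD; rewrite ler_wpM2r//.
    by rewrite /m0 ge_min lexx.
  by rewrite /m0 ge_min lexx orbT.
(* The nonnegative cross terms [C1 * J] and [kap / 2 * SD] complete the product of the two sums. *)
apply: le_trans key _; rewrite mulrDl.
have := mulr_ge0 (ltW C10) J0; have := mulr_ge0 (ltW kap0) SD0.
rewrite !mulrDr; lra.
Qed.
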